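(* Consider a planning problem with deterministic dynamics, stochastic rewards with noise range $b>0$, discount factor $\gamma$ and reward range $R_{\max}$, with associated smoothness parameters $(\nu,\rho)$ and branching factor $\kappa=\kappa^u(\nu,\rho)$ with associated constant $C$. Let PlaT$\gamma$POOS be run with budget $n$. Suppose that $b$ is high enough that both high-noise conditions hold, namely $$\text{(i)}\quad \frac{\nu^2\rho^{2\tilde h}}{\gamma^{2\tilde h}\,\tilde h\, b^2 g}\le 1,$$ together with $$\text{(ii)}\quad \frac{\nu^2\rho^{2\tilde h_2}}{b^2 g}\le 1\ \text{ in the case }\gamma^2\kappa\le 1,\qquad \text{(iii)}\quad \frac{\nu^2\rho^{2\tilde h_1}}{b^2 g}\le 1\ \text{ in the case }\gamma^2\kappa> 1 .$$ Then the simple regret $r_n$ of PlaT$\gamma$POOS after $n$ rounds satisfies $$\mathbb{E}\, r_n=\begin{cases}\widetilde{O}\!\left(\left(\dfrac{n}{b^2}\right)^{-\frac12}\right) & \text{if } \gamma^2\kappa\le 1,\\[3mm] \widetilde{O}\!\left(\left(\dfrac{n}{b^2}\right)^{-\frac{\log(1/\rho)}{\log(\gamma^2\kappa/\rho^2)}}\right) & \text{if } \gamma^2\kappa>1.\end{cases}$$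
   Context: **Planning problem.** $X$ is a state space (possibly infinite), $A$ a finite action set with $|A|=K$, $f:X\times A\to X$ a deterministic transition function, $r:X\times A\to[0,R_{\max}]$ a mean reward function, $\gamma\in(0,1)$ a known discount factor, $x\in X$ a fixed initial state. A generative model may be queried at any state-action pair $(x',a')$; it returns $f(x',a')$ and a random reward with mean $r(x',a')$ that differs from $r(x',a')$ by at most $b$. The noises of different queries are independent. **Values and regret.** $Q^\star(x,a)$ is the optimal $\gamma$-discounted value of playing $a$ in $x$ and optimally afterwards. If $a(n)\in A$ is the recommended first action, the simple regret is $r_n=\max_{a\in A}Q^\star(x,a)-Q^\star(x,a(n))$. **Planning tree.** Nodes are finite action sequences $a\in A^\bullet=\bigcup_{h\ge0}A^h$; $h(a)$ is the length of $a=(a_0,\dots,a_{h(a)-1})$ and $a_{[h]}$ is its prefix of length $h$. For an infinite sequence $a\in A^\infty$, $v(a)=\sum_{t\ge 0}\gamma^t r(x_t,a_t)$ with $x_0=x$, $x_{t+1}=f(x_t,a_t)$. For $a\in A^\bullet$, $v(a)=\sup_{a'\in A^\infty}v(aa')$ and $u(a)=\sum_{t=0}^{h(a)-1}\gamma^t r(x_t,a_t)$. $v^\star=v(\emptyset)$, and it is assumed that some $a^\star\in A^\infty$ has $v(a^\star)=v^\star$. **Smoothness.** The problem has associated smoothness $(\nu,\rho)$ if $\nu\in(0,R_{\max}/(1-\gamma)]$, $\rho\in(0,\gamma]$, and $u(a)\ge v(a)-\nu\rho^h$ for all $h\ge0$ and $a\in A^h$. **Branching factor.** $\mathcal N^u_h(\epsilon)$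 is the number of $a\in A^h$ with $u(a)\ge v^\star-\epsilon$. $\kappa^u(\nu,\rho)$ is the infimum of the $\kappa\ge1$ for which there is $C>1$ with $\mathcal N^u_h(3\nu\rho^h)\le C\kappa^h$ for all $h\ge0$. $C$ denotes the associated constant, i.e. $\mathcal N^u_h(3\nu\rho^h)\le C\,\kappa^u(\nu,\rho)^h$ for all $h\ge 0$. **Estimates.** To *open* a node $a$ with $m$ evaluations means to query $m$ times each of the $K$ actions in the state reached by $a$ (i.e. to evaluate $m$ times the last action of each child of $a$). The budget $n$ counts openings, up to constant factors. $T_a$ is the number of evaluations so far of the last action of $a$ (at its position in $a$), $\hat r$ denotes the empirical mean of the evaluations so far, and $\hat u(a)=\sum_{t=0}^{h(a)-1}\gamma^t\hat r(x_t,a_t)$. **Algorithm PlaT$\gamma$POOS** (input $n$, $A$, and $\gamma$; it uses none of $b,R_{\max},\nu,\rho$). Set $h_{\max}=\left\lfloor \frac{n}{2(\log_2 n+1)^2}\right\rfloor$ and $p_{\max}=\lfloor\log_2 h_{\max}\rfloor$ ($n$ is large enough that $p_{\max}\ge1$). Open the root with $h_{\max}$ evaluations. *Exploration:* for $h=1,\dots,h_{\max}$, and for $p=\lfloor\log_2(h_{\max}/\lceil h^2\gamma^{2h}\rceil)\rfloor$ down to $0$: open, with $\lceil h2^p\gamma^{2h}\rceil$ evaluations each, the at most $\left\lfloor\frac{h_{\max}}{h\lceil h2^p\gamma^{2h}\rceil}\right\rfloor$ not-yet-opened, already evaluated nodes $a\in A^h$ with highest $\hat u(a)$ among those with $T_a\ge\lceil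 (h-1)2^p\gamma^{2(h-1)}\rceil$. *Cross-validation:* for each $p\in\{0,\dots,p_{\max}\}$, let $a^p$ maximize $\hat u(a)$ over nonempty evaluated $a\in A^\bullet$ with $T_{a_{[t]}}\ge\lceil(t-1)2^p\gamma^{2(t-1)}\rceil$ for all $2\le t\le h(a)$, and evaluate, for each $t$, the action of $a^p$ at position $t$ (in its state $x_t$) $(t+1)\gamma^{2t}h_{\max}(1-\gamma^2)^2$ times (rounded up to an integer). *Output:* $a^n=\arg\max_{a^p,\,0\le p\le p_{\max}}\hat u(a^p)$; the recommended action $a(n)$ is the first action of $a^n$. **Quantities in the noise conditions.** $g=p_{\max}\log\!\left(\frac{R_{\max}n^{3/2}}{b(1-\gamma)}\right)$. $\tilde h_1,\tilde h_2>0$ are the real solutions of $$\frac{h_{\max}\nu^2\rho^{2\tilde h_1}}{\tilde h_1 b^2 g\,\gamma^{2\tilde h_1}}=C\kappa^{\tilde h_1},\qquad \frac{h_{\max}\nu^2\rho^{2\tilde h_2}}{\tilde h_2 b^2 g}=C.$$ $\tilde h>0$ is the largest real number for which, with $\tilde p$ defined by $b\sqrt{g/2^{\tilde p}}=\nu\rho^{\tilde h}$, one has $\frac{h_{\max}}{h^2 2^{\tilde p+1}\gamma^{2h}}\ge C\kappa^h$ for all $0<h\le\tilde h$. **Convention.** $\widetilde O$ hides multiplicative constants depending only on $K,\gamma,\nu,\rho,\kappa,C$ and factors polylogarithmic in $n$ and $R_{\max}/b$. Expectation is over the noise. *)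

(* Defs.v *)
(* MathComp-Analysis world. *)
From mathcomp Require Export all_boot all_order all_algebra.
From mathcomp Require Export all_classical all_reals all_analysis.
Import Order.TTheory GRing.Theory Num.Theory.
Import numFieldNormedType.Exports.

Set Implicit Arguments.
Unset Strict Implicit.
Unset Printing Implicit Defensive.

Local Open Scope classical_set_scope.
Local Open Scope ring_scope.

Definition log2 {R : realType} (x : R) : R := ln x / ln 2.

(* ceiling as a natural number, for x > -1 *)
Definition ceiln {R : realType} (x : R) : nat := `|Num.ceil x|%N.

Section planning_problem.
Context {R : realType} {X : Type} {A : finType}.
Variables (f : X -> A -> X) (r : X -> A -> R) (gamma : R).

Definition reach (y : X) (a : seq A) : X := foldl f y a.

Definition value (y : X) (s : nat -> A) : R :=
  limn (series (fun t => gamma ^+ t * r (reach y (mkseq s t)) (s t))).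

Definition Vstar (y : X) : R := sup [set value y s | s in [set: nat -> A]].

Definition Qstar (y : X) (c : A) : R := r y c + gamma * Vstar (f y c).

Definition simple_regret (y : X) (c : A) : R :=
  \big[Num.max/Qstar y c]_(c' : A) Qstar y c' - Qstar y c.

Variable x : X.

(* the infinite sequence a s, for a finite and s infinite *)
Definition cat_stream (a : seq A) (s : nat -> A) (t : nat) : A :=
  nth (s (t - size a)%N) a t.

Definition v (a : seq A) : R :=
  sup [set value x (cat_stream a s) | s in [set: nat -> A]].

Definition u (a : seq A) : R :=
  \sum_(t < size a) gamma ^+ t * r (reach x (take t a)) (tnth (in_tuple a) t).

Definition vstar : R := v [::].

Definition optimum_attained : Prop := exists s : nat -> A, value x s = vstar.

Definition smooth (Rmax nu rho : R) : Prop :=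
  [/\ 0 < nu <= Rmax / (1 - gamma), 0 < rho <= gamma
    & forall a : seq A, v a - nu * rho ^+ size a <= u a].

Definition near_optimal (h : nat) (eps : R) : nat :=
  #|[set a : h.-tuple A | vstar - eps <= u a]%SET|.

Definition branching_factor (nu rho : R) : R :=
  inf [set k : R | 1 <= k /\ exists C : R, 1 < C /\
    forall h : nat, (near_optimal h (3 * nu * rho ^+ h))%:R <= C * k ^+ h].

Definition branching_constant (nu rho C : R) : Prop :=
  1 < C /\ forall h : nat,
    (near_optimal h (3 * nu * rho ^+ h))%:R <= C * branching_factor nu rho ^+ h.

End planning_problem.

Definition mutually_independent d (W : measurableType d) (R : realType)
    (P : probability W R) (I : eqType) (Z : I -> W -> R) : Prop :=
  forall (J : seq I) (B : I -> set R), uniq J ->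
    (forall i, i \in J -> measurable (B i)) ->
    P (\bigcap_(i in [set` J]) (Z i @^-1` B i)) =
    (\prod_(i <- J) P (Z i @^-1` B i))%E.

(* [Y s c k] is the reward returned by the k-th query (k = 0, 1, ...) of action
   c in the state reached by the sequence s, i.e. by the k-th evaluation of the
   last action of the node [rcons s c].  Distinct nodes reaching the same state
   are evaluated by distinct queries. *)
Definition generative_model d (W : measurableType d) (R : realType)
    (P : probability W R) (X : Type) (A : finType) (f : X -> A -> X)
    (r : X -> A -> R) (x : X) (b : R)
    (Y : seq A -> A -> nat -> {RV P >-> R}) : Prop :=
  [/\ forall s c k, ('E_P[Y s c k] = (r (reach f x s) c)%:E)%E,
      forall s c k w, `|Y s c k w - r (reach f x s) c| <= b
    & mutually_independent P (fun (i : seq A * A * nat) (w : W) =>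
        Y i.1.1 i.1.2 i.2 w - r (reach f x i.1.1) i.1.2)].

Definition hmax (R : realType) (n : nat) : nat :=
  Num.truncn (n%:R / (2 * (log2 n%:R + 1) ^+ 2) : R).

Definition pmax (R : realType) (n : nat) : nat :=
  Num.truncn (log2 (hmax R n)%:R : R).

(* ---- The algorithm.  The samples enter only through the table Y; ties
   between equal estimates are resolved by an arbitrary order [tie]. ---- *)

(* [visits a] is T_a; [opened] lists the nodes opened so far. *)
Record search_state (A : finType) :=
  SearchState { visits : seq A -> nat ; opened : seq (seq A) }.

Section plat_gamma_poos.
Context {R : realType} {A : finType}.
Variables (n : nat) (gamma : R) (tie : rel (seq A)) (Y : seq A -> A -> nat -> R).

Local Notation H := (hmax R n).

Definition rhat (T : seq A -> nat) (s : seq A) (c : A) : R :=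
  (\sum_(k < T (rcons s c)) Y s c k) / (T (rcons s c))%:R.

Definition uhat (T : seq A -> nat) (a : seq A) : R :=
  \sum_(t < size a) gamma ^+ t * rhat T (take t a) (tnth (in_tuple a) t).

(* highest estimate first *)
Definition rank_nodes (T : seq A -> nat) : seq (seq A) -> seq (seq A) :=
  sort (fun a a' =>
    (uhat T a' < uhat T a) || ((uhat T a' == uhat T a) && tie a a')).

Definition nodes (h : nat) : seq (seq A) :=
  [seq tval a | a <- enum {: h.-tuple A}].

(* ceiling of h 2^p gamma^(2h) *)
Definition evals (h p : nat) : nat :=
  ceiln (h%:R * 2 ^+ p * gamma ^+ (2 * h)).

Definition open_node (m : nat) (st : search_state A) (a : seq A) :=
  SearchState
    (fun a' => visits st a' + (if [exists c, a' == rcons a c] then m else 0))%N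
    (a :: opened st).

Definition explore_stratum (h : nat) (st : search_state A) (p : nat) :=
  foldl (open_node (evals h p)) st
    (take (H %/ (h * evals h p))
      (rank_nodes (visits st)
        [seq a <- nodes h | [&& a \notin opened st, (0 < visits st a)%N
                              & (evals h.-1 p <= visits st a)%N]])).

Definition strata (h : nat) : seq nat :=
  if Num.floor (log2 (H%:R / (ceiln (h%:R ^+ 2 * gamma ^+ (2 * h)))%:R) : R)
    is Posz p then rev (iota 0 p.+1) else [::].

Definition explore_depth (st : search_state A) (h : nat) :=
  foldl (explore_stratum h) st (strata h).

Definition exploration : search_state A :=
  foldl explore_depth
    (open_node H (SearchState (fun=> 0%N) [::]) [::]) (iota 1 H).

(* Every evaluated node has depth at most [H.+1]. *)
Definition candidates (T : seq A -> nat) (p : nat) : seq (seq A) :=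
  [seq a <- flatten [seq nodes h | h <- iota 1 H.+1] | (0 < T a)%N &&
    all (fun t => (evals t.-1 p <= T (take t a))%N) (iota 2 (size a).-1)].

(* One round p: the evaluation counts are updated before the next round. *)
Definition cross_validate (acc : (seq A -> nat) * seq (seq A)) (p : nat) :=
  let: (T, L) := acc in
  let ap := head [::] (rank_nodes T (candidates T p)) in
  (fun a => (T a + \sum_(t < size ap | a == take t.+1 ap)
      ceiln (t.+1%:R * gamma ^+ (2 * t) * H%:R * (1 - gamma ^+ 2) ^+ 2))%N,
   rcons L ap).

Definition output_node : seq A :=
  let: (T, L) :=
    foldl cross_validate (visits exploration, [::]) (iota 0 (pmax R n).+1) in
  head [::] (rank_nodes T L).

(* [output_node] is nonempty as soon as [0 < H], so the default action [c0] is
   then irrelevant. *)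
Definition recommended (c0 : A) : A := head c0 output_node.

End plat_gamma_poos.

Section noise_conditions.
Context {R : realType}.
Variables (n : nat) (gamma nu rho kappa C b Rmax : R).

Local Notation H := ((hmax R n)%:R : R).

Definition gfactor : R :=
  (pmax R n)%:R * ln (Rmax * n%:R `^ (3 / 2) / (b * (1 - gamma))).

Local Notation g := gfactor.

Definition is_htilde1 (h : R) : Prop :=
  0 < h /\
  H * nu ^+ 2 * rho `^ (2 * h) / (h * b ^+ 2 * g * gamma `^ (2 * h))
    = C * kappa `^ h.

Definition is_htilde2 (h : R) : Prop :=
  0 < h /\ H * nu ^+ 2 * rho `^ (2 * h) / (h * b ^+ 2 * g) = C.

Definition htilde_condition (h : R) : Prop :=
  exists p : R, b * Num.sqrt (g / 2 `^ p) = nu * rho `^ h /\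
    forall h' : R, 0 < h' <= h ->
      C * kappa `^ h' <= H / (h' ^+ 2 * 2 `^ (p + 1) * gamma `^ (2 * h')).

Definition is_htilde (h : R) : Prop :=
  [/\ 0 < h, htilde_condition h
    & forall h' : R, 0 < h' -> htilde_condition h' -> h' <= h].

Definition high_noise (h h1 h2 : R) : Prop :=
  [/\ nu ^+ 2 * rho `^ (2 * h) / (gamma `^ (2 * h) * h * b ^+ 2 * g) <= 1,
      gamma ^+ 2 * kappa <= 1 -> nu ^+ 2 * rho `^ (2 * h2) / (b ^+ 2 * g) <= 1
    & 1 < gamma ^+ 2 * kappa ->
      nu ^+ 2 * rho `^ (2 * h1) / (b ^+ 2 * g) <= 1].

(* [polylog m] bounds a factor polylogarithmic in n and Rmax / b; the latter
   ratio may be smaller than 1. *)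
Definition polylog (m : nat) : R := (1 + ln n%:R + `|ln (Rmax / b)|) ^+ m.

End noise_conditions.

(* Main.v *)
(* The regret never exceeds [v* <= nu], so only large values of [n / b^2]
   matter.  A union bound over all nodes of depth [t], of which there are [K^t],
   and over all numbers of evaluations costs only a term linear in [t] in the
   deviation level; as the weights [gamma^t] are summable, this is a
   polylogarithmic loss, and the adaptive choice of the evaluated nodes needs no
   martingale argument.  On the resulting event, if stratum [p] estimates values
   up to [nu rho^h] and the budget at each depth [k <= h] exceeds the number
   [C kappa^k] of near-optimal nodes, then the optimal path is opened down to
   depth [h], and cross-validation returns a node of regret
   [O(nu rho^h + b / sqrt n)] up to polylogarithmic factors.

   The depth [h] is the largest one for which the budget suffices when the noise
   level is inflated by a polylogarithmic factor.  High-noise condition (i)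
   then gives [2^p gamma^(2h) >= 2], so the ceilings in the evaluation counts are
   harmless: they neither exhaust the budget nor let nodes from a poorer stratum
   compete in stratum [p]. *)
Require Import Defs.
From mathcomp Require Import measurable_realfun ring lra zify.
Import Order.TTheory GRing.Theory Num.Theory.
Import numFieldNormedType.Exports.

Set Implicit Arguments.
Unset Strict Implicit.
Unset Printing Implicit Defensive.

Local Open Scope classical_set_scope.
Local Open Scope ring_scope.

(** * Concentration of the empirical means *)

(** Independence is given for events only, so no product formula for exponential moments is at hand:
    each noise is rounded up to a grid, the product formula is applied to the cells, and the mesh is
    so fine that all roundings together cost one unit in the exponent. The regret is not shown to be
    measurable, so its mean is bounded through the supremum that defines the integral.

    Both regimes of the rate are one. With [mu = max 1 (gamma^2 kappa)], serving all depths up to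
    [h] in stratum [p] costs about [2^p h^2 mu^h], and the rate exponent is the [beta] with
    [beta * ln (mu / rho^2) = ln (1 / rho)], that is [1/2] when [mu = 1].

    The main obstacle is that condition (i) speaks of the critical depth, which is not the depth [h]
    of the analysis. [stratum_large] compares the two; its needs fix the inflation factor [V], hence
    the degree of the logarithmic factor. *)

Lemma expR_le_quad (R : realType) (z : R) : z <= 1 / 2 ->
  expR z <= 1 + z + 2 * z ^+ 2.
Proof.
move=> hz; have h1 : 0 < 1 - z by lra.
have h2 : 1 - z <= expR (- z) by rewrite expR_ge1Dx.
have h3 : expR z <= (1 - z)^-1.
  by rewrite -[expR z]invrK -expRN lef_pV2 // posrE // expR_gt0.
apply: (le_trans h3); rewrite -[leLHS]mul1r ler_pdivrMr //.
have -> : (1 + z + 2 * z ^+ 2) * (1 - z) = 1 + z ^+ 2 * (1 - 2 * z) by ring.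
rewrite lerDl mulr_ge0 ?sqr_ge0 //; lra.
Qed.

(** * Expectations against sums of indicators *)

Section expectation_bounds.
Context d (W : measurableType d) (R : realType) (P : probability W R).

Lemma expectation_sum_indic (I : finType) (D : I -> set W) (a : I -> R) :
  (forall i, measurable (D i)) -> (forall i, 0 <= a i) ->
  ('E_P[(fun w => \sum_i a i * \1_(D i) w)%R] = \sum_i (a i)%:E * P (D i))%E.
Proof.
move=> mD a0; rewrite unlock.
under eq_integral do rewrite -sumEFin.
rewrite ge0_integral_sum //; last 2 first.
- move=> i; apply/measurable_EFinP; apply: measurable_funM => //.
- by move=> i w _; rewrite lee_fin mulr_ge0.
apply: eq_bigr => i _; under eq_integral do rewrite EFinM.
rewrite ge0_integralZl_EFin //; last exact/measurable_EFinP.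
by rewrite integral_indic // setIT.
Qed.

Lemma measurable_sum_indic (I : finType) (D : I -> set W) (a : I -> R) :
  (forall i, measurable (D i)) ->
  measurable_fun [set: W] (fun w => \sum_i a i * \1_(D i) w).
Proof. by move=> mD; apply: measurable_sum => i; exact: measurable_funM. Qed.

(** A step function below [F] has a smaller mean. Used with constant and with linear weights, to
    extract the total mass and the first moment of a rounded noise. *)
Lemma sum_prob_le_expectation (I : finType) (D : I -> set W) (a : I -> R)
    (F : W -> R) :
  (forall i, measurable (D i)) -> (forall i, 0 <= a i) ->
  measurable_fun [set: W] F -> (forall w, \sum_i a i * \1_(D i) w <= F w) ->
  (\sum_i (a i)%:E * P (D i) <= 'E_P[F])%E.
Proof.
move=> mD a0 mF DF; rewrite -expectation_sum_indic //.
have s0 w : 0 <= \sum_i a i * \1_(D i) w :> R.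
  by apply: sumr_ge0 => i _; rewrite mulr_ge0.
apply: expectation_le => //; first exact: measurable_sum_indic.
- by move=> w; exact: le_trans (DF w).
- exact: aeW.
Qed.

Lemma prob_le_sum (I : finType) (D : I -> set W) (a : I -> R) (E : set W) :
  (forall i, measurable (D i)) -> (forall i, 0 <= a i) -> measurable E ->
  (forall w, E w -> 1 <= \sum_i a i * \1_(D i) w) ->
  (P E <= \sum_i (a i)%:E * P (D i))%E.
Proof.
move=> mD a0 mE ED; rewrite -expectation_sum_indic // -expectation_indic //.
have s0 w : 0 <= \sum_i a i * \1_(D i) w :> R.
  by apply: sumr_ge0 => i _; rewrite mulr_ge0.
apply: expectation_le => //; first exact: measurable_sum_indic.
apply: aeW => w; rewrite indicE; case: (boolP (w \in E)) => //= /set_mem.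
exact: ED.
Qed.

(** The integral of a nonnegative function is a supremum over the simple functions below it, hence
    monotone for arbitrary functions. This is how the regret, whose measurability is not
    established, is integrated: it lies below the constant [e] plus [N] times the indicator of
    [B]. *)
Lemma expectation_le_split (F : W -> R) (B : set W) (e N : R) :
  measurable B -> 0 <= e -> 0 <= N -> (forall w, 0 <= F w) ->
  (forall w, F w <= N) -> (forall w, ~ B w -> F w <= e) ->
  ('E_P[F] <= (e + N * fine (P B))%:E)%E.
Proof.
move=> mB e0 N0 F0 FN Fe.
have -> : (e + N * fine (P B))%:E
    = ('E_P[(fun w => \sum_(i : bool) (if i then e else N) *
         \1_(if i then setT else B) w)%R])%E.
  rewrite expectation_sum_indic; last 2 first.
  - by case.
  - by case.
  rewrite big_bool /= probability_setT mule1 EFinD EFinM fineK //.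
  exact: fin_num_measure.
rewrite unlock ge0_integralTE; last by move=> w; rewrite lee_fin.
rewrite [leRHS]ge0_integralTE; last first.
  by move=> w; rewrite lee_fin; apply: sumr_ge0 => -[] _; rewrite mulr_ge0.
apply: ge_ereal_sup => _ [g gF <-].
apply: ereal_sup_ubound; exists g => // w.
apply: (le_trans (gF w)); rewrite lee_fin big_bool /= indicT mulr1.
rewrite indicE; case: (boolP (w \in B)) => /= [_|/negP wB].
  by rewrite mulr1 (le_trans (FN w)) // lerDr.
by rewrite mulr0 addr0 Fe // => /mem_set.
Qed.
End expectation_bounds.

(** * Discretisation of a bounded noise *)

Section grid.
Context {R : realType}.
Variables (b eta : R).
Hypotheses (b_ge0 : 0 <= b) (eta_gt0 : 0 < eta).

Definition grid_cell (j : nat) : set R :=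
  `[- b + j%:R * eta, - b + j.+1%:R * eta[%classic.

(** The extra cell catches the value [b] itself, which the first [truncn (2 * b / eta)] half-open
    cells do not reach. *)
Definition grid_size : nat := (Num.truncn (2 * b / eta)).+1.

Lemma measurable_grid_cell j : measurable (grid_cell j).
Proof. exact: measurable_itv. Qed.

Lemma grid_cellE z j : `|z| <= b ->
  grid_cell j z <-> j = Num.truncn ((z + b) / eta).
Proof.
rewrite ler_norml => /andP[bz zb]; rewrite /grid_cell /= in_itv /=.
have z0 : 0 <= (z + b) / eta by rewrite divr_ge0 ?(ltW eta_gt0) //; lra.
have -> : (- b + j%:R * eta <= z < - b + j.+1%:R * eta) =
    (Num.truncn ((z + b) / eta) == j).
  rewrite truncn_eq // ler_pdivlMr // ltr_pdivrMr //.
  by congr (_ && _); apply/idP/idP => ?; lra.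
by split => [/eqP->|->].
Qed.

Lemma grid_index_lt z : `|z| <= b -> (Num.truncn ((z + b) / eta) < grid_size)%N.
Proof.
rewrite ler_norml => /andP[bz zb]; rewrite ltnS le_truncn //.
rewrite ler_pM2r ?invr_gt0 //; lra.
Qed.

Lemma grid_size_le (j : 'I_grid_size) : j%:R * eta <= 2 * b.
Proof.
rewrite -ler_pdivlMr //; have := ltn_ord j; rewrite ltnS => jN.
apply: (@le_trans _ _ (Num.truncn (2 * b / eta))%:R); first by rewrite ler_nat.
by rewrite truncn_le divr_ge0 ?(ltW eta_gt0) // mulr_ge0.
Qed.

Lemma sum_grid_indic (W : Type) (Z : W -> R) (a : nat -> R) w : `|Z w| <= b ->
  \sum_(j < grid_size) a j * \1_(Z @^-1` grid_cell j) w =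
  a (Num.truncn ((Z w + b) / eta)).
Proof.
move=> Zb; rewrite (bigD1 (Ordinal (grid_index_lt Zb))) //= big1 => [|j jn].
  by rewrite addr0 indicE mem_set ?mulr1 //=; apply/grid_cellE.
rewrite indicE memNset ?mulr0 //= => /(grid_cellE _ Zb) jE.
by move/eqP: jn; apply; apply/val_inj.
Qed.
End grid.

Lemma bounded_Lfun1 d (W : measurableType d) (R : realType)
    (P : probability W R) (Z : W -> R) (b : R) :
  measurable_fun [set: W] Z -> (forall w, `|Z w| <= b) -> Z \in Lfun P 1.
Proof.
move=> mZ Zb; apply/Lfun1_integrable; apply: measurable_bounded_integrable => //.
  by rewrite (le_lt_trans (probability_le1 _ _)) // ltry.
by exists b; split; [exact: num_real|move=> M bM w _; exact/ltW/(le_lt_trans (Zb w))].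
Qed.

Section grid_mgf.
Context d (W : measurableType d) (R : realType) (P : probability W R).
Variables (Z : W -> R) (b eta lam : R).
Hypotheses (mZ : measurable_fun [set: W] Z) (EZ : ('E_P[Z] = 0)%E)
  (Zb : forall w, `|Z w| <= b) (b_ge0 : 0 <= b) (eta_gt0 : 0 < eta)
  (lam_gt0 : 0 < lam) (lamb : lam * b <= 1 / 2).

Let p (j : nat) : R := fine (P (Z @^-1` grid_cell b eta j)).

Let mD j : measurable (Z @^-1` grid_cell b eta j).
Proof.
by rewrite -[X in measurable X]setTI; apply: mZ => //; exact: measurable_grid_cell.
Qed.

Let PE j : P (Z @^-1` grid_cell b eta j) = (p j)%:E.
Proof. by rewrite fineK // fin_num_measure. Qed.

(** The exponential is taken at the upper end of each cell. Once [eta] is split off, the lower ends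
    lie in [[-b, b]], where the quadratic bound on the exponential is at most affine in the cell
    index plus [2 * (lam * b)^2]. So only two facts on the law enter: its mass and its vanishing
    mean. *)
Lemma grid_mgf :
  \sum_(j < grid_size b eta) expR (lam * (- b + j.+1%:R * eta)) * p j
  <= expR (lam * eta + 2 * (lam * b) ^+ 2).
Proof.
have p0 j : 0 <= p j by rewrite fine_ge0.
have S1 : \sum_(j < grid_size b eta) p j <= 1.
  have := @sum_prob_le_expectation _ _ _ P _
    (fun j : 'I_(grid_size b eta) => Z @^-1` grid_cell b eta j) (fun=> 1) (cst 1).
  rewrite expectation_cst.
  under eq_bigr do rewrite PE mul1e.
  rewrite sumEFin lee_fin; apply => // w.
  by rewrite (sum_grid_indic eta_gt0 (fun=> 1) (Zb w)).
(* The left-hand side is the mean of [Z + b] rounded down, and [Z] is centred. *)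
have S2 : \sum_(j < grid_size b eta) (j%:R * eta) * p j <= b.
  have intZ := bounded_Lfun1 P mZ Zb.
  have := @sum_prob_le_expectation _ _ _ P _
    (fun j : 'I_(grid_size b eta) => Z @^-1` grid_cell b eta j)
    (fun j => j%:R * eta) (Z \+ cst b).
  rewrite expectationD // ?EZ ?add0e ?expectation_cst; last exact: (Lfun_cst P b 1).
  under eq_bigr do rewrite PE -EFinM.
  rewrite sumEFin lee_fin; apply => //.
  - by move=> j; rewrite mulr_ge0 // ltW.
  - exact: measurable_funD.
  move=> w; rewrite (sum_grid_indic eta_gt0 (fun j => j%:R * eta) (Zb w)) /=.
  rewrite -ler_pdivlMr // truncn_le divr_ge0 ?(ltW eta_gt0) //.
  by have := Zb w; rewrite ler_norml => /andP[? ?]; lra.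
apply: (@le_trans _ _ (\sum_(j < grid_size b eta) expR (lam * eta) *
   (((1 - lam * b) + 2 * (lam * b) ^+ 2) * p j + lam * (j%:R * eta * p j)))).
  apply: ler_sum => j _.
  have -> : lam * (- b + j.+1%:R * eta) = lam * eta + lam * (- b + j%:R * eta).
    by rewrite -[j.+1%:R]natr1; ring.
  rewrite expRD -mulrA ler_wpM2l ?expR_ge0 // mulrA -mulrDl ler_wpM2r //.
  have j0 : 0 <= j%:R * eta by rewrite mulr_ge0 // ltW.
  have j1 := grid_size_le b_ge0 eta_gt0 j.
  have h1 : lam * (- b + j%:R * eta) <= 1 / 2.
    by apply: le_trans lamb; rewrite ler_pM2l //; lra.
  apply: (le_trans (expR_le_quad h1)).
  have : (lam * (- b + j%:R * eta)) ^+ 2 <= (lam * b) ^+ 2.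
    rewrite !exprMn ler_wpM2l ?sqr_ge0 // -subr_ge0.
    have -> : b ^+ 2 - (- b + j%:R * eta) ^+ 2 = j%:R * eta * (2 * b - j%:R * eta).
      by ring.
    by rewrite mulr_ge0 // subr_ge0.
  lra.
rewrite -mulr_sumr expRD ler_wpM2l ?expR_ge0 // big_split /= -!mulr_sumr.
have h2 : 0 <= 1 - lam * b + 2 * (lam * b) ^+ 2.
  by have := sqr_ge0 (lam * b); move: (lam * b) lamb => y ? ?; lra.
apply: (@le_trans _ _ (1 - lam * b + 2 * (lam * b) ^+ 2 + lam * b)).
  by apply: lerD; [rewrite -[leRHS]mulr1 ler_wpM2l | rewrite ler_pM2l].
by apply: le_trans (expR_ge1Dx _); lra.
Qed.
End grid_mgf.

(** * Deviations of a sum of independent bounded noises *)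

Section tail.
Context d (W : measurableType d) (R : realType) (P : probability W R).
Variables (b : R) (m : nat).
Hypotheses (b_gt0 : 0 < b) (m_gt0 : (0 < m)%N).

Definition independent_upto (Z : nat -> W -> R) : Prop :=
  forall B : nat -> set R, (forall i, measurable (B i)) ->
    P (\bigcap_(i in [set` iota 0 m]) (Z i @^-1` B i)) =
    (\prod_(i <- iota 0 m) P (Z i @^-1` B i))%E.

Definition bounded_noise (Z : nat -> W -> R) : Prop :=
  [/\ forall k, measurable_fun [set: W] (Z k),
      forall k, ('E_P[Z k] = 0)%E, forall k w, `|Z k w| <= b
    & independent_upto Z].

Lemma measurable_partial_sum (Z : nat -> W -> R) : bounded_noise Z ->
  measurable_fun [set: W] (fun w => \sum_(k < m) Z k w).
Proof. by move=> [mZ _ _ _]; apply: measurable_sum. Qed.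

Lemma measurable_excess (Z : nat -> W -> R) e : bounded_noise Z ->
  measurable [set w | e < \sum_(k < m) Z k w].
Proof.
move=> nZ; have := measurable_partial_sum nZ.
move=> /(_ measurableT `]e, +oo[%classic (measurable_itv _)); rewrite setTI.
congr (measurable _); apply/seteqP; split => w /=; rewrite in_itv /= andbT //.
Qed.

(** The event is covered by boxes of cells, one for each vector [J], weighted by the exponential at
    the upper corner; on the event, the box that contains the noise has weight at least one. Box
    probabilities factorise by independence, and the sum over all vectors of a product becomes a
    product of sums. *)
Lemma chernoff_bound (Z : nat -> W -> R) (lam e : R) : bounded_noise Z ->
  0 < lam -> lam * b <= 1 / 2 ->
  fine (P [set w | e < \sum_(k < m) Z k w]) <=
    expR (1 + 2 * m%:R * (lam * b) ^+ 2 - lam * e).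
Proof.
move=> nZ lam0 lamb; have [mZ EZ Zb iZ] := nZ.
have m0 : 0 < m%:R :> R by rewrite ltr0n.
(* With this mesh the [m] roundings cost [m * lam * eta = 1], the leading [1] in the exponent. *)
pose eta := (m%:R * lam)^-1.
have eta0 : 0 < eta by rewrite invr_gt0 mulr_gt0.
pose N := grid_size b eta.
pose q (j : nat) := - b + j.+1%:R * eta.
(* [insub] extends the vector of cells to all of [nat]; the default cell [0] is never met below
   [m]. *)
pose B (J : {ffun 'I_m -> 'I_N}) (k : nat) : set R :=
  grid_cell b eta (oapp (fun i => J i : nat) 0%N (insub k)).
pose D J := \bigcap_(k in [set` iota 0 m]) (Z k @^-1` B J k).
pose a (J : {ffun 'I_m -> 'I_N}) := expR (lam * (\sum_(i < m) q (J i) - e)).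
pose p (i j : nat) := fine (P (Z i @^-1` grid_cell b eta j)).
have mB J k : measurable (B J k) by exact: measurable_grid_cell.
have mZB J k : measurable (Z k @^-1` B J k).
  by rewrite -[X in measurable X]setTI; apply: mZ.
have mD J : measurable (D J) by apply: bigcap_measurableType.
have PD J : P (D J) = (\prod_(i < m) p i (J i))%:E.
  rewrite iZ // -{1}(subn0 m) -/(index_iota 0 m) big_mkord -prodEFin.
  apply: eq_bigr => i _; rewrite /B valK /= fineK // fin_num_measure //.
  rewrite -[X in measurable X]setTI; apply: mZ => //.
  exact: measurable_grid_cell.
have cover w : e < \sum_(k < m) Z k w -> 1 <= \sum_J a J * \1_(D J) w.
  move=> ew; pose J := [ffun k : 'I_m => Ordinal (grid_index_lt eta0 (Zb k w))].
  rewrite (bigD1 J) //= [X in a J * X]indicE mem_set; last first.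
    move=> k /=; rewrite mem_iota => /= km; rewrite /B insubT /= ffunE /=.
    by apply/grid_cellE.
  rewrite mulr1 ler_wpDr //.
    by apply: sumr_ge0 => i _; rewrite mulr_ge0 ?expR_ge0.
  rewrite -expR0 ler_expR mulr_ge0 ?(ltW lam0) // subr_ge0 (le_trans (ltW ew)) //.
  apply: ler_sum => k _; rewrite ffunE /q /=.
  have /(grid_cellE eta0 _ (Zb k w)) : Num.truncn ((Z k w + b) / eta) =
    Num.truncn ((Z k w + b) / eta) by [].
  by rewrite /grid_cell /= in_itv /= => /andP[_ /ltW].
have := @prob_le_sum _ _ _ P _ D a _ mD (fun J => expR_ge0 _)
  (measurable_excess e nZ) cover.
under eq_bigr do rewrite PD -EFinM.
rewrite sumEFin -[X in (X <= _)%E]fineK ?fin_num_measure ?lee_fin //; last first.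
  exact: measurable_excess.
move=> /le_trans; apply.
have -> : \sum_J a J * \prod_(i < m) p i (J i) =
    expR (- (lam * e)) * \prod_(i < m) \sum_(j < N) expR (lam * q j) * p i j.
  rewrite bigA_distr_bigA mulr_sumr; apply: eq_bigr => J _.
  rewrite big_split /= mulrA; congr (_ * _).
  rewrite /a mulrBr expRD [LHS]mulrC mulr_sumr expR_sum //.
rewrite addrC expRD ler_wpM2l ?expR_ge0 //.
apply: (@le_trans _ _ (\prod_(i < m) expR (lam * eta + 2 * (lam * b) ^+ 2))).
  apply: ler_prod => i _; apply/andP; split.
    by apply: sumr_ge0 => j _; rewrite mulr_ge0 ?expR_ge0 ?fine_ge0.
  exact: (grid_mgf (mZ i) (EZ i) (Zb i) (ltW b_gt0)).
rewrite prodr_const card_ord -expRM_natr ler_expR /eta.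
have -> : lam * (m%:R * lam)^-1 = m%:R^-1 by field; rewrite !gt_eqF.
by rewrite mulrDl mulVf ?gt_eqF // -mulrA [_ * m%:R]mulrC mulrA.
Qed.

(** Chernoff with [lam = sqrt (x / m) / (2 b)], for which the exponent is [1 + x / 2 - 3 x / 2]. The
    choice requires [x <= m]; for larger [x] the event is empty, as the sum never exceeds
    [m * b]. *)
Lemma upper_tail (Z : nat -> W -> R) (x : R) : bounded_noise Z -> 0 < x ->
  fine (P [set w | 3 * b * Num.sqrt (x * m%:R) < \sum_(k < m) Z k w])
    <= expR (1 - x).
Proof.
move=> nZ x0; have [mZ EZ Zb iZ] := nZ.
have m0 : 0 < m%:R :> R by rewrite ltr0n.
have [mx|xm] := leP m%:R x.
  rewrite (_ : [set w | _] = set0) ?measure0 ?expR_ge0 //.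
  apply/seteqP; split => // w /=; apply/negP; rewrite -leNgt.
  have mle : m%:R <= Num.sqrt (x * m%:R).
    rewrite -[leLHS]ger0_norm ?ler0n // -sqrtr_sqr ler_wsqrtr //.
    by rewrite expr2 ler_pM2r.
  apply: (@le_trans _ _ (b * m%:R)); last first.
    have := mulr_ge0 (ltW b_gt0) (sqrtr_ge0 (x * m%:R)).
    have : b * m%:R <= b * Num.sqrt (x * m%:R) by rewrite ler_pM2l.
    by rewrite -mulrA; move: (b * Num.sqrt _) => y; lra.
  apply: (@le_trans _ _ (\sum_(k < m) b)).
    by apply: ler_sum => k _; have := Zb k w; rewrite ler_norml => /andP[].
  by rewrite sumr_const card_ord mulr_natr.
pose s := Num.sqrt (x / m%:R).
have s0 : 0 < s by rewrite sqrtr_gt0 divr_gt0.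
have s2 : s ^+ 2 = x / m%:R by rewrite sqr_sqrtr // divr_ge0 // ltW.
have s1 : s <= 1.
  by rewrite -[leRHS]sqrtr1 ler_wsqrtr // ler_pdivrMr // mul1r ltW.
have sE : Num.sqrt (x * m%:R) = s * m%:R.
  rewrite -[m%:R in RHS]ger0_norm ?ler0n // -sqrtr_sqr -sqrtrM; last first.
    by rewrite divr_ge0 // ltW.
  by congr Num.sqrt; field; rewrite gt_eqF.
have bn0 : b != 0 by rewrite gt_eqF.
have sb : s / (2 * b) * b = s / 2 by field.
apply: le_trans (chernoff_bound (lam := s / (2 * b)) _ nZ _ _) _.
- by rewrite divr_gt0 // mulr_gt0.
- rewrite sb; lra.
rewrite ler_expR sb sE.
have -> : s / (2 * b) * (3 * b * (s * m%:R)) = 3 / 2 * (s ^+ 2 * m%:R) by field.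
rewrite exprMn s2 [2 * m%:R]mulrC.
have -> : m%:R * 2 * (x / m%:R * 2^-1 ^+ 2) = x / 2.
  by field; rewrite gt_eqF.
have -> : x / m%:R * m%:R = x by rewrite divfK // gt_eqF.
lra.
Qed.

Lemma bounded_noiseN (Z : nat -> W -> R) : bounded_noise Z ->
  bounded_noise (fun k w => - Z k w).
Proof.
move=> [mZ EZ Zb iZ]; split.
- by move=> k; exact: measurableT_comp.
- move=> k; rewrite (_ : (fun w => _) = -1 \o* Z k); last first.
    by apply/funext => w /=; rewrite mulrN1.
  by rewrite expectationZl ?EZ ?mule0 //; exact: bounded_Lfun1 (mZ k) (Zb k).
- by move=> k w; rewrite normrN.
move=> B mB; have := iZ (fun k => -%R @^-1` B k).
apply => k.
by rewrite -[X in measurable X]setTI; exact: (@oppr_measurable R setT).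
Qed.

Lemma two_sided_tail (Z : nat -> W -> R) (x : R) : bounded_noise Z -> 0 < x ->
  measurable [set w | 3 * b * Num.sqrt (x * m%:R) < `|\sum_(k < m) Z k w|] /\
  fine (P [set w | 3 * b * Num.sqrt (x * m%:R) < `|\sum_(k < m) Z k w|])
    <= 2 * expR (1 - x).
Proof.
move=> nZ x0; set e := 3 * b * _.
have nZ' := bounded_noiseN nZ.
have -> : [set w | e < `|\sum_(k < m) Z k w|] =
    [set w | e < \sum_(k < m) Z k w] `|` [set w | e < \sum_(k < m) - Z k w].
  by apply/seteqP; split => w /=; rewrite sumrN lter_normr; [move/orP|move=> h; apply/orP].
have mU := measurable_excess e nZ; have mU' := measurable_excess e nZ'.
split; first exact: measurableU.
rewrite [2 * _]mulr_natl mulr2n.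
apply: le_trans (lerD (upper_tail nZ x0) (upper_tail nZ' x0)).
rewrite -lee_fin EFinD !fineK ?fin_num_measure //; last exact: measurableU.
exact: measureU2.
Qed.
End tail.

(** * Union bounds *)

Section unions.
Context d (W : measurableType d) (R : realType) (P : probability W R).

Lemma prob_fin_union (I : finType) (D : I -> set W) (e : I -> R) :
  (forall i, measurable (D i) /\ fine (P (D i)) <= e i) ->
  measurable [set w | exists i, D i w] /\
  fine (P [set w | exists i, D i w]) <= \sum_i e i.
Proof.
move=> De; have mD i : measurable (D i) by case: (De i).
have mE : measurable [set w | exists i, D i w].
  rewrite (_ : [set w | _] = \bigcup_(i in [set: I]) D i).
    by apply: fin_bigcup_measurable.
  by apply/seteqP; split => w /= [i]; [exists i | move=> _; exists i].
split => //; rewrite -lee_fin fineK ?fin_num_measure //.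
apply: (@le_trans _ _ (\sum_i 1%:E * P (D i))%E).
  apply: prob_le_sum => // w [i Di].
  rewrite (bigD1 i) //= mul1r indicE mem_set // ler_wpDr //.
  by apply: sumr_ge0 => j _; rewrite mul1r indicE.
rewrite -sumEFin; apply: lee_sum => i _; rewrite mul1e.
rewrite -[X in (X <= _)%E]fineK ?fin_num_measure // lee_fin; by case: (De i).
Qed.

(** The bounds telescope, [1 / ((m + 1) (m + 2))] being a difference of consecutive inverses. *)
Lemma prob_countable_union (D : nat -> set W) (e : R) : 0 <= e ->
  (forall m, measurable (D m) /\ fine (P (D m)) <= e / (m.+1 * m.+2)%:R) ->
  measurable [set w | exists m, D m w] /\
  fine (P [set w | exists m, D m w]) <= e.
Proof.
move=> e0 De; have mD i : measurable (D i) by case: (De i).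
have EE : [set w | exists m, D m w] = \bigcup_m D m.
  by apply/seteqP; split => w /= [i]; [exists i | move=> _; exists i].
have mE : measurable [set w | exists m, D m w].
  by rewrite EE; exact: bigcup_measurable.
split => //; rewrite -lee_fin fineK ?fin_num_measure //.
have sub : [set w | exists m, D m w] `<=` \bigcup_m D m by rewrite EE.
apply: (le_trans (measure_sigma_subadditive P mD mE sub)).
apply: lime_le; first exact: is_cvg_nneseries.
apply: nearW => n; rewrite big_mkord.
apply: (@le_trans _ _ (\sum_(i < n) (e / (i.+1 * i.+2)%:R)%:E)%E).
  apply: lee_sum => i _; have [? ?] := De i.
  by rewrite -[X in (X <= _)%E]fineK ?fin_num_measure // lee_fin.
rewrite sumEFin lee_fin.
have -> : \sum_(i < n) e / (i.+1 * i.+2)%:R = e * (1 - n.+1%:R^-1).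
  elim: n => [|n IHn]; first by rewrite big_ord0 invr1 subrr mulr0.
  rewrite big_ord_recr /= IHn natrM -[n.+2%:R]natr1.
  have : n.+1%:R != 0 :> R by rewrite pnatr_eq0.
  have : n.+1%:R + 1 != 0 :> R by rewrite natr1 pnatr_eq0.
  by move: (n.+1%:R : R) => y ? ?; field; apply/andP.
by rewrite -[leRHS]mulr1 ler_wpM2l // gerBl invr_ge0.
Qed.
End unions.

(** Each term pays for one factor of the union bound: [1] for the loss in the tail bound, [ln 2] for
    the two signs, [L] for the confidence, [t.+1 * ln (2 K)] for the [K^(t+1)] evaluated actions at
    depth [t] and a geometric weight over depths, and the last term for the number [m] of
    evaluations. *)
Definition dev_level {R : realType} (K : nat) (L : R) (t m : nat) : R :=
  1 + ln 2 + L + t.+1%:R * ln (2 * K%:R) + ln (m * m.+1)%:R.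

(** A property of one fixed table of samples, after which the analysis of the algorithm is
    deterministic. It holds for all [m] at once, so it applies to whatever counts the algorithm
    produces. *)
Definition concentrated {R : realType} {X : Type} {A : finType}
    (f : X -> A -> X) (r : X -> A -> R) (x : X) (b L : R) (H : nat)
    (Y : seq A -> A -> nat -> R) : Prop :=
  forall s c m, (size s <= H)%N -> (0 < m)%N ->
    `|(\sum_(k < m) Y s c k) / m%:R - r (reach f x s) c|
      <= 3 * b * Num.sqrt (dev_level #|A| L (size s) m / m%:R).

Lemma dev_level_gt0 (R : realType) K (L : R) t m : (0 < K)%N -> 0 <= L ->
  (0 < m)%N -> 0 < dev_level K L t m.
Proof.
move=> K0 L0 m0; rewrite /dev_level.
have h1 : 0 <= ln 2 :> R by rewrite ln_ge0 // ler1n.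
have h2 : 0 <= ln (2 * K%:R) :> R.
  by rewrite ln_ge0 // -natrM ler1n muln_gt0.
have h3 : 0 <= ln (m * m.+1)%:R :> R by rewrite ln_ge0 // ler1n muln_gt0 m0.
have h4 : 0 <= t.+1%:R * ln (2 * K%:R) :> R by rewrite mulr_ge0.
lra.
Qed.

Lemma expR_dev_level (R : realType) K (L : R) t m : (0 < K)%N -> (0 < m)%N ->
  2 * expR (1 - dev_level K L t m) =
  expR (- L) / (m * m.+1)%:R / (2 * K%:R) ^+ t.+1.
Proof.
move=> K0 m0.
have h1 : 0 < 2 * K%:R :> R by rewrite -natrM ltr0n muln_gt0.
have h2 : 0 < (m * m.+1)%:R :> R by rewrite ltr0n muln_gt0 m0.
have -> : 1 - dev_level K L t m =
    - L + (- ln (m * m.+1)%:R) + (- (t.+1%:R * ln (2 * K%:R))) + - ln 2.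
  by rewrite /dev_level; ring.
rewrite !expRD !expRN expRM_natl !lnK ?posrE // mulrC divfK //.
Qed.

Lemma concentration d (W : measurableType d) (R : realType)
    (P : probability W R) (X : Type) (A : finType) (f : X -> A -> X)
    (r : X -> A -> R) (x : X) (b L : R) (H : nat)
    (Y : seq A -> A -> nat -> {RV P >-> R}) :
  0 < b -> 0 <= L -> (0 < #|A|)%N -> generative_model f r x b Y ->
  exists Bad : set W, [/\ measurable Bad, fine (P Bad) <= expR (- L)
    & forall w, ~ Bad w ->
      concentrated f r x b L H (fun s c k => Y s c k w)].
Proof.
move=> b0 L0 K0 [EY Yb iY].
pose Z s c (k : nat) (w : W) := Y s c k w - r (reach f x s) c.
have nZ s c m : bounded_noise P b m (Z s c).
  split.
  - by move=> k; exact: measurable_funB.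
  - move=> k; have mYk : measurable_fun [set: W] (Z s c k) by exact: measurable_funB.
    have LY : (Y s c k : W -> R) \in Lfun P 1.
      apply: (@bounded_Lfun1 _ _ _ P _ (b + `|r (reach f x s) c|)) => // w.
      rewrite -[Y s c k w](subrK (r (reach f x s) c)).
      by rewrite (le_trans (ler_normD _ _)) // lerD2r Yb.
    rewrite (_ : Z s c k = Y s c k \- cst (r (reach f x s) c)) //.
    rewrite expectationB ?expectation_cst ?EY ?subee //.
    exact: Lfun_cst P _ 1.
  - by move=> k w; exact: Yb.
  move=> B mB.
  have := iY [seq (s, c, k) | k <- iota 0 m] (fun i => B i.2).
  rewrite map_inj_uniq ?iota_uniq; last by move=> ? ? [].
  rewrite big_map => /(_ isT (fun i _ => mB i.2)) <-.
  congr (P _); apply/seteqP; split => w /= h.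
    by move=> i /= /mapP[k km ->]; exact: h.
  by move=> k km; apply: (h (s, c, k)) => /=; apply/mapP; exists k.
(* The index [m] is shifted by one. The unions over nodes and actions, over depths and over counts
   then consume the three factors of [expR_dev_level] in turn. *)
pose D m (t : 'I_H.+1) (i : t.-tuple A * A) : set W :=
  [set w | 3 * b * Num.sqrt (dev_level #|A| L t m.+1 * m.+1%:R)
     < `|\sum_(k < m.+1) Z i.1 i.2 k w| ].
pose D2 m (t : 'I_H.+1) := [set w | exists i, @D m t i w].
pose D3 m := [set w | exists t, @D2 m t w].
have bD m t i : measurable (@D m t i) /\ fine (P (@D m t i)) <=
    expR (- L) / (m.+1 * m.+2)%:R / (2 * #|A|%:R) ^+ t.+1.
  rewrite -expR_dev_level //; apply: two_sided_tail => //.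
  exact: dev_level_gt0.
have bD2 m t : measurable (@D2 m t) /\ fine (P (@D2 m t)) <=
    expR (- L) / (m.+1 * m.+2)%:R / 2 ^+ t.+1.
  have [? h] := prob_fin_union (bD m t); split => //; apply: (le_trans h).
  rewrite sumr_const card_prod card_tuple -expnSr -[_ *+ (_ ^ _)%N]mulr_natr natrX exprMn.
  have A0 : #|A|%:R ^+ t.+1 != 0 :> R by rewrite expf_neq0 // pnatr_eq0 -lt0n.
  rewrite invfM -!mulrA mulVf // mulr1 //.
have bD3 m : measurable (D3 m) /\ fine (P (D3 m)) <=
    expR (- L) / (m.+1 * m.+2)%:R.
  have [? h] := prob_fin_union (bD2 m); split => //; apply: (le_trans h).
  rewrite -mulr_sumr -[leRHS]mulr1 ler_wpM2l ?divr_ge0 ?expR_ge0 //.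
  have -> : \sum_(t < H.+1) (2 ^+ t.+1)^-1 = 1 - (2 ^+ H.+1)^-1 :> R.
    elim: (H.+1) => [|n IH]; first by rewrite big_ord0 expr0 invr1 subrr.
    rewrite big_ord_recr /= IH exprS; field.
    by rewrite expf_neq0.
  by rewrite gerBl invr_ge0 exprn_ge0.
have [mB PB] := prob_countable_union (expR_ge0 _) bD3.
exists [set w | exists m, D3 m w]; split => // w nB s c [//|m] sH _.
rewrite leNgt; apply/negP => lt.
apply: nB; exists m, (Ordinal (n:=H.+1) (m:=size s) sH), (in_tuple s, c).
rewrite /D /= /Z sumrB sumr_const card_ord.
have m0 : 0 < m.+1%:R :> R by rewrite ltr0n.
move: lt; rewrite -(ltr_pM2r m0) => lt.
have -> : Num.sqrt (dev_level #|A| L (size s) m.+1 * m.+1%:R) =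
    Num.sqrt (dev_level #|A| L (size s) m.+1 / m.+1%:R) * m.+1%:R.
  have dl0 : 0 <= dev_level #|A| L (size s) m.+1 / m.+1%:R.
    by rewrite divr_ge0 // ltW // dev_level_gt0.
  rewrite (_ : _ * m.+1%:R =
    dev_level #|A| L (size s) m.+1 / m.+1%:R * m.+1%:R ^+ 2); last first.
    by rewrite expr2 mulrA divfK // pnatr_eq0.
  by rewrite sqrtrM // sqrtr_sqr ger0_norm.
rewrite mulrA (lt_le_trans lt) // -[X in _ * X]ger0_norm ?ler0n // -normrM.
by rewrite mulrBl divfK ?pnatr_eq0 // mulr_natr.
Qed.

(** * Values and regret *)

Section planning.
Context {R : realType} {X : Type} {A : finType}.
Variables (f : X -> A -> X) (r : X -> A -> R) (gamma Rmax : R).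
Hypotheses (gamma01 : 0 < gamma < 1) (r_bounds : forall y a, 0 <= r y a <= Rmax).

Let term y (s : nat -> A) (t : nat) : R :=
  gamma ^+ t * r (reach f y (mkseq s t)) (s t).

Let term_ge0 y s t : 0 <= term y s t.
Proof.
have [g0 g1] := andP gamma01; have [r0 _] := andP (r_bounds (reach f y (mkseq s t)) (s t)).
by rewrite mulr_ge0 // exprn_ge0 // ltW.
Qed.

Lemma discounted_sum_le y s n :
  series (term y s) n <= Rmax / (1 - gamma).
Proof.
have [g0 g1] := andP gamma01.
have g1' : 0 < 1 - gamma by rewrite subr_gt0.
have R0 : 0 <= Rmax.
  by have [r0 r1] := andP (r_bounds y (s 0%N)); exact: le_trans r1.
apply: (@le_trans _ _ (Rmax * \sum_(0 <= t < n) gamma ^+ t)).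
  rewrite /series /= mulr_sumr; apply: ler_sum => t _; rewrite /term [leRHS]mulrC.
  have [_ h] := andP (r_bounds (reach f y (mkseq s t)) (s t)).
  by rewrite ler_wpM2l // exprn_ge0 // ltW.
rewrite ler_wpM2l // big_mkord -[leRHS]mul1r ler_pdivlMr // mulrC.
by rewrite -opprB mulNr -subrX1 opprB gerBl exprn_ge0 // ltW.
Qed.

Lemma nondecreasing_discounted_sum y s : nondecreasing_seq (series (term y s)).
Proof.
apply/nondecreasing_seqP => n; rewrite seriesSr /=.
by rewrite lerDl.
Qed.

Lemma is_cvg_discounted_sum y s : cvgn (series (term y s)).
Proof.
apply: nondecreasing_is_cvgn; first exact: nondecreasing_discounted_sum.
by exists (Rmax / (1 - gamma)) => _ [n _ <-]; exact: discounted_sum_le.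
Qed.

Lemma value_le y s : value f r gamma y s <= Rmax / (1 - gamma).
Proof.
apply: limr_le; first exact: is_cvg_discounted_sum.
by apply: nearW => n; exact: discounted_sum_le.
Qed.

Lemma discounted_sum_le_value y s n : series (term y s) n <= value f r gamma y s.
Proof.
apply: nondecreasing_cvgn_le; first exact: nondecreasing_discounted_sum.
exact: is_cvg_discounted_sum.
Qed.

Lemma value_ge0 y s : 0 <= value f r gamma y s.
Proof.
by apply: le_trans (discounted_sum_le_value y s 0); rewrite /series /= big_geq.
Qed.

Lemma value_unfold y s : value f r gamma y s =
  r y (s 0%N) + gamma * value f r gamma (f y (s 0%N)) (s \o succn).
Proof.
rewrite /value -/(term y s); apply: cvg_lim => //.
rewrite -(cvg_shiftS (series (term y s))).
have -> : (fun n => series (term y s) n.+1) =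
    (fun n => r y (s 0%N) + gamma * series (term (f y (s 0%N)) (s \o succn)) n).
  apply/funext => n; rewrite /series /= big_nat_recl // {1}/term expr0 mul1r.
  congr (_ + _); rewrite mulr_sumr; apply: eq_bigr => t _.
  rewrite /term exprS mulrA; congr (_ * r _ _).
  by rewrite /reach /mkseq /= -[iota 1 t]/(iota (1 + 0) t) iotaDl -map_comp.
apply: cvgD; first exact: cvg_cst.
by apply: cvgM; [exact: cvg_cst | exact: is_cvg_discounted_sum].
Qed.

(** The map [g] serves both suprema: the identity for [Vstar], and [cat_stream a] for [v]. *)
Lemma has_sup_value y (g : (nat -> A) -> (nat -> A)) (c0 : A) :
  has_sup [set value f r gamma y (g s) | s in [set: nat -> A]].
Proof.
split; first by exists (value f r gamma y (g (fun=> c0))); exists (fun=> c0).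
by exists (Rmax / (1 - gamma)) => _ [s _ <-]; exact: value_le.
Qed.

Lemma value_le_Vstar y s : value f r gamma y s <= Vstar f r gamma y.
Proof. by apply: (sup_upper_bound (has_sup_value y id (s 0%N))); exists s. Qed.

Lemma vstarE x : vstar f r gamma x = Vstar f r gamma x.
Proof.
rewrite /vstar /v /Vstar; congr sup; apply: eq_imagel => s _; congr value.
by apply/funext => t; rewrite /cat_stream nth_nil subn0.
Qed.

Lemma u_le_value x a s : u f r gamma x a <= value f r gamma x (cat_stream a s).
Proof.
apply: le_trans (discounted_sum_le_value x _ (size a)).
rewrite le_eqVlt; apply/orP; left; apply/eqP.
rewrite /series /= big_mkord; apply: eq_bigr => t _.
rewrite /term; have -> : mkseq (cat_stream a s) t = take t a.
  apply: (@eq_from_nth _ (s 0%N)).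
    by rewrite size_mkseq size_takel // ltnW.
  move=> i; rewrite size_mkseq => it; rewrite nth_mkseq // nth_take //.
  by apply: set_nth_default; exact: ltn_trans it (ltn_ord t).
by rewrite /cat_stream (tnth_nth (s (t - size a)%N)).
Qed.

(** Any infinite completion, here the constant one, only adds nonnegative rewards, and what follows
    [c] is at most optimal. *)
Lemma u_le_Qstar x c a : u f r gamma x (c :: a) <= Qstar f r gamma x c.
Proof.
apply: (le_trans (u_le_value x (c :: a) (fun=> c))); rewrite value_unfold /Qstar.
have [g0 _] := andP gamma01.
by rewrite lerD2l ler_pM2l // value_le_Vstar.
Qed.

Lemma Qstar_ge0 x c : 0 <= Qstar f r gamma x c.
Proof.
have [g0 _] := andP gamma01; have [r0 _] := andP (r_bounds x c).
rewrite addr_ge0 // mulr_ge0 ?(ltW g0) //.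
exact: le_trans (value_ge0 _ (fun=> c)) (value_le_Vstar _ _).
Qed.

Lemma Qstar_le_vstar x c : Qstar f r gamma x c <= vstar f r gamma x.
Proof.
have [g0 _] := andP gamma01.
rewrite vstarE /Qstar -lerBrDl mulrC -ler_pdivlMr //.
apply: ge_sup.
  by exists (value f r gamma (f x c) (fun=> c)); exists (fun=> c).
move=> _ [s _ <-]; rewrite ler_pdivlMr // lerBrDl mulrC.
pose s' t := if t is t'.+1 then s t' else c.
by have := value_le_Vstar x s'; rewrite value_unfold.
Qed.

Lemma value_le_v x s h : value f r gamma x s <= v f r gamma x (mkseq s h).
Proof.
apply: (sup_upper_bound (has_sup_value x _ (s 0%N))).
exists (fun t => s (t + h)%N) => //; congr value; apply/funext => t.
rewrite /cat_stream size_mkseq; have [th|ht] := ltnP t h.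
  by rewrite nth_mkseq.
by rewrite nth_default ?size_mkseq // subnK.
Qed.

(** Smoothness at the root, where [u] is an empty sum. It yields the a priori bound [nu] on the
    regret, used on the bad event. *)
Lemma vstar_le_nu x nu rho : smooth f r gamma x Rmax nu rho ->
  vstar f r gamma x <= nu.
Proof.
move=> [_ _ /(_ [::])]; rewrite /vstar /u /= big_ord0 expr0 mulr1.
by rewrite lerBlDr add0r.
Qed.

Lemma u_optimal_prefix x nu rho s h : smooth f r gamma x Rmax nu rho ->
  value f r gamma x s = vstar f r gamma x ->
  vstar f r gamma x - nu * rho ^+ h <= u f r gamma x (mkseq s h).
Proof.
move=> [_ _ sm] <-; apply: le_trans (sm (mkseq s h)).
by rewrite size_mkseq lerD2r value_le_v.
Qed.

Lemma simple_regret_ge0 x c : 0 <= simple_regret f r gamma x c.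
Proof.
by rewrite /simple_regret subr_ge0 bigmax_ge_id.
Qed.

Lemma simple_regret_le_vstar x c :
  simple_regret f r gamma x c <= vstar f r gamma x - Qstar f r gamma x c.
Proof.
rewrite /simple_regret lerD2r.
elim/big_ind: _ => [|a b h1 h2|i _]; try exact: Qstar_le_vstar.
by rewrite ge_max h1 h2.
Qed.

Lemma simple_regret_le_nu x nu rho c : smooth f r gamma x Rmax nu rho ->
  simple_regret f r gamma x c <= nu.
Proof.
move=> sm; apply: (le_trans (simple_regret_le_vstar x c)).
by rewrite lerBlDr (le_trans (vstar_le_nu sm)) // lerDl Qstar_ge0.
Qed.

(** Any continuation [a] certifies a value for its first action; this converts a guarantee on the
    returned node into one on the recommendation. *)
Lemma simple_regret_le_u x c a :
  simple_regret f r gamma x c <= vstar f r gamma x - u f r gamma x (c :: a).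
Proof.
apply: (le_trans (simple_regret_le_vstar x c)).
by rewrite lerB // u_le_Qstar.
Qed.

End planning.

(** * Error of the estimates *)

Lemma sum_arith_geom_le (R : realType) (g : R) n : 0 < g < 1 ->
  \sum_(j < n) j.+1%:R * g ^+ j <= (1 - g) ^- 2.
Proof.
move=> /andP[g0 g1]; have h : 0 < 1 - g by rewrite subr_gt0.
rewrite -[leRHS]mul1r ler_pdivlMr ?exprn_gt0 //.
have -> : (\sum_(j < n) j.+1%:R * g ^+ j) * (1 - g) ^+ 2 =
    1 - n%:R * g ^+ n * (1 - g) - g ^+ n.
  elim: n => [|n IH]; first by rewrite big_ord0 expr0; ring.
  by rewrite big_ord_recr /= mulrDl IH [g ^+ n.+1]exprS -[n.+1%:R]natr1; ring.
have : 0 <= n%:R * g ^+ n * (1 - g).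
  by rewrite mulr_ge0 ?(ltW h) // mulr_ge0 // exprn_ge0 // ltW.
have : 0 <= g ^+ n by rewrite exprn_ge0 // ltW.
lra.
Qed.

(** The subtraction [t - t0] is truncated, so discounting starts only at [t0]. The bound rests on
    [t + 1 <= (t0 + 1) (t - t0 + 1)]. *)
Lemma sum_delayed_geom_le (R : realType) (g : R) n t0 : 0 < g < 1 ->
  \sum_(t < n) t.+1%:R * g ^+ (t - t0) <= t0.+1%:R ^+ 2 * (1 - g) ^- 2.
Proof.
move=> g01; have /andP[g0 g1] := g01.
pose F j : R := j.+1%:R * g ^+ j.
have split_sum m : \sum_(t < m) F (t - t0)%N <= t0%:R + \sum_(j < m - t0) F j.
  suff h : \sum_(t < m) F (t - t0)%N <= (minn m t0)%:R + \sum_(j < m - t0) F j.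
    by apply: (le_trans h); rewrite lerD2r ler_nat geq_minr.
  elim: m => [|m IH]; first by rewrite big_ord0 min0n sub0n big_ord0 addr0.
  rewrite big_ord_recr /=; have [mt|tm] := ltnP m t0.
    have -> : (m - t0 = 0)%N by lia.
    rewrite /F expr0 mulr1; move: IH; have -> : (minn m t0 = m)%N by lia.
    have -> : (minn m.+1 t0 = m.+1)%N by lia.
    have -> : (m - t0 = 0)%N by lia.
    have -> : (m.+1 - t0 = 0)%N by lia.
    by rewrite !big_ord0 !addr0 -[m.+1%:R]natr1 => IH; rewrite lerD2r.
  have -> : (m.+1 - t0 = (m - t0).+1)%N by lia.
  rewrite big_ord_recr /= addrA lerD2r (le_trans IH) // lerD2r ler_nat; lia.
have g1' : 0 < 1 - g by rewrite subr_gt0.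
have S := sum_arith_geom_le (n - t0) g01.
have q1 : 1 <= (1 - g) ^- 2.
  by rewrite invf_ge1 ?exprn_gt0 // exprn_ile1 //; lra.
apply: (@le_trans _ _ (t0.+1%:R * \sum_(t < n) F (t - t0)%N)).
  rewrite mulr_sumr; apply: ler_sum => t _; rewrite /F mulrA ler_wpM2r //.
    by rewrite exprn_ge0 // ltW.
  rewrite -natrM ler_nat; nia.
rewrite expr2 -mulrA ler_wpM2l //; apply: (le_trans (split_sum n)).
apply: (@le_trans _ _ (t0%:R * (1 - g) ^- 2 + (1 - g) ^- 2)).
  by rewrite lerD // ler_peMr.
by rewrite -[t0.+1%:R]natr1 mulrDl mul1r.
Qed.

(** [3] comes from the tail bound, [8 + ln (2 K)] from the deviation level, the square from the
    depth [t0.+1] of [uhat_error] per unit of [L], and the last factor from the discounted sum. *)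
Definition error_const {R : realType} (K : nat) (gamma : R) : R :=
  3 * (8 + ln (2 * K%:R)) * ((2 * ln gamma^-1)^-1 + 2) ^+ 2 * (1 - gamma) ^- 2.

Section estimation_error.
Context {R : realType} {X : Type} {A : finType}.
Variables (f : X -> A -> X) (r : X -> A -> R) (x : X) (gamma b L : R) (H : nat)
  (Y : seq A -> A -> nat -> R).
Hypotheses (gamma01 : 0 < gamma < 1) (b_gt0 : 0 < b) (L_ge1 : 1 <= L)
  (A_gt0 : (0 < #|A|)%N) (conc : concentrated f r x b L H Y).

Let lnK_ge0 : 0 <= ln (2 * #|A|%:R) :> R.
Proof. by rewrite ln_ge0 // -natrM ler1n muln_gt0. Qed.

(** The count [m] is adaptive and only known to be at least [m0]. Since [ln m <= L + (m / m0 - 1)],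
    the level is at most linear in [m / m0], and dividing by [m] leaves [1 / m0] with no upper bound
    on [m]. *)
Lemma dev_level_ratio_le (t m : nat) (m0 : R) : (0 < m)%N ->
  1 <= m0 -> m0 <= m%:R -> m0 <= expR L ->
  dev_level #|A| L t m / m%:R <= (8 + ln (2 * #|A|%:R)) * L * t.+1%:R / m0.
Proof.
move=> m_gt0 m01 m0m m0L.
have m0_gt0 : 0 < m0 by lra.
have mr : 0 < m%:R :> R by rewrite ltr0n.
have ln2 : ln 2 <= 1 :> R.
  rewrite -[leRHS]expRK ler_ln ?posrE ?expR_gt0 //.
  by have := expR_ge1Dx (1 : R); lra.
have lm0 : ln m0 <= L by rewrite -[leRHS]expRK ler_ln ?posrE ?expR_gt0.
have lmm : ln m%:R <= L + (m%:R / m0 - 1) :> R.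
  have -> : m%:R = m0 * (m%:R / m0) :> R by rewrite mulrC divfK // gt_eqF.
  rewrite lnM ?posrE ?divr_gt0 //; apply: lerD => //.
  have q0 : 0 < m%:R / m0 by rewrite divr_gt0.
  have := expR_ge1Dx (ln (m%:R / m0)); rewrite lnK ?posrE //.
  by rewrite [m0 * _]mulrC divfK ?gt_eqF //; lra.
have lmm1 : ln (m * m.+1)%:R <= 1 + 2 * ln m%:R :> R.
  apply: (@le_trans _ _ (ln (2 * (m%:R * m%:R)))).
    rewrite ler_ln ?posrE ?mulr_gt0 ?ltr0n ?muln_gt0 ?m_gt0 //.
    by rewrite -!natrM ler_nat mulnS mul2n -addnn leq_add2r leq_pmulr.
  by rewrite !lnM ?posrE ?mulr_gt0 //; lra.
have t1 : 1 <= t.+1%:R :> R by rewrite ler1n.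
have i1 : m%:R^-1 <= m0^-1 by rewrite lef_pV2 ?posrE.
rewrite ler_pdivrMr //.
have -> : (8 + ln (2 * #|A|%:R)) * L * t.+1%:R / m0 * m%:R =
   ((8 + ln (2 * #|A|%:R)) * L * t.+1%:R) * (m%:R / m0) by rewrite -mulrA [_ * m%:R]mulrC.
have q1 : 1 <= m%:R / m0 by rewrite ler_pdivlMr // mul1r.
have lK := lnK_ge0; rewrite /dev_level; set q := m%:R / m0 in lmm q1 *; set l := ln (2 * _) in lK *.
have h1 : 1 + ln 2 + L + t.+1%:R * l + ln (m * m.+1)%:R <=
    1 + 3 * L + t.+1%:R * l + 2 * q by lra.
apply: (le_trans h1).
have h2 : t.+1%:R * l <= t.+1%:R * l * L * q.
  rewrite -mulrA ler_peMr ?mulr_ge0 //.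
  by rewrite -[X in X <= _]mulr1 ler_pM.
have L0 : 0 <= L by exact: le_trans ler01 L_ge1.
have q0 : 0 <= q by exact: le_trans ler01 q1.
have h3 : 1 + 3 * L + 2 * q <= 8 * (L * q).
  have h5 : 1 * q <= L * q by rewrite ler_wpM2r.
  have h6 : L * 1 <= L * q by rewrite ler_wpM2l.
  have := L_ge1; move: (L * q) h5 h6 => y; lra.
have h4 : 8 * (L * q) <= 8 * (L * q) * t.+1%:R.
  by rewrite -[leLHS]mulr1 ler_wpM2l // mulr_ge0 // mulr_ge0.
have -> : (8 + l) * L * t.+1%:R * q = 8 * (L * q) * t.+1%:R + t.+1%:R * l * L * q.
  by ring.
lra.
Qed.

(** Down to depth [t0] the discounted error is of order [1 / sqrt sigma] per depth. Beyond it
    [sigma * gamma^(2t)] may fall below one and a single evaluation is all that is guaranteed, but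
    the surplus discount [gamma^(t - t0)] makes the sum converge. As [sigma <= expR L], [t0] is of
    order [L]; one [L] from the deviation level and two from [t0.+1] make [L^3]. *)
Lemma uhat_error (T : seq A -> nat) (a : seq A) (sigma : R) :
  (size a <= H.+1)%N -> 0 < sigma -> sigma <= expR L ->
  (forall t, (t < size a)%N -> (0 < T (take t.+1 a))%N /\
    sigma * gamma ^+ (2 * t) <= (T (take t.+1 a))%:R) ->
  `|uhat gamma Y T a - u f r gamma x a| <=
    b * (error_const #|A| gamma * L ^+ 3) / Num.sqrt sigma.
Proof.
move=> aH s0 sL Ta; have /andP[g0 g1] := gamma01.
have lK := lnK_ge0; have L1 := L_ge1; have b0 := ltW b_gt0.
have L0 : 0 <= L by lra.
pose Xc := (8 + ln (2 * #|A|%:R)) * L.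
have Xc1 : 1 <= Xc.
  have h : 1 <= 8 + ln (2 * #|A|%:R) :> R by lra.
  by rewrite -[leLHS]mulr1 ler_pM.
have lg : 0 < ln gamma^-1 by rewrite ln_gt0 // invf_gt1.
pose t0 := (Num.truncn (L / (2 * ln gamma^-1))).+1.
have t0L : sigma * gamma ^+ (2 * t0) <= 1.
  rewrite -ler_pdivlMr ?exprn_gt0 // mul1r (le_trans sL) //.
  have -> : (gamma ^+ (2 * t0))^-1 = expR (t0%:R * (2 * ln gamma^-1)).
    rewrite expRM_natl expRM_natl lnK ?posrE ?invr_gt0 //.
    by rewrite -exprM exprVn.
  rewrite ler_expR -ler_pdivrMr ?mulr_gt0 // ltW //.
  have : 0 <= L / (2 * ln gamma^-1) by rewrite divr_ge0 ?mulr_ge0 // ltW.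
  by move=> /truncn_itv /andP[].
have t0b : t0.+1%:R <= ((2 * ln gamma^-1)^-1 + 2) * L.
  rewrite /t0 -[_.+2%:R]natr1 -[_.+1%:R]natr1.
  have : 0 <= L / (2 * ln gamma^-1) by rewrite divr_ge0 ?mulr_ge0 // ltW.
  move=> /truncn_itv /andP[h _].
  rewrite [leRHS]mulrC mulrDr -addrA; apply: lerD => //.
  by rewrite -[leLHS]mul1r ler_wpM2r.
clearbody t0.
have sq0 : 0 < Num.sqrt sigma by rewrite sqrtr_gt0.
have edge t : (t < size a)%N ->
    gamma ^+ t * (3 * b * Num.sqrt (dev_level #|A| L t (T (take t.+1 a)) /
      (T (take t.+1 a))%:R)) <=
    3 * b * Xc / Num.sqrt sigma * (t.+1%:R * gamma ^+ (t - t0)) :> R.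
  move=> ta; have [m0 sm] := Ta t ta.
  move: (T _) m0 sm => m m0 sm.
  have g2t : 0 < gamma ^+ (2 * t) by rewrite exprn_gt0.
  (* Both guarantees on the count in one: at least one evaluation, and at least
     [sigma * gamma^(2t)]. *)
  pose mm : R := Num.max 1 (sigma * gamma ^+ (2 * t)).
  have mm1 : 1 <= mm by rewrite /mm le_max lexx.
  have mm2 : sigma * gamma ^+ (2 * t) <= mm by rewrite /mm le_max lexx orbT.
  have mm0 : 0 < mm by exact: lt_le_trans ltr01 mm1.
  have h1 : dev_level #|A| L t m / m%:R <= Xc * t.+1%:R / mm.
    apply: dev_level_ratio_le => //.
      by rewrite /mm ge_max ler1n m0.
    rewrite /mm ge_max; apply/andP; split.
      by rewrite -expR0 ler_expR.
    apply: le_trans sL; rewrite ler_piMr ?(ltW s0) //.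
    by rewrite exprn_ile1 // ltW.
  (* [Xc * t.+1] is at least one, hence bounds its own root. This is crude but harmless, as the
     weights [t.+1] stay summable under the discount. *)
  have h2 : Num.sqrt (dev_level #|A| L t m / m%:R) <= Xc * t.+1%:R / Num.sqrt mm.
    apply: (le_trans (ler_wsqrtr h1)).
    have Y1 : 1 <= Xc * t.+1%:R by rewrite -[leLHS]mulr1 ler_pM // ler1n.
    have Y0 := le_trans ler01 Y1.
    rewrite sqrtrM //.
    rewrite sqrtrV ?(ltW mm0) // ler_wpM2r ?invr_ge0 ?sqrtr_ge0 //.
    rewrite -[leRHS]ger0_norm //.
    by rewrite -sqrtr_sqr ler_wsqrtr // expr2 -[leLHS]mul1r ler_wpM2r.
  have h3 : gamma ^+ t / Num.sqrt mm <= gamma ^+ (t - t0) / Num.sqrt sigma.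
    have gg (n : nat) : Num.sqrt (gamma ^+ (2 * n)) = gamma ^+ n.
      by rewrite mulnC exprM sqrtr_sqr ger0_norm // exprn_ge0 // ltW.
    rewrite ler_pdivrMr ?sqrtr_gt0 // mulrAC ler_pdivlMr //.
    rewrite -(gg t) -(gg (t - t0)%N) -!sqrtrM ?exprn_ge0 ?(ltW g0) // ler_wsqrtr //.
    have [tt0|t0t] := leqP t t0.
      by move: (tt0); rewrite -subn_eq0 => /eqP->; rewrite muln0 expr0 mul1r mulrC.
    have -> : (2 * t = 2 * (t - t0) + 2 * t0)%N by rewrite -mulnDr subnK // ltnW.
    rewrite exprD -mulrA ler_wpM2l ?exprn_ge0 ?(ltW g0) //.
    by rewrite mulrC (le_trans t0L).
  apply: (@le_trans _ _ (gamma ^+ t * (3 * b * (Xc * t.+1%:R / Num.sqrt mm)))).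
    by rewrite ler_wpM2l ?exprn_ge0 ?(ltW g0) // ler_wpM2l // mulr_ge0 // ltW.
  have Xc0 := le_trans ler01 Xc1.
  have -> : gamma ^+ t * (3 * b * (Xc * t.+1%:R / Num.sqrt mm)) =
     (3 * b * Xc * t.+1%:R) * (gamma ^+ t / Num.sqrt mm) by ring.
  have -> : 3 * b * Xc / Num.sqrt sigma * (t.+1%:R * gamma ^+ (t - t0)) =
     (3 * b * Xc * t.+1%:R) * (gamma ^+ (t - t0) / Num.sqrt sigma) by ring.
  by rewrite ler_wpM2l // mulr_ge0 // mulr_ge0 // mulr_ge0.
rewrite /uhat /u -sumrB; apply: (le_trans (ler_norm_sum _ _ _)).
apply: (@le_trans _ _ (\sum_(t < size a) 3 * b * Xc / Num.sqrt sigma *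
    (t.+1%:R * gamma ^+ (t - t0)))).
  apply: ler_sum => t _; rewrite -mulrBr normrM ger0_norm ?exprn_ge0 ?(ltW g0) //.
  apply: le_trans (edge t (ltn_ord t)).
  rewrite ler_wpM2l ?exprn_ge0 ?(ltW g0) //.
  have rE : rcons (take t a) (tnth (in_tuple a) t) = take t.+1 a.
    by rewrite (tnth_nth (tnth (in_tuple a) t)) -take_nth.
  rewrite /rhat rE; have [m0 _] := Ta t (ltn_ord t).
  have st : size (take t a) = t by rewrite size_takel // ltnW.
  have := conc (tnth (in_tuple a) t) (s := take t a) _ m0; rewrite st; apply.
  by rewrite -ltnS (leq_trans (ltn_ord t)).
have Xc0 := le_trans ler01 Xc1.
rewrite -mulr_sumr; apply: (@le_trans _ _ (3 * b * Xc / Num.sqrt sigma *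
   (t0.+1%:R ^+ 2 * (1 - gamma) ^- 2))).
  rewrite ler_wpM2l ?sum_delayed_geom_le //.
  by rewrite mulr_ge0 ?invr_ge0 ?sqrtr_ge0 // mulr_ge0 // mulr_ge0.
have -> : b * (error_const #|A| gamma * L ^+ 3) / Num.sqrt sigma =
   3 * b * Xc / Num.sqrt sigma *
     ((((2 * ln gamma^-1)^-1 + 2) * L) ^+ 2 * (1 - gamma) ^- 2).
  by rewrite /error_const /Xc; ring.
rewrite ler_wpM2l //.
  by rewrite mulr_ge0 ?invr_ge0 ?sqrtr_ge0 // mulr_ge0 // mulr_ge0.
rewrite ler_wpM2r ?invr_ge0 ?exprn_ge0 ?subr_ge0 ?(ltW g1) //.
by rewrite lerXn2r ?nnegrE // (le_trans _ t0b).
Qed.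
End estimation_error.

(** * Guarantees of the algorithm *)

Lemma ceiln_ge (R : realType) (x : R) : 0 <= x -> x <= (ceiln x)%:R.
Proof.
move=> x0; rewrite /ceiln natr_absz ger0_norm ?ceil_ge //.
by rewrite ceil_ge0 (lt_le_trans _ x0).
Qed.

Lemma ceiln_lt (R : realType) (x : R) : 0 <= x -> (ceiln x)%:R < x + 1.
Proof.
move=> x0; rewrite /ceiln natr_absz ger0_norm; last first.
  by rewrite ceil_ge0 (lt_le_trans _ x0).
by have /andP[] := ceil_itv x; rewrite intrB ltrBlDr.
Qed.

Lemma leq_ceiln (R : realType) (x y : R) : 0 <= x -> x <= y ->
  (ceiln x <= ceiln y)%N.
Proof.
move=> x0 xy; have y0 := le_trans x0 xy.
rewrite -ltnS -(ltr_nat R).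
rewrite -[(ceiln y).+1%:R]natr1 (lt_le_trans (ceiln_lt x0)) // lerD2r.
by rewrite (le_trans xy) // ceiln_ge.
Qed.

Lemma ceiln_gt0 (R : realType) (x : R) : 0 < x -> (0 < ceiln x)%N.
Proof.
by move=> x0; rewrite -(ltr_nat R) (lt_le_trans x0) // ceiln_ge // ltW.
Qed.

Section evals.
Context {R : realType}.
Variable gamma : R.
Hypothesis gamma_gt0 : 0 < gamma.

Let arg_ge0 h p : 0 <= h%:R * 2 ^+ p * gamma ^+ (2 * h) :> R.
Proof. by rewrite !mulr_ge0 ?exprn_ge0 // ltW. Qed.

Lemma evals_ge h p : h%:R * 2 ^+ p * gamma ^+ (2 * h) <= (evals gamma h p)%:R.
Proof. exact: ceiln_ge. Qed.

Lemma evals_lt h p : (evals gamma h p)%:R < h%:R * 2 ^+ p * gamma ^+ (2 * h) + 1.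
Proof. exact: ceiln_lt. Qed.

Lemma evals0 p : evals gamma 0 p = 0%N.
Proof. by rewrite /evals !mul0r /ceiln ceil0. Qed.

Lemma evals_gt0 h p : (0 < h)%N -> (0 < evals gamma h p)%N.
Proof. by move=> h0; rewrite ceiln_gt0 // !mulr_gt0 ?exprn_gt0 // ltr0n. Qed.

Lemma leq_evals h p p' : (p <= p')%N -> (evals gamma h p <= evals gamma h p')%N.
Proof.
move=> pp; apply: leq_ceiln => //.
rewrite -!mulrA ler_wpM2l // ler_wpM2r ?exprn_ge0 ?(ltW gamma_gt0) //.
by rewrite ler_weXn2l // ler1n.
Qed.

(* Above the threshold 2 the ceiling is harmless: evaluation counts determine
   the stratum. *)
Lemma evals_leq_stratum h p p' :
  2 <= h%:R * 2 ^+ p * gamma ^+ (2 * h) ->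
  (evals gamma h p <= evals gamma h p')%N -> (p <= p')%N.
Proof.
move=> h2 le; rewrite leqNgt; apply/negP => pp.
have h3 : 2 * (h%:R * 2 ^+ p' * gamma ^+ (2 * h)) <= h%:R * 2 ^+ p * gamma ^+ (2 * h).
  have -> : 2 * (h%:R * 2 ^+ p' * gamma ^+ (2 * h)) =
      h%:R * 2 ^+ p'.+1 * gamma ^+ (2 * h) by rewrite [2 ^+ p'.+1]exprS; ring.
  rewrite ler_wpM2r ?exprn_ge0 ?(ltW gamma_gt0) //.
  by rewrite ler_wpM2l // ler_weXn2l // ler1n.
have e1 := evals_ge h p; have e2 := evals_lt h p'.
have e3 : (evals gamma h p)%:R <= (evals gamma h p')%:R :> R by rewrite ler_nat.
by lra.
Qed.
End evals.

(** * Nodes sorted by estimate *)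

Section ranking.
Context {R : realType} {A : finType}.
Variables (gamma : R) (tie : rel (seq A)) (Y : seq A -> A -> nat -> R).
Hypotheses (tie_total : total tie) (tie_trans : transitive tie).
Variable T : seq A -> nat.

Local Notation est := (uhat gamma Y T).
Let leT (a a' : seq A) := (est a' < est a) || ((est a' == est a) && tie a a').

Let leT_total : total leT.
Proof.
by move=> a a'; rewrite /leT; case: (ltgtP (est a') (est a)) => //=.
Qed.

Let leT_trans : transitive leT.
Proof.
move=> a2 a1 a3 /orP[l1|/andP[/eqP e1 t1]] /orP[l2|/andP[/eqP e2 t2]]; rewrite /leT.
- by rewrite (lt_trans l2 l1).
- by rewrite e2 l1.
- by rewrite -e1 l2.
- by rewrite e2 e1 eqxx (tie_trans t1 t2) orbT.
Qed.

Let leT_est a a' : leT a a' -> est a' <= est a.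
Proof. by move=> /orP[/ltW//|/andP[/eqP-> _]]. Qed.

Lemma mem_rank_nodes l : rank_nodes gamma tie Y T l =i l.
Proof. exact: mem_sort. Qed.

Lemma rank_nodes_uniq l : uniq (rank_nodes gamma tie Y T l) = uniq l.
Proof. exact: sort_uniq. Qed.

Lemma head_rank_nodes x0 l a : a \in l ->
  head x0 (rank_nodes gamma tie Y T l) \in l /\
  est a <= est (head x0 (rank_nodes gamma tie Y T l)).
Proof.
rewrite -(mem_rank_nodes l a) => ain.
have := sort_sorted leT_total l; have := mem_rank_nodes l; move: ain.
rewrite -[sort leT l]/(rank_nodes gamma tie Y T l).
case: (rank_nodes _ _ _ _ _) => [//|h s] /= ain ml ph; split.
  by rewrite -ml mem_head.
move: ain; rewrite inE => /predU1P[->//|ains]; apply: leT_est.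
by have /allP := order_path_min leT_trans ph; apply.
Qed.

(** Every node ranked before [a] has an estimate at least as high, so the rank of [a] is bounded by
    the number of such nodes. Ties count against [a], which makes the criterion independent of
    [tie]. *)
Lemma mem_take_rank_nodes l a k : a \in l ->
  (count (fun a' => (est a <= est a')%R) l <= k)%N ->
  a \in take k (rank_nodes gamma tie Y T l).
Proof.
move=> ain ck; set s := rank_nodes _ _ _ _ _.
have as_ : a \in s by rewrite mem_rank_nodes.
rewrite in_take // (leq_trans _ ck) //.
have <- : count (fun a' => (est a <= est a')%R) s = count (fun a' => (est a <= est a')%R) l.
  by apply/permP; rewrite perm_sort.
rewrite -(cat_take_drop (index a s).+1 s) count_cat.
apply: leq_trans (leq_addr _ _).
have -> : count (fun a' => (est a <= est a')%R) (take (index a s).+1 s) =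
    size (take (index a s).+1 s).
  apply/eqP; rewrite -all_count; apply/(all_nthP a) => i.
  rewrite size_takel ?index_mem // => ii; rewrite nth_take //.
  rewrite -[X in est X <= _](nth_index a as_).
  apply: leT_est; apply: (sorted_leq_nth leT_trans _ a (sort_sorted leT_total l)).
  - by move=> y; have := leT_total y y; rewrite orbb.
  - by rewrite inE (leq_trans ii) // index_mem.
  - by rewrite inE index_mem.
  - by rewrite -ltnS.
by rewrite size_takel ?index_mem // cat_take_drop.
Qed.
End ranking.

Lemma mem_nodes (A : finType) h (a : seq A) : (a \in nodes h) = (size a == h).
Proof.
apply/mapP/idP => [[t _ ->]|/eqP ha]; first by rewrite size_tuple.
by exists (Tuple (introT eqP ha)) => //; rewrite mem_enum.
Qed.

Lemma nodes_uniq (A : finType) h : uniq (nodes (A := A) h).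
Proof. by rewrite map_inj_uniq ?enum_uniq //; exact: val_inj. Qed.

Lemma count_nodes (A : finType) h (p : pred (seq A)) :
  count p (nodes h) = #|[set a : h.-tuple A | p a]%SET|.
Proof.
rewrite /nodes count_map cardsE cardE /enum_mem size_filter /=.
by rewrite (eq_filter (a2 := predT)) // filter_predT.
Qed.

(** * Invariants of the exploration *)

Section search.
Context {R : realType} {A : finType}.
Variables (n : nat) (gamma : R) (tie : rel (seq A)) (Y : seq A -> A -> nat -> R).
Hypothesis gamma_gt0 : 0 < gamma.

Local Notation H := (hmax R n).
Local Notation evals := (evals gamma).
Local Notation explore_stratum := (explore_stratum n gamma tie Y).
Local Notation explore_depth := (explore_depth n gamma tie Y).

Definition state_le (st st' : search_state A) : Prop :=
  (forall a, (visits st a <= visits st' a)%N) /\ {subset opened st <= opened st'}.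

Lemma state_le_refl st : state_le st st.
Proof. by split. Qed.

Lemma state_le_trans st2 st1 st3 :
  state_le st1 st2 -> state_le st2 st3 -> state_le st1 st3.
Proof.
move=> [v1 o1] [v2 o2]; split => a; first exact: leq_trans (v2 a).
by move=> /o1/o2.
Qed.

(** A node is opened only once, so the counts of its children are equal to [evals (size s) p] for
    the stratum [p] of the opening. This equality lets the stratum be read off the counts, and the
    bound that comes with it passes the information on to the parent. The root is exempt: its
    children receive [H] evaluations. *)
Definition consistent (d : nat) (st : search_state A) : Prop :=
  [/\ forall s c, s \notin opened st -> visits st (rcons s c) = 0%N,
      forall s c, s \in opened st -> s != [::] -> exists p,
        visits st (rcons s c) = evals (size s) p /\
        (evals (size s).-1 p <= visits st s)%N,
      forall c, (H <= visits st [:: c])%N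
    & forall s, s \in opened st -> (size s <= d)%N].

Lemma visits_open_node m (st : search_state A) (a s : seq A) (c : A) :
  visits (open_node m st a) (rcons s c) =
  (visits st (rcons s c) + if s == a then m else 0)%N.
Proof.
rewrite /open_node /=; congr (_ + _)%N.
case: eqP => [->|sa]; case: existsP => //.
  by case; exists c.
by case=> c' /eqP/rcons_inj [].
Qed.

Lemma state_le_open_node m st (a : seq A) : state_le st (open_node m st a).
Proof.
by split => [a'|a' h] /=; [exact: leq_addr | rewrite inE h orbT].
Qed.

Lemma state_le_foldl (I : Type) (g : search_state A -> I -> search_state A) st l :
  (forall st i, state_le st (g st i)) -> state_le st (foldl g st l).
Proof.
move=> gle; elim: l st => [|i l IH] st /=; first exact: state_le_refl.
exact: state_le_trans (gle st i) (IH _).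
Qed.

Lemma consistent_open_node h p st a : (0 < h)%N ->
  consistent h st -> a \notin opened st -> size a = h ->
  (evals h.-1 p <= visits st a)%N -> consistent h (open_node (evals h p) st a).
Proof.
move=> h0 [c1 c2 c3 c4] ao ah ev; split.
- move=> s c; rewrite inE negb_or => /andP[sa so].
  by rewrite visits_open_node (negbTE sa) c1.
- move=> s c; rewrite inE visits_open_node; case: eqP => [-> _ _|sa /= so s0].
    (* The children of a node not yet opened have count zero, so the new count is exactly
       [evals h p]. *)
    exists p; rewrite c1 // ah; split => //; apply: leq_trans ev _.
    exact: (state_le_open_node _ _ _).1.
  have [p' [e1 e2]] := c2 s c so s0; exists p'; rewrite addn0; split => //.
  exact: leq_trans e2 ((state_le_open_node _ _ _).1 s).
- by move=> c; exact: leq_trans (c3 c) ((state_le_open_node _ _ _).1 _).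
- by move=> s; rewrite inE => /predU1P[->|/c4//]; rewrite ah.
Qed.

Lemma open_nodes h p st l : (0 < h)%N -> consistent h st -> uniq l ->
  (forall a, a \in l -> [/\ a \notin opened st, size a = h
    & (evals h.-1 p <= visits st a)%N]) ->
  let st' := foldl (open_node (evals h p)) st l in
  [/\ consistent h st', state_le st st',
      forall a c, a \in l -> (evals h p <= visits st' (rcons a c))%N
    & forall a, a \in opened st' -> a \in l \/ a \in opened st].
Proof.
move=> h0; elim: l st => [|a l IH] st cst /= ul la.
  by split => // [|a]; [exact: state_le_refl | right].
have /andP[al ul'] := ul; have [ao ah ae] := la a (mem_head _ _).
have lle := state_le_open_node (evals h p) st a.
have cst' := consistent_open_node h0 cst ao ah ae.
have [|i1 i2 i3 i4] := IH _ cst' ul'.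
  move=> a' a'l; have [b1 b2 b3] := la a' (mem_behead (s := a :: l) a'l); split => //.
    by rewrite inE negb_or b1 andbT; apply: contraNneq al => <-.
  exact: leq_trans b3 (lle.1 _).
split => //; first exact: state_le_trans lle i2.
- move=> a' c; rewrite inE => /predU1P[->|/i3//].
  apply: leq_trans (i2.1 _); rewrite visits_open_node eqxx; exact: leq_addl.
- move=> a' /i4[a'l|]; first by left; rewrite inE a'l orbT.
  by rewrite inE => /predU1P[->|]; [left; rewrite mem_head | right].
Qed.

Lemma mem_opened_open_nodes m st (l : seq (seq A)) a : a \in l ->
  a \in opened (foldl (open_node m) st l).
Proof.
elim: l st => [//|a' l IH] st; rewrite inE /= => /predU1P[->|]; last exact: IH.
have [_ h] := @state_le_foldl _ (open_node m) (open_node m st a') l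
  (@state_le_open_node m).
exact/h/mem_head.
Qed.

Definition eligible (h p : nat) (st : search_state A) (a : seq A) : bool :=
  [&& size a == h, a \notin opened st, (0 < visits st a)%N
    & (evals h.-1 p <= visits st a)%N].

(** In the last clause the competitors of [a] are counted in the state before the stratum: if the
    places suffice for all of them, [a] itself included, then [a] is opened. *)
Lemma explore_stratum_spec h p st : (0 < h)%N -> consistent h st ->
  let st' := explore_stratum h st p in
  [/\ consistent h st', state_le st st',
      forall a c, a \in opened st' -> a \notin opened st ->
        (evals h p <= visits st' (rcons a c))%N
    & total tie -> transitive tie -> forall a, eligible h p st a ->
      (count (fun a' => eligible h p st a' && (uhat gamma Y (visits st) a <=
         uhat gamma Y (visits st) a')%R) (nodes h)
        <= H %/ (h * evals h p))%N -> a \in opened st'].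
Proof.
move=> h0 cst; set st' := Defs.explore_stratum _ _ _ _ _ _ _.
set l0 := [seq a <- nodes h | [&& a \notin opened st, (0 < visits st a)%N
                              & (evals h.-1 p <= visits st a)%N]].
set l := take (H %/ (h * evals h p)) (rank_nodes gamma tie Y (visits st) l0).
have l0E a : (a \in l0) = eligible h p st a.
  by rewrite mem_filter mem_nodes andbC /eligible.
have ll0 a : a \in l -> eligible h p st a.
  by move=> /mem_take; rewrite mem_rank_nodes l0E.
have ul : uniq l by rewrite take_uniq // rank_nodes_uniq filter_uniq // nodes_uniq.
have [|i1 i2 i3 i4] := @open_nodes h p st l h0 cst ul.
  by move=> a /ll0 /and4P[/eqP ? ? ? ?].
split => //.
- move=> a c aop aon; apply: i3; case: (i4 a aop) => // aop'.
  by rewrite aop' in aon.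
move=> tt ttr a ae cnt.
suff al : a \in l.
  by rewrite /st' /Defs.explore_stratum -/l0 -/l mem_opened_open_nodes.
apply: mem_take_rank_nodes => //; first by rewrite l0E.
apply: leq_trans cnt; rewrite count_filter leq_eqVlt; apply/orP; left; apply/eqP.
apply: eq_in_count => a'; rewrite mem_nodes => sa' /=.
by rewrite /eligible sa' andbC.
Qed.

Lemma consistent_leq d d' st : (d <= d')%N -> consistent d st -> consistent d' st.
Proof.
move=> dd [c1 c2 c3 c4]; split => // s so; exact: leq_trans (c4 s so) dd.
Qed.

(** Strata are visited by decreasing index. Applied to those preceding [p], the last clause says
    that a node opened before stratum [p] is no worse evaluated than one opened in it. *)
Lemma explore_strata_spec h st l : (0 < h)%N -> consistent h st ->
  let st' := foldl (explore_stratum h) st l in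
  [/\ consistent h st', state_le st st'
    & forall p a c, all (geq^~ p) l -> a \in opened st' -> a \notin opened st ->
        (evals h p <= visits st' (rcons a c))%N].
Proof.
move=> h0; elim: l st => [|p' l IH] st cst /=.
  by split => // [|p a c _ ->//]; exact: state_le_refl.
have [c1 l1 o1 _] := explore_stratum_spec p' h0 cst.
have [c2 l2 o2] := IH _ c1; split => //; first exact: state_le_trans l1 l2.
move=> p a c /andP[pp pl] ao an.
have [ao'|ao'] := boolP (a \in opened (explore_stratum h st p')).
  apply: leq_trans (l2.1 _); apply: leq_trans (o1 a c ao' an).
  exact: leq_evals.
exact: o2.
Qed.

Lemma explore_depth_le st h : (0 < h)%N -> consistent h st ->
  consistent h (explore_depth st h) /\ state_le st (explore_depth st h).
Proof. by move=> h0 cst; have [] := explore_strata_spec (strata n gamma h) h0 cst. Qed.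

Definition initial_state : search_state A :=
  open_node H (SearchState (fun=> 0%N) [::]) [::].

Definition state_at (k : nat) : search_state A :=
  foldl explore_depth initial_state (iota 1 k).

Lemma state_atS k : state_at k.+1 = explore_depth (state_at k) k.+1.
Proof. by rewrite /state_at -{1}(addn1 k) iotaD foldl_cat /= add1n. Qed.

Lemma consistent_state_at k : consistent k (state_at k).
Proof.
elim: k => [|k IH]; last first.
  by rewrite state_atS; apply: (explore_depth_le _ _).1 => //; exact: consistent_leq IH.
have iE s c : visits initial_state (rcons s c) = (if s == [::] then H else 0)%N.
  by rewrite visits_open_node.
have oE s : (s \in opened initial_state) = (s == [::]) by rewrite mem_seq1.
change (consistent 0 initial_state); split.
- by move=> s c; rewrite oE iE => /negbTE->.
- by move=> s c; rewrite oE => ->.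
- by move=> c; have := iE [::] c; rewrite /= => ->.
- by move=> s; rewrite oE => /eqP->.
Qed.

Lemma state_at_le k k' : (k <= k')%N -> state_le (state_at k) (state_at k').
Proof.
move=> /subnK <-; elim: (k' - k)%N => [|j IH]; first exact: state_le_refl.
rewrite addSn state_atS; apply: state_le_trans IH _.
apply: (explore_depth_le _ _).2 => //.
exact: consistent_leq (consistent_state_at _).
Qed.

(* A node evaluated enough for stratum [p] was opened at a stratum [>= p], so
   the same holds for all its prefixes. *)
Lemma eligible_prefix d p h st a : consistent d st -> (2 ^ p <= H)%N ->
  2 <= 2 ^+ p * gamma ^+ (2 * h) -> gamma <= 1 -> (0 < size a <= h.+1)%N ->
  (0 < visits st a)%N -> (evals (size a).-1 p <= visits st a)%N ->
  forall t, (t < size a)%N -> (0 < visits st (take t.+1 a))%N /\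
    2 ^+ p * gamma ^+ (2 * t) <= (visits st (take t.+1 a))%:R :> R.
Proof.
move=> [c1 c2 c3 c4] pH p2 g1; elim/last_ind: a => [//|s c IH].
rewrite size_rcons /= ltnS => sh v0 ve.
have base t : t = size s -> (0 < visits st (take t.+1 (rcons s c)))%N /\
    2 ^+ p * gamma ^+ (2 * t) <= (visits st (take t.+1 (rcons s c)))%:R :> R.
  move=> ->; rewrite take_oversize ?size_rcons //; split => //.
  have [s0|s0] := posnP (size s).
    rewrite s0 muln0 expr0 mulr1 (size0nil s0) /= -natrX ler_nat.
    exact: leq_trans pH (c3 c).
  apply: (@le_trans _ _ (evals (size s) p)%:R); last by rewrite ler_nat.
  apply: le_trans (evals_ge _ _ _) => //; rewrite -mulrA ler_peMl ?ler1n //.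
  by rewrite mulr_ge0 // exprn_ge0 // ltW.
move=> t; rewrite ltnS leq_eqVlt => /predU1P[/base//|ts].
have s0 : s != [::] by case: (s) ts.
have so : s \in opened st.
  by apply: contraTT v0 => /c1 ->.
have [p' [e1 e2]] := c2 s c so s0.
(* The threshold of [evals_leq_stratum] is smallest at depth [h], up to the factor [j >= 1], so it
   holds at all depths up to [h]. *)
have big j : (0 < j <= h)%N -> 2 <= j%:R * 2 ^+ p * gamma ^+ (2 * j) :> R.
  move=> /andP[j0 jh]; apply: (le_trans p2).
  apply: (@le_trans _ _ (2 ^+ p * gamma ^+ (2 * j))).
    rewrite ler_wpM2l // ler_wiXn2l ?(ltW gamma_gt0) //.
    by rewrite leq_mul2l.
  by rewrite -mulrA ler_peMl ?ler1n // mulr_ge0 // exprn_ge0 // ltW.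
have ss0 : (0 < size s)%N by rewrite lt0n size_eq0.
have pp : (p <= p')%N.
  apply: (evals_leq_stratum gamma_gt0 (h := size s)); last by rewrite -e1.
  by apply: big; rewrite ss0.
have ve' : (evals (size s).-1 p <= visits st s)%N.
  by apply: leq_trans e2; exact: leq_evals.
(* At depth one the threshold [evals 0 p] is zero, and positivity comes from the opening of the
   root. *)
have v0' : (0 < visits st s)%N.
  have [s1|s1] := posnP (size s).-1.
    have : size s = 1%N by lia.
    case: (s) => [//|c' [|//]] _.
    by apply: leq_trans (c3 c'); apply: leq_trans pH; rewrite expn_gt0.
  by apply: leq_trans e2; exact: evals_gt0.
have sle : (0 < size s <= h.+1)%N by rewrite ss0 ltnW.
have := IH sle v0' ve' t ts.
rewrite -cats1 takel_cat //.
Qed.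
End search.

(** * Deterministic guarantee on the returned node *)

Section guarantee.
Context {R : realType} {X : Type} {A : finType}.
Variables (f : X -> A -> X) (r : X -> A -> R) (x : X).
Variables (n : nat) (gamma : R) (tie : rel (seq A)) (Y : seq A -> A -> nat -> R).
Variables (nu rho B S : R) (s : nat -> A) (h p : nat).

Local Notation H := (hmax R n).
Local Notation evals := (evals gamma).
Local Notation uhat := (uhat gamma Y).
Local Notation u := (u f r gamma x).
Local Notation vstar := (vstar f r gamma x).
Local Notation near_optimal := (near_optimal f r gamma x).
Local Notation state_at := (state_at n gamma tie Y).
Local Notation cross_validate := (cross_validate n gamma tie Y).

(** [sigma] is the effective sample size at the root; deeper actions may have fewer evaluations,
    since the discount reduces their error. The counts [T] are a parameter because nodes are
    compared in rounds with different counts. *)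
Definition well_estimated (sigma : R) (T : seq A -> nat) (a : seq A) : Prop :=
  forall t, (t < size a)%N -> (0 < T (take t.+1 a))%N /\
    sigma * gamma ^+ (2 * t) <= (T (take t.+1 a))%:R.

Hypotheses (gamma01 : 0 < gamma < 1) (rho01 : 0 < rho <= 1) (nu_ge0 : 0 <= nu)
  (tie_total : total tie) (tie_trans : transitive tie)
  (optimal : forall k, vstar - nu * rho ^+ k <= u (mkseq s k))
  (error : forall T a sigma, (size a <= H.+1)%N -> 0 < sigma -> sigma <= S ->
     well_estimated sigma T a -> `|uhat T a - u a| <= B / Num.sqrt sigma).
Hypotheses (hH : (h <= H)%N) (hp : 2 <= 2 ^+ p * gamma ^+ (2 * h))
  (pH : (2 ^ p <= H)%N) (HS : H%:R <= S) (pp : (p <= pmax R n)%N)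
  (few : forall k, (0 < k <= h)%N ->
     (near_optimal k (3 * nu * rho ^+ k) <= H %/ (k * evals k p))%N)
  (pstrata : forall k, (0 < k <= h)%N -> p \in strata n gamma k)
  (Bh : B / Num.sqrt (2 ^+ p) <= nu * rho ^+ h).

Let gamma_gt0 : 0 < gamma. Proof. by case/andP: gamma01. Qed.
Let gamma_le1 : gamma <= 1. Proof. by case/andP: gamma01 => _ /ltW. Qed.
Let H_gt0 : (0 < H)%N. Proof. by apply: leq_trans pH; rewrite expn_gt0. Qed.

Let error_p T a : (size a <= H.+1)%N -> well_estimated (2 ^+ p) T a ->
  `|uhat T a - u a| <= B / Num.sqrt (2 ^+ p).
Proof.
move=> sa wa; apply: error => //.
by apply: le_trans HS; rewrite -natrX ler_nat.
Qed.

(** A node that outranks the optimal prefix loses at most [nu * rho^k.+1] for the bias of that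
    prefix and as much for each of the two estimation errors: this is the [3] in the definition of
    the branching factor. *)
Lemma count_competitors k st : (k < h)%N -> consistent n gamma k.+1 st ->
  eligible gamma k.+1 p st (mkseq s k.+1) ->
  (count (fun a => eligible gamma k.+1 p st a &&
     (uhat (visits st) (mkseq s k.+1) <= uhat (visits st) a)%R) (nodes k.+1)
   <= H %/ (k.+1 * evals k.+1 p))%N.
Proof.
move=> kh cst es; have kh' : (0 < k.+1 <= h)%N by [].
apply: leq_trans (few kh'); rewrite count_nodes /Defs.near_optimal.
apply/subset_leq_card/fintype.subsetP => a.
have el a' : eligible gamma k.+1 p st a' ->
    `|uhat (visits st) a' - u a'| <= nu * rho ^+ k.+1.
  move=> /and4P[/eqP sa _ v0 ve].
  have le1 : nu * rho ^+ h <= nu * rho ^+ k.+1.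
    have /andP[r0 r1] := rho01.
    by rewrite ler_wpM2l // ler_wiXn2l // ltW.
  apply: le_trans le1; apply: le_trans Bh; apply: error_p.
    by rewrite sa (leq_trans kh) // (leq_trans hH).
  apply: (eligible_prefix gamma_gt0 cst pH hp) => //.
    by rewrite sa /= ltnS ltnW.
  by rewrite sa.
rewrite !inE => /andP[ea le].
have := el _ ea; have := el _ es; have := optimal k.+1.
rewrite !ler_norml => o1 /andP[e1 e2] /andP[e3 e4].
move: (nu * rho ^+ k.+1) o1 e1 e2 e3 e4 (mulrA 3 nu (rho ^+ k.+1)) => y.
by move=> o1 e1 e2 e3 e4 <-; lra.
Qed.

(** When a depth is explored, the optimal prefix either was opened in a stratum before [p], with at
    least as many evaluations, or is eligible in stratum [p], where the places suffice for all its
    competitors. *)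
Lemma optimal_prefix_visits k c : (k <= h)%N ->
  (0 < visits (state_at k) (rcons (mkseq s k) c))%N /\
  (evals k p <= visits (state_at k) (rcons (mkseq s k) c))%N.
Proof.
elim: k c => [|k IH] c kh.
  have [_ _ c3 _] := consistent_state_at n tie Y gamma_gt0 0.
  by rewrite evals0 /=; split => //; exact: leq_trans H_gt0 (c3 c).
suff ev : (evals k.+1 p <= visits (state_at k.+1) (rcons (mkseq s k.+1) c))%N.
  by split => //; apply: leq_trans ev; exact: evals_gt0.
have [v0 ve] := IH (s k) (ltnW kh); have pin := @pstrata k.+1 kh.
have cst := consistent_state_at n tie Y gamma_gt0 k.
rewrite state_atS /Defs.explore_depth.
set a := mkseq s k.+1; have aE : a = rcons (mkseq s k) (s k).
  by rewrite /a /mkseq -[in LHS]addn1 iotaD map_cat cats1.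
rewrite -aE in v0 ve.
have sa : size a = k.+1 by rewrite size_mkseq.
have an : a \notin opened (state_at k).
  have [_ _ _ c4] := cst; apply/negP => /c4; by rewrite sa ltnn.
have cst1 := consistent_leq (leqnSn k) cst.
(* The list of strata is decreasing, so everything before [p] is above it. *)
have : exists l1 l2, strata n gamma k.+1 = l1 ++ p :: l2 /\ all (geq^~ p) l1.
  move: pin; rewrite /strata; case: (Num.floor _) => // P.
  rewrite mem_rev mem_iota add0n => /andP[_ pP].
  exists (rev (iota p.+1 (P - p))), (rev (iota 0 p)); split.
    have -> : P.+1 = (p.+1 + (P - p))%N by rewrite addSn subnKC.
    by rewrite iotaD add0n rev_cat -addn1 iotaD add0n addn1 rev_cat.
  by apply/allP => q; rewrite mem_rev mem_iota => /andP[/ltnW].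
move=> [l1 [l2 [-> pl1]]]; set ac := rcons a c; rewrite foldl_cat /=.
have [cs1 le1 op1] := explore_strata_spec tie Y gamma_gt0 l1 (ltn0Sn k) cst1.
set st1 := foldl _ (state_at k) l1 in cs1 le1 op1 *.
have [cs2 le2 op2 found] := explore_stratum_spec tie Y p (ltn0Sn k) cs1.
set st2 := Defs.explore_stratum _ _ _ _ _ st1 p in cs2 le2 op2 found *.
have [_ le3 _] := explore_strata_spec tie Y gamma_gt0 l2 (ltn0Sn k) cs2.
apply: leq_trans (le3.1 _).
have [ao|ao] := boolP (a \in opened st1).
  by apply: leq_trans (le2.1 _); exact: op1.
apply: op2 => //; have ea : eligible gamma k.+1 p st1 a.
  rewrite /eligible sa eqxx ao /=; apply/andP; split.
    exact: leq_trans v0 (le1.1 a).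
  exact: leq_trans ve (le1.1 a).
apply: found => //; exact: count_competitors.
Qed.

Definition counts_le (T T' : seq A -> nat) : Prop := forall a, (T a <= T' a)%N.

Definition validated (T : seq A -> nat) (a : seq A) : Prop :=
  forall t, (t < size a)%N -> (ceiln (t.+1%:R * gamma ^+ (2 * t) * H%:R *
    (1 - gamma ^+ 2) ^+ 2) <= T (take t.+1 a))%N.

Definition selected (T : seq A -> nat) (q : nat) : seq A :=
  head [::] (rank_nodes gamma tie Y T (candidates n gamma T q)).

Lemma cross_validateE T L q : cross_validate (T, L) q =
  ((cross_validate (T, L) q).1, rcons L (selected T q)).
Proof. by []. Qed.

Lemma cross_validate_spec T L q : counts_le T (cross_validate (T, L) q).1 /\
  validated (cross_validate (T, L) q).1 (selected T q).
Proof.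
split => [a|t ta] /=; first exact: leq_addr.
rewrite -/(selected T q); apply: leq_trans (leq_addl _ _).
by rewrite (bigD1 (Ordinal ta)) ?eqxx //= leq_addr.
Qed.

(** Counts change from round to round: a node is selected with intermediate counts [T1], whereas the
    final comparison uses [T']. Both facts are kept, since validation is inherited by the larger
    final counts. *)
Lemma foldl_cross_validate T L qs :
  let: (T', L') := foldl cross_validate (T, L) qs in
  [/\ counts_le T T',
      forall a, a \in L -> a \in L',
      forall q, q \in qs -> exists T1,
        [/\ counts_le T T1, counts_le T1 T' & selected T1 q \in L']
    & forall a, a \in L' -> a \in L \/ validated T' a /\
        exists q T1, [/\ counts_le T T1, counts_le T1 T' & a = selected T1 q]].
Proof.
elim: qs T L => [|q qs IH] T L; first by split => // a; left.
rewrite -[foldl _ _ (q :: qs)]/(foldl cross_validate (cross_validate (T, L) q) qs).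
rewrite cross_validateE; have [le1 val1] := cross_validate_spec T L q.
set T1 := (cross_validate (T, L) q).1 in le1 val1 *.
have := IH T1 (rcons L (selected T q)).
case: (foldl _ _ qs) => T' L' [le' sub' all' only'].
have le : counts_le T T' by move=> a; exact: leq_trans (le1 a) (le' a).
split => //.
- by move=> a aL; apply: sub'; rewrite mem_rcons inE aL orbT.
- move=> q'; rewrite inE => /predU1P[->|/all'[T2 [l1 l2 m2]]].
    by exists T; split => //; apply: sub'; rewrite mem_rcons mem_head.
  by exists T2; split => // a; exact: leq_trans (le1 a) (l1 a).
move=> a /only'[|[va [q' [T2 [l1 l2 aE]]]]]; last first.
  right; split => //.
  by exists q', T2; split => // a'; exact: leq_trans (le1 a') (l1 a').
rewrite mem_rcons inE => /predU1P[->|]; last by left.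
right; split; last by exists q, T; split.
by move=> t ta; exact: leq_trans (val1 t ta) (le' _).
Qed.

(** One-action nodes carry the [H] evaluations of the root, so the list of candidates is never empty
    and the default of [head] is not selected. Here [t] is a position, so [evals t q] is the
    threshold for the prefix of length [t.+1]. *)
Lemma selectedP T q : counts_le (visits (state_at H)) T ->
  [/\ (0 < size (selected T q) <= H.+1)%N,
      forall t, (t < size (selected T q))%N ->
        (0 < T (take t.+1 (selected T q)))%N /\
        (evals t q <= T (take t.+1 (selected T q)))%N,
      forall c, (H <= T [:: c])%N
    & forall a, a \in candidates n gamma T q ->
        uhat T a <= uhat T (selected T q)].
Proof.
move=> le0; have HT c : (H <= T [:: c])%N.
  have [_ _ c3 _] := consistent_state_at n tie Y gamma_gt0 H.
  exact: leq_trans (c3 c) (le0 _).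
have c0in : [:: s 0%N] \in candidates n gamma T q.
  rewrite mem_filter; apply/andP; split; first by rewrite (leq_trans H_gt0 (HT _)).
  apply/flattenP.
  exists (nodes 1); last by rewrite mem_nodes.
  by apply/mapP; exists 1%N => //; rewrite mem_iota.
have [inc _] := head_rank_nodes gamma Y tie_total tie_trans T [::] c0in.
rewrite -/(selected T q) in inc.
split => //; last first.
  by move=> a ain; have [_] := head_rank_nodes gamma Y tie_total tie_trans T [::] ain.
- move=> t ts; move: inc; rewrite mem_filter => /andP[/andP[T0 /allP ev] _].
  case: t ts => [|t] ts.
    rewrite evals0; split => //; case: (selected T q) ts => [//|c l] _ /=.
    by rewrite take0; exact: leq_trans H_gt0 (HT c).
  have e : (evals t.+1 q <= T (take t.+2 (selected T q)))%N.
    by apply: (ev t.+2); rewrite mem_iota; move: ts; case: (size _).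
  by split => //; apply: leq_trans e; exact: evals_gt0.
move: inc; rewrite mem_filter => /andP[_ /flattenP[l /mapP[j]]].
by rewrite mem_iota => /andP[j0 j1] -> /[!mem_nodes]/eqP->; rewrite j0 -ltnS.
Qed.

Lemma selected_well_estimated T q : counts_le (visits (state_at H)) T ->
  (2 ^ q <= H)%N -> well_estimated (2 ^+ q) T (selected T q).
Proof.
move=> lT qH t ts; have [sz ev HT _] := selectedP q lT.
have [T0 te] := ev t ts; split => //.
(* At position [0] the threshold [evals 0 q] is void; the [H >= 2^q] evaluations of the first action
   replace it. *)
case: t ts T0 te => [|t] ts T0 te.
  rewrite muln0 expr0 mulr1 -natrX ler_nat.
  case: (selected T q) ts => [//|c l] _; rewrite /= take0.
  exact: leq_trans qH (HT c).
apply: (@le_trans _ _ (evals t.+1 q)%:R); last by rewrite ler_nat.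
apply: le_trans (evals_ge _ _ _) => //; rewrite -mulrA ler_peMl ?ler1n //.
by rewrite mulr_ge0 // exprn_ge0 // ltW.
Qed.

(** Two comparisons. In the final estimates the output beats the node selected in round [p], both
    being validated; in the estimates of round [p] that node beats the optimal prefix. Each
    comparison costs two errors. The optimal prefix has length [h.+1], since opening its prefix of
    length [h] evaluates the next action. *)
Lemma output_guarantee :
  let err := B / Num.sqrt (2 ^+ p) + B / Num.sqrt (H%:R * (1 - gamma ^+ 2) ^+ 2) in
  output_node n gamma tie Y != [::] /\
  vstar - nu * rho ^+ h.+1 - 2 * err <= u (output_node n gamma tie Y).
Proof.
set e1 := B / Num.sqrt (2 ^+ p); set e2 := B / _.
have := foldl_cross_validate (visits (state_at H)) [::] (iota 0 (pmax R n).+1).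
rewrite /output_node -[exploration n gamma tie Y]/(state_at H).
case: (foldl _ _ _) => T L [leL _ allL onlyL].
have pin : p \in iota 0 (pmax R n).+1 by rewrite mem_iota.
have [T1 [l1 l2 sL]] := allL p pin.
have [_ max_out] := head_rank_nodes gamma Y tie_total tie_trans T [::] sL.
have [outL _] := head_rank_nodes gamma Y tie_total tie_trans T [::] sL.
set out := head [::] _ in max_out outL *.
have [sz ev HT best] := selectedP p l1.
(* Validation provides the effective sample size [H * (1 - gamma^2)^2]; the factor [t.+1] is
   dropped. *)
have out_in a : a \in L -> (0 < size a <= H.+1)%N /\
    `|uhat T a - u a| <= e2.
  move=> /onlyL[//|[va [q [T2 [le1 le2 aE]]]]].
  have [sz2 ev2 _ _] := selectedP q le1; rewrite -aE in sz2 ev2.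
  split => //; have /andP[_ sz3] := sz2.
  have g2 : 0 < 1 - gamma ^+ 2.
    by rewrite subr_gt0 exprn_ilt1 // ?ltW //; case/andP: gamma01.
  have Hr : 0 < H%:R :> R by rewrite ltr0n.
  apply: error => //; first by rewrite mulr_gt0 // exprn_gt0.
    apply: le_trans HS; rewrite ler_piMr ?(ltW Hr) //.
    have g3 : 1 - gamma ^+ 2 <= 1 by rewrite gerBl sqr_ge0.
    exact: exprn_ile1 (ltW g2) g3.
  move=> t ta; have [T0 _] := ev2 t ta; split.
    exact: leq_trans T0 (le2 _).
  apply: le_trans (_ : (ceiln (t.+1%:R * gamma ^+ (2 * t) * H%:R *
    (1 - gamma ^+ 2) ^+ 2))%:R <= _); last by rewrite ler_nat; exact: va.
  have c0 : 0 <= gamma ^+ (2 * t) * H%:R * (1 - gamma ^+ 2) ^+ 2.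
    apply: mulr_ge0; last exact: exprn_ge0 (ltW g2).
    by apply: mulr_ge0 => //; exact: exprn_ge0 (ltW gamma_gt0).
  apply: le_trans (ceiln_ge _); last by rewrite -!mulrA mulr_ge0 // mulrA.
  have -> : H%:R * (1 - gamma ^+ 2) ^+ 2 * gamma ^+ (2 * t) =
    gamma ^+ (2 * t) * H%:R * (1 - gamma ^+ 2) ^+ 2 by ring.
  by rewrite -[leRHS]mulrA -[leRHS]mulrA [X in _ <= _ * X]mulrA ler_peMl ?ler1n.
have [out_sz out_err] := out_in _ outL; have [_ sel_err] := out_in _ sL.
split; first by case/andP: out_sz; case: (out).
have est_sel : `|uhat T1 (selected T1 p) - u (selected T1 p)| <= e1.
  by apply: error_p; [case/andP: sz | exact: selected_well_estimated].
pose a := mkseq s h.+1.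
have a_v k c : (k <= h)%N -> (0 < T1 (rcons (mkseq s k) c))%N /\
    (evals k p <= T1 (rcons (mkseq s k) c))%N.
  move=> kh; have [v0 ve] := optimal_prefix_visits c kh.
  have [le3 _] := state_at_le n tie Y gamma_gt0 (leq_trans kh hH).
  by split; [apply: leq_trans v0 _|apply: leq_trans ve _];
    exact: leq_trans (le3 _) (l1 _).
have takeE t : (t <= h)%N -> take t.+1 a = rcons (mkseq s t) (s t).
  move=> th; rewrite /a /mkseq -map_take take_iota.
  have -> : minn t.+1 h.+1 = t.+1 by apply/minn_idPl.
  by rewrite -[in LHS]addn1 iotaD map_cat cats1.
have ain : a \in candidates n gamma T1 p.
  rewrite mem_filter; apply/andP; split; [apply/andP; split|].
  - have := (a_v h (s h) (leqnn h)).1; rewrite -takeE //.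
    by rewrite take_oversize // size_mkseq.
  - apply/allP => t0; rewrite mem_iota size_mkseq; case: t0 => [|[|t]] // ht.
    have th : (t.+1 <= h)%N by case/andP: ht => _; rewrite !ltnS.
    by rewrite takeE //; exact: (a_v _ _ th).2.
  apply/flattenP; exists (nodes h.+1); last by rewrite mem_nodes size_mkseq.
  by apply/mapP; exists h.+1 => //; rewrite mem_iota /= add1n !ltnS.
have est_a : `|uhat T1 a - u a| <= e1.
  apply: error_p; first by rewrite size_mkseq ltnS.
  move=> t; rewrite size_mkseq ltnS => th; rewrite takeE //.
  have [v0 ve] := a_v t (s t) th; split => //.
  case: t th v0 ve => [|t] th v0 ve.
    rewrite muln0 expr0 mulr1 -natrX ler_nat; exact: leq_trans pH (HT _).
  apply: (@le_trans _ _ (evals t.+1 p)%:R); last by rewrite ler_nat.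
  apply: le_trans (evals_ge _ _ _) => //; rewrite -mulrA ler_peMl ?ler1n //.
  by rewrite mulr_ge0 // exprn_ge0 // ltW.
have := best _ ain; have := optimal h.+1; rewrite -/a.
move: out_err sel_err est_sel est_a; rewrite !ler_norml.
move=> /andP[? ?] /andP[? ?] /andP[? ?] /andP[? ?] ? ?.
clearbody e1 e2 out a; lra.
Qed.
End guarantee.

(** * Choice of the depth and of the stratum *)

(* Replacing the critical depth [t] by a smaller [h] lowers the left-hand side
   by at most a polylogarithmic factor, which the factor [V] makes up for:
   either [t - h] is at most logarithmic in [Z], or the discount [a] wins. *)
Lemma stratum_large (R : realType) (a rr lm t G g V Z C c1 Hr : R) (h j : nat) :
  let lq := 2 * rr - 2 * a in let lM := lm + 2 * rr in
  0 < a -> a <= rr -> 0 <= lm -> (0 < h)%N -> 0 < t -> 0 < G -> 0 < g ->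
  0 < V -> 1 <= Z -> 0 < C -> 0 < c1 -> lq <= 2 * a * j%:R ->
  1 <= t * G * g * expR (t * lq) ->
  (1 <= t -> 2 * C * G * g * c1 * expR (t * lM) <= Hr) ->
  Hr < 4 * C * h.+1%:R ^+ 2 * G * V * expR (h.+1%:R * lM) ->
  2 * t * g * Z ^+ j <= V ->
  4 * t * h.+1%:R ^+ 2 * expR lM / c1 <= Z ->
  2 <= G * V * expR (h%:R * lq).
Proof.
move=> lq lM a0 ar lm0 h0 t0 G0 g0 V0 Z1 C0 c10 lqj i1 i2 i3 VZ ZZ.
have Z0 : 0 < Z by exact: lt_le_trans ltr01 Z1.
have lq0 : 0 <= lq by rewrite /lq; lra.
have E0 := expR_gt0 (h%:R * lq).
have GE : 0 < G * expR (h%:R * lq) by rewrite mulr_gt0.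
have tg0 : 0 < t * g by rewrite mulr_gt0.
pose th := t - h%:R.
have tE : expR (t * lq) = expR (h%:R * lq) * expR (th * lq).
  by rewrite -expRD; congr expR; rewrite /th; ring.
have small : expR (th * lq) <= Z ^+ j -> 2 <= G * V * expR (h%:R * lq).
  move=> hZ; have h1 : 1 <= t * g * (G * expR (h%:R * lq)) * Z ^+ j.
    apply: (le_trans i1).
    have -> : t * G * g * expR (t * lq) =
      t * g * (G * expR (h%:R * lq)) * expR (th * lq) by rewrite tE; ring.
    by rewrite ler_wpM2l // ltW // mulr_gt0.
  have -> : G * V * expR (h%:R * lq) = V * (G * expR (h%:R * lq)) by ring.
  apply: (@le_trans _ _ (2 * t * g * Z ^+ j * (G * expR (h%:R * lq)))).
    have -> : 2 * t * g * Z ^+ j * (G * expR (h%:R * lq)) =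
      2 * (t * g * (G * expR (h%:R * lq)) * Z ^+ j) by ring.
    by rewrite -[leLHS]mulr1 ler_wpM2l.
  by rewrite ler_wpM2r // ltW.
have lnZ : 0 <= ln Z by rewrite ln_ge0.
(* If [exp (2 a (t - h)) <= Z], the choice of [j] bounds the loss by [Z^j], which [V] absorbs.
   Otherwise [t > h], and the budgets at the two depths are compared. *)
have [th1|th1] := leP (th * (2 * a)) (ln Z).
  apply: small; rewrite -[Z]lnK ?posrE // -expRM_natl ler_expR.
  have [th0|th0] := leP th 0.
    apply: (@le_trans _ _ 0); last by rewrite mulr_ge0.
    by rewrite mulr_le0_ge0.
  apply: (@le_trans _ _ (th * (2 * a * j%:R))).
    by rewrite ler_wpM2l // ltW.
  by rewrite mulrA [leRHS]mulrC ler_wpM2r.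
have th0 : 0 < th.
  by have := le_lt_trans lnZ th1; rewrite pmulr_lgt0 // mulr_gt0.
have t1 : 1 <= t.
  have : 1 <= h%:R :> R by rewrite ler1n.
  by move: th0; rewrite /th; lra.
have h2 := i2 t1.
have tM : expR (t * lM) = expR (h%:R * lM) * expR (th * lM).
  by rewrite -expRD; congr expR; rewrite /th; ring.
have hM : expR (h.+1%:R * lM) = expR (h%:R * lM) * expR lM.
  by rewrite -expRD; congr expR; rewrite -natr1; ring.
(* The budget suffices at [t] and fails at [h.+1]; dividing the two inequalities bounds
   [exp ((t - h) lM)]. *)
have k1 : g * c1 * expR (th * lM) <= 2 * h.+1%:R ^+ 2 * V * expR lM.
  have pos : 0 < 2 * C * G * expR (h%:R * lM).
    by rewrite !mulr_gt0 ?expR_gt0.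
  rewrite -(ler_pM2l pos) ltW //.
  have -> : 2 * C * G * expR (h%:R * lM) * (g * c1 * expR (th * lM)) =
    2 * C * G * g * c1 * expR (t * lM) by rewrite tM; ring.
  apply: (le_lt_trans h2); apply: (lt_le_trans i3).
  rewrite hM le_eqVlt; apply/orP; left; apply/eqP; ring.
(* Here [lM - lq = lm + 2 a >= 2 a]: replacing [lM] by [lq] gains the factor [Z], because
   [2 a (t - h)] exceeds [ln Z] in this case. *)
have k2 : expR (th * lq) <= expR (th * lM) / Z.
  rewrite -[X in _ / X]lnK ?posrE // -expRN -expRD ler_expR.
  apply: (@le_trans _ _ (th * lM - th * (2 * a))); last by rewrite lerD2l lerN2 ltW.
  rewrite -mulrBr ler_wpM2l ?(ltW th0) //; rewrite /lq /lM; lra.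
have i4 : 1 <= t * (G * expR (h%:R * lq)) * (g * expR (th * lM)) / Z.
  apply: (le_trans i1).
  have -> : t * G * g * expR (t * lq) =
    t * g * (G * expR (h%:R * lq)) * expR (th * lq) by rewrite tE; ring.
  have -> : t * (G * expR (h%:R * lq)) * (g * expR (th * lM)) / Z =
    t * g * (G * expR (h%:R * lq)) * (expR (th * lM) / Z) by ring.
  by rewrite ler_wpM2l // ltW // mulr_gt0.
have k3 : g * expR (th * lM) <= 2 * h.+1%:R ^+ 2 * V * expR lM / c1.
  by rewrite ler_pdivlMr // mulrAC.
have k4 : 2 * h.+1%:R ^+ 2 * V * expR lM / c1 * t * 2 <= V * Z.
  have -> : 2 * h.+1%:R ^+ 2 * V * expR lM / c1 * t * 2 =
    V * (4 * t * h.+1%:R ^+ 2 * expR lM / c1).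
    by field; rewrite gt_eqF.
  by rewrite ler_wpM2l // ltW.
have i5 : Z <= t * (G * expR (h%:R * lq)) * (g * expR (th * lM)).
  by move: i4; rewrite ler_pdivlMr // mul1r.
have i6 : 2 * Z <= V * Z * (G * expR (h%:R * lq)).
  apply: (@le_trans _ _ (2 * (t * (G * expR (h%:R * lq)) * (g * expR (th * lM))))).
    by rewrite ler_pM2l.
  apply: (@le_trans _ _ (2 * h.+1%:R ^+ 2 * V * expR lM / c1 * t * 2 * (G * expR (h%:R * lq)))).
    have -> : 2 * (t * (G * expR (h%:R * lq)) * (g * expR (th * lM))) =
      (2 * t * (G * expR (h%:R * lq))) * (g * expR (th * lM)) by ring.
    have -> : 2 * h.+1%:R ^+ 2 * V * expR lM / c1 * t * 2 * (G * expR (h%:R * lq)) =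
      (2 * t * (G * expR (h%:R * lq))) * (2 * h.+1%:R ^+ 2 * V * expR lM / c1) by ring.
    by rewrite ler_wpM2l // ltW // !mulr_gt0.
  by rewrite ler_wpM2r // ltW.
rewrite -(ler_pM2l Z0); apply: le_trans (_ : V * Z * (G * expR (h%:R * lq)) <= _).
  by rewrite mulrC.
by rewrite le_eqVlt; apply/orP; left; apply/eqP; ring.
Qed.

Lemma dyadic_between (R : realType) (y : R) : 1 <= y ->
  exists p : nat, y <= 2 ^+ p <= 2 * y.
Proof.
move=> y1.
have ex : exists p : nat, y <= 2 ^+ p.
  exists (Num.truncn y).+1; have /andP[_ /ltW h] := truncn_itv (le_trans ler01 y1).
  apply: (le_trans h); rewrite -natrX ler_nat ltnW // ltn_expl //.
have [[|p] yp min] := ex_minnP ex.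
  by exists 0%N; rewrite yp expr0; lra.
exists p.+1; rewrite yp /=; have [//|lt] := leP y (2 ^+ p).
  by move=> /min; rewrite ltnn.
by rewrite exprS ler_pM2l // ltW.
Qed.

Lemma powR_expR (R : realType) (x y : R) : 0 < x -> x `^ y = expR (y * ln x).
Proof. by move=> x0; rewrite /powR gt_eqF. Qed.

Lemma expR_lnX (R : realType) (x : R) (k : nat) : 0 < x -> expR (k%:R * ln x) = x ^+ k.
Proof. by move=> x0; rewrite expRM_natl lnK. Qed.

(** * Consequences of the definition of the critical depth *)

Section critical_depth.
Context {R : realType}.
Variables (n : nat) (gamma nu rho kappa C b Rmax t : R).
Hypotheses (gamma_gt0 : 0 < gamma) (nu_gt0 : 0 < nu) (rho_gt0 : 0 < rho)
  (kappa_gt0 : 0 < kappa) (C_gt0 : 0 < C) (b_gt0 : 0 < b) (t_gt0 : 0 < t)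
  (t_cond : htilde_condition n gamma nu rho kappa C b Rmax t).

Local Notation g := (gfactor n gamma b Rmax).
Local Notation H := ((hmax R n)%:R : R).
Local Notation G := (b ^+ 2 / nu ^+ 2).
Local Notation c1 := (Num.min 1 (gamma ^+ 2 * kappa)).
Local Notation lmu := (ln (Num.max 1 (gamma ^+ 2 * kappa))).

Lemma gfactor_gt0 : 0 < g.
Proof.
have [p [e _]] := t_cond.
have : 0 < b * Num.sqrt (g / 2 `^ p) by rewrite e mulr_gt0 // powR_gt0.
by rewrite pmulr_rgt0 // sqrtr_gt0 pmulr_lgt0 // invr_gt0 powR_gt0.
Qed.

Let critical_pow2 p : b * Num.sqrt (g / 2 `^ p) = nu * rho `^ t ->
  2 `^ p = G * g * expR (t * (2 * ln rho^-1)).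
Proof.
move=> e; have p0 : 0 < 2 `^ p :> R by rewrite powR_gt0.
have g0 := gfactor_gt0.
have : (b * Num.sqrt (g / 2 `^ p)) ^+ 2 = (nu * rho `^ t) ^+ 2 by rewrite e.
rewrite exprMn sqr_sqrtr ?divr_ge0 ?(ltW g0) ?(ltW p0) // => e2.
have rE : (rho `^ t) ^+ 2 * expR (t * (2 * ln rho^-1)) = 1.
  rewrite powR_expR // lnV ?posrE // -expRM_natl -expRD.
  by rewrite (_ : _ + _ = 0) ?expR0 //; ring.
have nu0 : nu != 0 by rewrite gt_eqF.
apply: (@mulfI _ (nu ^+ 2 * (rho `^ t) ^+ 2)).
  by rewrite mulf_neq0 ?expf_neq0 // gt_eqF // powR_gt0.
rewrite -{1}exprMn -e2.
have -> : nu ^+ 2 * (rho `^ t) ^+ 2 * (G * g * expR (t * (2 * ln rho^-1))) =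
  b ^+ 2 * g * ((rho `^ t) ^+ 2 * expR (t * (2 * ln rho^-1))) by field.
by rewrite rE mulr1 -mulrA divfK // gt_eqF.
Qed.

(** By [critical_pow2] the right-hand side is [t * 2^p * gamma^(2t)] for the real stratum [p]
    attached to [t]. So condition (i) says that the evaluation count of that stratum at depth [t] is
    at least one before rounding. *)
Lemma critical_depth_stratum :
  nu ^+ 2 * rho `^ (2 * t) / (gamma `^ (2 * t) * t * b ^+ 2 * g) <= 1 ->
  1 <= t * G * g * expR (t * (2 * ln rho^-1 - 2 * ln gamma^-1)).
Proof.
have g0 := gfactor_gt0.
have pos : 0 < gamma `^ (2 * t) * t * b ^+ 2 * g.
  by rewrite mulr_gt0 // mulr_gt0 ?exprn_gt0 // mulr_gt0 // powR_gt0.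
rewrite ler_pdivrMr // mul1r !powR_expR // => h.
have nn : 0 < nu ^+ 2 * expR (2 * t * ln rho) by rewrite !mulr_gt0 ?expR_gt0.
rewrite -(ler_pM2l nn) mulr1; apply: (le_trans h).
have -> : nu ^+ 2 * expR (2 * t * ln rho) *
    (t * G * g * expR (t * (2 * ln rho^-1 - 2 * ln gamma^-1))) =
   t * b ^+ 2 * g * (expR (2 * t * ln rho) *
     expR (t * (2 * ln rho^-1 - 2 * ln gamma^-1))).
  by field; rewrite gt_eqF.
rewrite -expRD !lnV ?posrE //.
have -> : 2 * t * ln rho + t * (2 * - ln rho - 2 * - ln gamma) = 2 * t * ln gamma.
  by ring.
by rewrite le_eqVlt; apply/orP; left; apply/eqP; ring.
Qed.

(** The budget condition is used at its most expensive end: depth [1] if [gamma^2 kappa <= 1], which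
    produces the factor [c1], and depth [t] otherwise. The bound [1 <= t] makes depth [1] available
    and lets [t^2] be dropped. *)
Lemma critical_depth_le : 1 <= t ->
  2 * C * G * g * c1 * expR (t * (lmu + 2 * ln rho^-1)) <= H.
Proof.
move=> t1; have g0 := gfactor_gt0; have [p [/critical_pow2 pE cond]] := t_cond.
have p1 : 2 `^ (p + 1) = 2 * (G * g * expR (t * (2 * ln rho^-1))).
  by rewrite powRD ?pnatr_eq0 ?implybT // powRr1 // pE mulrC.
have gk : 0 < gamma ^+ 2 * kappa by rewrite mulr_gt0 // exprn_gt0.
have rew h' : 0 < h' <= t ->
    C * kappa `^ h' * (h' ^+ 2 * 2 `^ (p + 1) * gamma `^ (2 * h')) <= H.
  move=> /[dup] /andP[h0 _] /cond; rewrite ler_pdivlMr //.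
  by rewrite !mulr_gt0 ?powR_gt0 // exprn_gt0.
have [le1|gt1] := leP (gamma ^+ 2 * kappa) 1.
  rewrite ln1 add0r.
  have := @rew 1; rewrite ltr01 t1 => /(_ isT).
  rewrite powRr1 ?(ltW kappa_gt0) // mulr1 expr1n mul1r.
  rewrite (_ : gamma `^ 2 = gamma ^+ 2); last by rewrite -powR_mulrn // ltW.
  by rewrite p1; apply: le_trans; rewrite le_eqVlt; apply/orP; left; apply/eqP; ring.
have := @rew t; rewrite t_gt0 lexx => /(_ isT); rewrite p1; apply: le_trans.
rewrite mulrDr expRD.
have -> : expR (t * ln (gamma ^+ 2 * kappa)) = kappa `^ t * gamma `^ (2 * t).
  rewrite !powR_expR // -expRD; congr expR.
  by rewrite lnM ?posrE ?exprn_gt0 // lnXn // -mulr_natr; ring.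
have -> : C * kappa `^ t * (t ^+ 2 * (2 * (G * g * expR (t * (2 * ln rho^-1)))) * gamma `^ (2 * t)) =
  (2 * C * G * g * 1 * (kappa `^ t * gamma `^ (2 * t) * expR (t * (2 * ln rho^-1)))) * t ^+ 2 by ring.
rewrite ler_peMr //; last by rewrite expr_ge1 // ltW.
move: (gfactor n gamma b Rmax) g0 => gf g0.
by rewrite ltW // !mulr_gt0 ?powR_gt0 ?expR_gt0 ?invr_gt0 ?exprn_gt0.
Qed.
End critical_depth.

(** * Existence of a suitable depth and stratum *)

Section parameters.
Context {R : realType}.
Variables (n : nat) (gamma nu rho kappa C b g V B U Z t : R) (j : nat)
  (N : nat -> nat).
Local Notation Hn := (hmax R n).
Local Notation H := ((hmax R n)%:R : R).
Local Notation G := (b ^+ 2 / nu ^+ 2).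
Local Notation mu := (Num.max 1 (gamma ^+ 2 * kappa)).
Local Notation c1 := (Num.min 1 (gamma ^+ 2 * kappa)).
Local Notation a := (ln gamma^-1).
Local Notation rr := (ln rho^-1).
Local Notation lM := (ln mu + 2 * rr).

Hypotheses (gamma01 : 0 < gamma < 1) (nu_gt0 : 0 < nu) (rho_gt0 : 0 < rho)
  (rho_le : rho <= gamma) (kappa_gt0 : 0 < kappa) (C_gt1 : 1 < C) (b_gt0 : 0 < b)
  (g_ge : 1 / 2 <= g) (V_ge1 : 1 <= V) (B_ge0 : 0 <= B)
  (BV : B ^+ 2 <= b ^+ 2 * V) (U_ge1 : 1 <= U) (Z_ge1 : 1 <= Z) (t_gt0 : 0 < t)
  (Hn_gt0 : (0 < Hn)%N)
  (Uspec : forall y, expR (y * lM) <= 2 * H / (G * c1) -> y <= U)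
  (jspec : 2 * rr - 2 * a <= 2 * a * j%:R)
  (ZV : 2 * U * g * Z ^+ j <= V)
  (UZ : 4 * U * (U + 1) ^+ 2 * expR lM / c1 <= Z)
  (t_stratum : 1 <= t * G * g * expR (t * (2 * rr - 2 * a)))
  (t_le : 1 <= t -> 2 * C * G * g * c1 * expR (t * lM) <= H)
  (N_le : forall k, (N k)%:R <= C * kappa ^+ k).

(** [h] is the largest depth with [4 C h^2 G V (mu / rho^2)^h <= H], and [2^p] lies between
    [y = G V / rho^(2h)] and [2 y]. One factor two of the [4] pays for rounding [p], the other for
    the ceilings in [evals]. Maximality is kept as a conclusion because it yields the rate. *)
Lemma depth_and_stratum : exists h : nat,
  [/\ h%:R <= U,
      H < 4 * C * h.+1%:R ^+ 2 * G * V * expR (h.+1%:R * lM)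
    & (0 < h)%N -> exists p : nat,
      [/\ (h <= Hn)%N, 2 <= 2 ^+ p * gamma ^+ (2 * h), (2 ^ p <= Hn)%N,
         (p <= pmax R n)%N &
         [/\ forall k, (0 < k <= h)%N -> (N k <= Hn %/ (k * evals gamma k p))%N,
          forall k, (0 < k <= h)%N -> p \in strata n gamma k
         & B / Num.sqrt (2 ^+ p) <= nu * rho ^+ h]]].
Proof.
have [g0 g1] := andP gamma01.
have gk : 0 < gamma ^+ 2 * kappa by rewrite mulr_gt0 // exprn_gt0.
have c10 : 0 < c1 by rewrite lt_min ltr01 gk.
have c11 : c1 <= 1 by rewrite ge_min lexx.
have mu1 : 1 <= mu by rewrite le_max lexx.
have mu0 : 0 < mu by exact: lt_le_trans ltr01 mu1.
have G0 : 0 < G by rewrite divr_gt0 // exprn_gt0.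
have Gc0 : 0 < G * c1 by rewrite mulr_gt0.
have C0 : 0 < C by exact: lt_trans ltr01 C_gt1.
have V0 : 0 < V by exact: lt_le_trans ltr01 V_ge1.
have U0 : 0 < U by exact: lt_le_trans ltr01 U_ge1.
have gg0 : 0 < g by apply: lt_le_trans g_ge; rewrite divr_gt0.
have a0 : 0 < a by rewrite ln_gt0 // invf_gt1.
have ar : a <= rr by rewrite ler_ln ?posrE ?invr_gt0 // lef_pV2.
have lm0 : 0 <= ln mu by rewrite ln_ge0.
have H0 : 0 < H by rewrite ltr0n.
pose Q (k : nat) := 4 * C * k%:R ^+ 2 * G * V * expR (k%:R * lM) <= H.
have QU (k : nat) : Q k -> k%:R <= U.
  case: (posnP k) => [->|k0 Qk]; first by rewrite ltW.
  apply: Uspec; rewrite ler_pdivlMr //.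
  have E0 := expR_gt0 (k%:R * lM).
  apply: (@le_trans _ _ (G * expR (k%:R * lM))).
    by rewrite [leLHS]mulrC ler_pM2r // ger_pMr.
  apply: (@le_trans _ _ H); last by rewrite ler_peMl ?ltW // ltr1n.
  apply: le_trans Qk.
  have -> : 4 * C * k%:R ^+ 2 * G * V * expR (k%:R * lM) =
    (4 * C * k%:R ^+ 2 * V) * (G * expR (k%:R * lM)) by ring.
  rewrite ler_peMl //; first by rewrite ltW // mulr_gt0.
  have k1 : 1 <= k%:R ^+ 2 :> R by rewrite expr_ge1 // ler1n.
  have C4 : 1 <= 4 * C by apply: (le_trans (ltW C_gt1)); rewrite ler_peMl ?ler1n // ltW.
  by rewrite -[leLHS]mulr1 ler_pM // -[leLHS]mulr1 ler_pM.
have exQ : exists k, Q k.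
  by exists 0%N; rewrite /Q expr0n /= mulr0 !mul0r.
have bdQ : forall i, Q i -> (i <= Num.truncn U)%N.
  by move=> i /QU kU; rewrite truncn_ge_nat // ltW.
case: (ex_maxnP exQ bdQ) => h Qh maxh.
have hU := QU _ Qh.
have big : H < 4 * C * h.+1%:R ^+ 2 * G * V * expR (h.+1%:R * lM).
  by rewrite ltNge; apply/negP => /maxh; rewrite ltnn.
exists h; split => // h0.
(* The critical depth obeys the same a priori bound as [h], so the factors [t] in [stratum_large]
   are absorbed by [V] and [Z]. *)
have tU : t <= U.
  have [t1|t1] := leP 1 t; last exact: le_trans (ltW t1) U_ge1.
  apply: Uspec; rewrite ler_pdivlMr //.
  have E0 := expR_gt0 (t * lM).
  have pos : 0 < G * c1 * expR (t * lM) by rewrite mulr_gt0.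
  rewrite mulrC; apply: le_trans (_ : 2 * (2 * C * G * g * c1 * expR (t * lM)) <= _).
    have -> : 2 * (2 * C * G * g * c1 * expR (t * lM)) =
      (2 * C * (2 * g)) * (G * c1 * expR (t * lM)) by ring.
    rewrite ler_peMl ?(ltW pos) //.
    have g2 : 1 <= 2 * g by move: g_ge; lra.
    have C2 : 1 <= 2 * C by move: C_gt1; lra.
    by rewrite -[leLHS]mulr1 ler_pM.
  by rewrite ler_pM2l // t_le.
have hU1 : h.+1%:R <= U + 1 by rewrite -natr1 lerD2r.
have large : 2 <= G * V * expR (h%:R * (2 * rr - 2 * a)).
  apply: (@stratum_large _ a rr (ln mu) t G g V Z C c1 H h j) => //.
  - apply: le_trans ZV; rewrite ler_wpM2r ?exprn_ge0 ?(le_trans ler01 Z_ge1) //.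
    by rewrite ler_wpM2r ?(ltW gg0) // ler_wpM2l.
  - apply: le_trans UZ; rewrite ler_wpM2r ?invr_ge0 ?(ltW c10) //.
    rewrite ler_wpM2r ?expR_ge0 // ler_pM ?mulr_ge0 ?(ltW t_gt0) ?exprn_ge0 //.
      by rewrite ler_wpM2l.
    by rewrite lerXn2r // nnegrE // addr_ge0 // ltW.
have gE : expR (h%:R * (2 * rr - 2 * a)) = gamma ^+ (2 * h) / rho ^+ (2 * h).
  rewrite -!expR_lnX // -expRN -expRD; congr expR.
  by rewrite !lnV ?posrE // natrM; ring.
pose y := G * V / rho ^+ (2 * h).
have r2h : 0 < rho ^+ (2 * h) by rewrite exprn_gt0.
have g2h : 0 < gamma ^+ (2 * h) by rewrite exprn_gt0.
have g2h1 : gamma ^+ (2 * h) <= 1 by rewrite exprn_ile1 // ltW.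
have y2 : 2 <= y * gamma ^+ (2 * h).
  apply: (le_trans large); rewrite gE le_eqVlt; apply/orP; left; apply/eqP.
  by rewrite /y; ring.
have y0 : 0 < y by rewrite divr_gt0 // mulr_gt0.
have y1 : 1 <= y.
  have : y * gamma ^+ (2 * h) <= y by rewrite ger_pMr.
  by move: y2; lra.
have [p /andP[yp py]] := dyadic_between y1.
have p2 : 2 <= 2 ^+ p * gamma ^+ (2 * h).
  by apply: (le_trans y2); rewrite ler_pM2r.
have h1 : 1 <= h%:R :> R by rewrite ler1n.
have pp0 : 0 < 2 ^+ p :> R by rewrite exprn_gt0.
have muh1 : 1 <= mu ^+ h by rewrite exprn_ege1.
have hpos : 0 < h%:R ^+ 2 :> R by rewrite exprn_gt0 // (lt_le_trans ltr01).
have muh0 : 0 < mu ^+ h by rewrite (lt_le_trans ltr01).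
have pos1 : 0 < 2 * C * h%:R ^+ 2 * mu ^+ h.
  by rewrite mulr_gt0 // mulr_gt0 // mulr_gt0.
have main : 2 * C * h%:R ^+ 2 * 2 ^+ p * mu ^+ h <= H.
  apply: le_trans Qh.
  have -> : expR (h%:R * lM) = mu ^+ h / rho ^+ (2 * h).
    rewrite -(expR_lnX h mu0) -(expR_lnX (2 * h) rho_gt0) -expRN -expRD.
    congr expR; by rewrite lnV ?posrE // natrM; ring.
  have -> : 4 * C * h%:R ^+ 2 * G * V * (mu ^+ h / rho ^+ (2 * h)) =
    (2 * C * h%:R ^+ 2 * mu ^+ h) * (2 * y) by rewrite /y; ring.
  have -> : 2 * C * h%:R ^+ 2 * 2 ^+ p * mu ^+ h =
    (2 * C * h%:R ^+ 2 * mu ^+ h) * 2 ^+ p by ring.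
  by rewrite ler_wpM2l // ltW.
have main2 : 2 * h%:R ^+ 2 * 2 ^+ p <= H.
  apply: le_trans main.
  have -> : 2 * C * h%:R ^+ 2 * 2 ^+ p * mu ^+ h =
    (C * mu ^+ h) * (2 * h%:R ^+ 2 * 2 ^+ p) by ring.
  have x1 : 1 <= C * mu ^+ h by rewrite -[leLHS]mulr1 ler_pM // ltW.
  by rewrite ler_peMl // mulr_ge0 ?(ltW pp0) // mulr_ge0 // ltW.
have hh1 : 1 <= h%:R ^+ 2 :> R by rewrite expr_ge1.
have pH : 2 ^+ p <= H.
  apply: le_trans main2; rewrite ler_peMl ?(ltW pp0) //.
  by move: hh1; lra.
have hH : h%:R <= H.
  apply: le_trans main2.
  have e1 : h%:R <= 2 * h%:R ^+ 2 :> R.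
    have : h%:R <= h%:R ^+ 2 :> R by rewrite expr2 ler_peMl // (le_trans ler01).
    by move: hh1; lra.
  have x1 : 1 <= 2 ^+ p :> R by rewrite exprn_ege1 // ler1n.
  by apply: (le_trans e1); rewrite ler_peMr // mulr_ge0 // ltW.
have kx k : (0 < k <= h)%N -> 1 <= 2 ^+ p * gamma ^+ (2 * k).
  move=> /andP[k0 kh]; apply: (@le_trans _ _ 2); first by rewrite ler1n.
  apply: (le_trans p2); rewrite ler_pM2l // ler_wiXn2l ?(ltW g0) ?(ltW g1) //.
  by rewrite leq_mul2l.
have kh k : (0 < k <= h)%N -> (1 <= k%:R :> R) && (k%:R <= h%:R :> R).
  by move=> /andP[k0 kh]; rewrite ler1n k0 ler_nat kh.
have pH' : (2 ^ p <= Hn)%N by rewrite -(ler_nat R) natrX.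
have ln20 : 0 < ln 2 :> R by rewrite ln_gt0 // ltr1n.
exists p; split => //.
- by rewrite -(ler_nat R).
- rewrite /pmax truncn_ge_nat; last first.
    by rewrite /log2 divr_ge0 ?(ltW ln20) // ln_ge0 // ler1n.
  rewrite /log2 ler_pdivlMr // mulr_natl -lnXn //.
  by rewrite ler_ln ?posrE // ?exprn_gt0.
split.
- move=> k hk; have [k1 k2] := andP (kh k hk); have k3 := kx k hk.
  have kk0 : (0 < k)%N by case/andP: hk.
  have ev0 : (0 < evals gamma k p)%N by exact: evals_gt0.
  rewrite leq_divRL ?muln_gt0 ?kk0 //.
  rewrite -(ler_nat R) natrM natrM.
  have gk2 : 0 < gamma ^+ (2 * k) by rewrite exprn_gt0.
  have ev : (evals gamma k p)%:R <= 2 * (k%:R * 2 ^+ p * gamma ^+ (2 * k)) :> R.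
    apply: (le_trans (ltW (evals_lt g0 _ _))).
    have : 1 <= k%:R * (2 ^+ p * gamma ^+ (2 * k)) by rewrite -[leLHS]mulr1 ler_pM.
    by rewrite mulrA; lra.
  apply: (@le_trans _ _ (C * kappa ^+ k * (k%:R * (2 * (k%:R * 2 ^+ p * gamma ^+ (2 * k)))))).
    rewrite ler_pM // ?mulr_ge0 //.
    by rewrite ler_wpM2l.
  have -> : C * kappa ^+ k * (k%:R * (2 * (k%:R * 2 ^+ p * gamma ^+ (2 * k)))) =
    2 * C * k%:R ^+ 2 * 2 ^+ p * (gamma ^+ 2 * kappa) ^+ k.
    by rewrite exprMn -exprM; ring.
  apply: le_trans main; apply: ler_pM.
  - have kpos : 0 < k%:R ^+ 2 :> R by rewrite exprn_gt0 // (lt_le_trans ltr01).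
    by rewrite ltW // mulr_gt0 // mulr_gt0 // mulr_gt0.
  - by rewrite exprn_ge0 // ltW.
  - rewrite ler_pM2r // ler_pM2l ?mulr_gt0 // lerXn2r ?nnegrE ?(le_trans ler01) //.
  apply: (@le_trans _ _ (mu ^+ k)).
    by rewrite lerXn2r ?nnegrE ?(ltW gk) ?(ltW mu0) // le_max lexx orbT.
  by rewrite ler_weXn2l //; case/andP: hk.
- move=> k hk; have [k1 k2] := andP (kh k hk).
  have kk0 : (0 < k)%N by case/andP: hk.
  have gk2 : 0 < gamma ^+ (2 * k) by rewrite exprn_gt0.
  set e := ceiln (k%:R ^+ 2 * gamma ^+ (2 * k)).
  have arg0 : 0 < k%:R ^+ 2 * gamma ^+ (2 * k) :> R.
    by rewrite mulr_gt0 // exprn_gt0 // (lt_le_trans ltr01).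
  have e0 : (0 < e)%N by rewrite ceiln_gt0.
  have e1 : e%:R <= 2 * h%:R ^+ 2 :> R.
    apply: (le_trans (ltW (ceiln_lt (ltW arg0)))).
    have : k%:R ^+ 2 * gamma ^+ (2 * k) <= h%:R ^+ 2 :> R.
      apply: (@le_trans _ _ (k%:R ^+ 2)); last first.
        by rewrite lerXn2r // nnegrE (le_trans ler01).
      have gk1 : gamma ^+ (2 * k) <= 1 by rewrite exprn_ile1 // ltW.
      by rewrite ler_piMr ?sqr_ge0.
    by move: hh1; lra.
  have fl : p%:Z <= Num.floor (log2 (H / e%:R) : R).
    rewrite floor_ge_int /log2 -pmulrn ler_pdivlMr // [p%:R * _]mulr_natl -lnXn //.
    rewrite ler_ln ?posrE ?exprn_gt0 ?divr_gt0 ?ltr0n //.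
    rewrite ler_pdivlMr ?ltr0n // mulrC; apply: le_trans main2.
    by rewrite ler_pM2r.
  rewrite /strata -/e; move: fl; case: (Num.floor _) => [P|P] //.
  by rewrite lez_nat mem_rev mem_iota add0n ltnS.
(* After squaring, [B^2 <= b^2 V = nu^2 rho^(2h) y] and [y <= 2^p]. *)
rewrite ler_pdivrMr ?sqrtr_gt0 //.
have rh0 : 0 < nu * rho ^+ h by rewrite mulr_gt0 // exprn_gt0.
rewrite -[leLHS]ger0_norm // -sqrtr_sqr -[nu * _]ger0_norm ?(ltW rh0) //.
rewrite -sqrtr_sqr -sqrtrM ?sqr_ge0 // ler_wsqrtr //.
apply: (le_trans BV).
have -> : (nu * rho ^+ h) ^+ 2 = nu ^+ 2 * rho ^+ (2 * h).
  by rewrite exprMn -exprM mulnC.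
have -> : b ^+ 2 * V = nu ^+ 2 * rho ^+ (2 * h) * y.
  by rewrite /y; field; rewrite !gt_eqF.
by rewrite ler_wpM2l // ltW // mulr_gt0 // exprn_gt0.
Qed.
End parameters.

Lemma ln2_ge_half (R : realType) : 1 / 2 <= ln 2 :> R.
Proof.
rewrite -[leLHS]expRK ler_ln ?posrE ?expR_gt0 //.
have := expR_ge1Dx (- (1 / 2) : R); rewrite expRN => h.
have e0 := expR_gt0 (1 / 2 : R).
have : (1 - 1 / 2) * expR (1 / 2) <= 1 :> R by rewrite -ler_pdivlMr // [X in _ <= X]mul1r.
by move: (expR _) => E; lra.
Qed.

Lemma ln_le_sub1 (R : realType) (y : R) : 0 < y -> ln y <= y - 1.
Proof. by move=> y0; have := expR_ge1Dx (ln y); rewrite lnK ?posrE //; lra. Qed.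

(** * Comparison of [n] with the budget per depth *)

Section budget.
Context {R : realType}.
Variables (n : nat).
Hypothesis pmax_ge1 : (1 <= pmax R n)%N.
Local Notation H := ((hmax R n)%:R : R).
Local Notation y := ((n%:R / (2 * (log2 n%:R + 1) ^+ 2)) : R).

Lemma hmax_gt0 : (0 < hmax R n)%N.
Proof.
rewrite lt0n; apply: contraTneq pmax_ge1 => h0.
by rewrite /pmax h0 /log2 ln0 // mul0r truncn0.
Qed.

Lemma budget_gt0 : (0 < n)%N.
Proof.
rewrite lt0n; apply: contraTneq hmax_gt0 => n0.
by rewrite /hmax n0 mul0r truncn0.
Qed.

Let ln_n : 0 <= ln n%:R :> R. Proof. by rewrite ln_ge0 // ler1n budget_gt0. Qed.
Let log_n : 0 <= log2 n%:R :> R.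
Proof. by rewrite /log2 divr_ge0 // (le_trans _ (ln2_ge_half R)). Qed.

Let den1 : 1 <= (log2 n%:R + 1) ^+ 2 :> R.
Proof. by rewrite expr_ge1 //; have := log_n; move: (log2 _) => z; lra. Qed.

Lemma hmax_le : (hmax R n <= n)%N.
Proof.
have d := den1.
rewrite -(ler_nat R) (@le_trans _ _ y) //.
  by rewrite truncn_le divr_ge0 // mulr_ge0 // exprn_ge0 // addr_ge0.
rewrite ler_pdivrMr; last by move: d; lra.
by rewrite ler_peMr //; move: d; lra.
Qed.

(** Rounding down to [H >= 1] costs a factor [2], and [log2 n + 1 <= 3 L]: together
    [2 * 2 * 9 = 36]. *)
Lemma budget_le (L : R) : 1 + ln n%:R <= L -> n%:R <= 36 * L ^+ 2 * H.
Proof.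
move=> nL; have l0 := ln_n; have d := den1; have lg := log_n.
have H1 : 1 <= H by rewrite ler1n hmax_gt0.
have y0 : 0 <= y by rewrite divr_ge0 // mulr_ge0 // exprn_ge0 // addr_ge0.
have /andP[_ yH] := truncn_itv y0.
have y2 : y <= 2 * H.
  by apply: (le_trans (ltW yH)); rewrite -natr1 -/(hmax R n); move: H1; lra.
have d0 : 0 < 2 * (log2 n%:R + 1) ^+ 2 :> R by move: d; lra.
move: y2; rewrite ler_pdivrMr // => y2; apply: (le_trans y2).
have lL : log2 n%:R + 1 <= 3 * L.
  have : log2 n%:R <= 2 * ln n%:R :> R.
    rewrite /log2 ler_pdivrMr; last by apply: lt_le_trans (ln2_ge_half R); lra.
    have := ln2_ge_half R; move: (ln 2) (ln _) l0 => z w w0 z1.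
    rewrite [leRHS]mulrC mulrA ler_peMl //; lra.
  by move: nL l0; move: (log2 _) (ln _) => ? ?; lra.
have L0 : 0 <= L by move: nL l0; move: (ln _) => ?; lra.
have sq : (log2 n%:R + 1) ^+ 2 <= 9 * L ^+ 2.
  have -> : 9 * L ^+ 2 = (3 * L) ^+ 2 by ring.
  by rewrite lerXn2r // nnegrE ?mulr_ge0 // addr_ge0.
have -> : 36 * L ^+ 2 * H = 2 * H * (2 * (9 * L ^+ 2)) by ring.
rewrite ler_pM2l; last by move: H1; lra.
by rewrite ler_pM2l.
Qed.

Lemma pmax_le : (pmax R n)%:R <= 2 * ln n%:R :> R.
Proof.
have ll := ln2_ge_half R.
have l20 : 0 < ln 2 :> R by apply: lt_le_trans ll; rewrite divr_gt0.
have lH : 0 <= ln H by rewrite ln_ge0 // ler1n hmax_gt0.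
have lHn : ln H <= ln n%:R by rewrite ler_ln ?posrE ?ltr0n ?hmax_gt0 ?budget_gt0 // ler_nat hmax_le.
apply: (@le_trans _ _ (ln H / ln 2)).
  by rewrite truncn_le divr_ge0 // ltW.
rewrite ler_pdivrMr //.
have : ln n%:R <= 2 * ln n%:R * ln 2 :> R.
  by rewrite mulrAC ler_peMl ?ln_n //; move: ll; lra.
by apply: le_trans.
Qed.
End budget.

(** Raised to the power [beta], the bound on [D] turns [exp (h.+1 * lM)] into [rho^-(h+1)], and
    [Q^beta <= Q]. *)
Lemma rate_from_depth (R : realType) (D Q lM beta rho : R) (h : nat) :
  0 < rho -> 0 < D -> 1 <= Q -> 0 <= beta <= 1 -> beta * lM = ln rho^-1 ->
  D < Q * expR (h.+1%:R * lM) ->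
  rho ^+ h <= rho^-1 * Q * D `^ (- beta).
Proof.
move=> r0 D0 Q1 /andP[b0 b1] bM DQ.
have Q0 : 0 < Q by exact: lt_le_trans ltr01 Q1.
rewrite powR_expR // -[rho ^+ h]expR_lnX //.
rewrite -[rho^-1]lnK ?posrE ?invr_gt0 // -[Q in leRHS]lnK ?posrE // -!expRD ler_expR.
have lD : ln D <= ln Q + h.+1%:R * lM.
  rewrite -[X in _ + X]expRK -lnM ?posrE ?expR_gt0 // ler_ln ?posrE ?mulr_gt0 ?expR_gt0 //.
  exact: ltW.
have lQ : 0 <= ln Q by rewrite ln_ge0.
have h1 : beta * ln D <= ln Q + h.+1%:R * ln rho^-1.
  apply: (@le_trans _ _ (beta * (ln Q + h.+1%:R * lM))); first by rewrite ler_wpM2l.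
  rewrite mulrDr [beta * (_ * _)]mulrCA bM lerD2r.
  by rewrite ler_piMl.
move: h1; rewrite lnV ?posrE // -natr1 mulNr.
by move: (ln D) (ln Q) (ln rho) => d q r; rewrite mulrDl mul1r; lra.
Qed.

(** For bounded [D] the claimed rate is bounded below, so the trivial regret bound suffices. *)
Lemma powR_le_rate (R : realType) (D D0 beta : R) : 0 < D -> D <= D0 -> 1 <= D0 ->
  0 <= beta <= 1 -> 1 <= D0 * D `^ (- beta).
Proof.
move=> D_gt0 DD D1 /andP[b0 b1].
have D00 : 0 < D0 by exact: lt_le_trans ltr01 D1.
rewrite powR_expR // -[X in X * _]lnK ?posrE // -expRD -expR0 ler_expR.
have l0 : 0 <= ln D0 by rewrite ln_ge0.
have l1 : ln D <= ln D0 by rewrite ler_ln ?posrE.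
have : beta * ln D <= ln D0.
  apply: (@le_trans _ _ (beta * ln D0)); first by rewrite ler_wpM2l.
  by rewrite ler_piMl.
by rewrite mulNr; lra.
Qed.

(** * The regret bound *)

(** The [3] collects the bias of the optimal prefix and twice the error of stratum [p], each at most
    [nu * rho^h]; the second term is the cross-validation error. *)
Lemma regret_on_concentration (R : realType) (X : Type) (A : finType)
    (f : X -> A -> X) (r : X -> A -> R) (x : X) (n : nat)
    (gamma nu rho Rmax b L : R) (tie : rel (seq A))
    (Y : seq A -> A -> nat -> R) (c0 : A) (h p : nat) :
  let B := b * (error_const #|A| gamma * L ^+ 3) in
  0 < gamma < 1 -> (forall y a, 0 <= r y a <= Rmax) -> 0 < b -> 1 <= L ->
  optimum_attained f r gamma x -> smooth f r gamma x Rmax nu rho ->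
  total tie -> transitive tie -> (hmax R n)%:R <= expR L ->
  concentrated f r x b L (hmax R n) Y ->
  [/\ (h <= hmax R n)%N, 2 <= 2 ^+ p * gamma ^+ (2 * h),
     (2 ^ p <= hmax R n)%N, (p <= pmax R n)%N &
    [/\ forall k, (0 < k <= h)%N -> (near_optimal f r gamma x k
          (3 * nu * rho ^+ k) <= hmax R n %/ (k * evals gamma k p))%N,
       forall k, (0 < k <= h)%N -> p \in strata n gamma k
     & B / Num.sqrt (2 ^+ p) <= nu * rho ^+ h]] ->
  simple_regret f r gamma x (recommended n gamma tie Y c0) <=
    3 * nu * rho ^+ h + 2 * B / (Num.sqrt (hmax R n)%:R * (1 - gamma ^+ 2)).
Proof.
move=> B g01 rb b0 L1 [s sopt] sm tt ttr HL conc [hH hp pH pp [few str Bh]].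
have [/andP[nu0 _] /andP[r0 rg] _] := sm; have [g0 g1] := andP g01.
have r1 : rho <= 1 by exact: le_trans rg (ltW g1).
have A0 : (0 < #|A|)%N by apply/card_gt0P; exists c0.
have opt k : vstar f r gamma x - nu * rho ^+ k <= u f r gamma x (mkseq s k).
  exact: (u_optimal_prefix g01 rb _ sm sopt).
have err T a sigma : (size a <= (hmax R n).+1)%N -> 0 < sigma -> sigma <= expR L ->
    well_estimated gamma sigma T a ->
    `|uhat gamma Y T a - u f r gamma x a| <= B / Num.sqrt sigma.
  by move=> sa s0 sL wa; exact: (uhat_error g01 b0 L1 A0 conc sa s0 sL wa).
have r01 : 0 < rho <= 1 by rewrite r0 r1.
have [out0 out] := output_guarantee g01 r01 (ltW nu0) tt ttr opt err hH hp pH HL pp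
  few str Bh.
rewrite /recommended; case: (output_node _ _ _ _) out0 out => [//|c l] _ out /=.
apply: (le_trans (simple_regret_le_u f g01 rb x c l)).
have e : nu * rho ^+ h.+1 <= nu * rho ^+ h.
  by rewrite ler_pM2l // exprS ler_piMl // exprn_ge0 // ltW.
have g2 : 0 <= 1 - gamma ^+ 2 by rewrite subr_ge0 exprn_ile1 // ltW.
have sE : Num.sqrt ((hmax R n)%:R * (1 - gamma ^+ 2) ^+ 2) =
    Num.sqrt (hmax R n)%:R * (1 - gamma ^+ 2).
  by rewrite sqrtrM ?ler0n // sqrtr_sqr ger0_norm.
move: out; rewrite sE; move: Bh e.
rewrite -(mulrA 3) -(mulrA 2 B).
move: (B / Num.sqrt (2 ^+ p)) (B / _) (nu * rho ^+ h) (nu * rho ^+ h.+1) => y1 y2 y3 y4.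
by move: (vstar f r gamma x) (u f r gamma x _) => y5 y6; lra.
Qed.

(** * Constants and their logarithmic growth *)

Section regret.
Context {R : realType}.
Variables (K : nat) (gamma nu rho kappa C : R).
Hypotheses (gamma01 : 0 < gamma < 1) (nu_gt0 : 0 < nu)
  (rho_bounds : 0 < rho <= gamma) (kappa_gt0 : 0 < kappa) (C_gt1 : 1 < C).

Local Notation mu := (Num.max 1 (gamma ^+ 2 * kappa)).
Local Notation c1 := (Num.min 1 (gamma ^+ 2 * kappa)).
Local Notation a := (ln gamma^-1).
Local Notation rr := (ln rho^-1).
Local Notation lM := (ln mu + 2 * rr).
Local Notation l1 := (ln (1 - gamma)^-1).
Local Notation Ec := (error_const K gamma).

(** The quotient is a bound, per unit of [L], on the logarithm of the affordable cost divided by the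
    logarithmic cost [lM] of one depth. *)
Definition depth_const : R := 1 + (4 + 2 * l1 - ln c1) / lM.
Definition gfactor_const : R := 2 * (2 + l1).
(** An integer [j] with [(gamma / rho)^2 <= gamma^(-2 j)], expressing the loss per depth in powers
    of the discount. *)
Definition discount_exponent : nat := (Num.truncn ((2 * rr - 2 * a) / (2 * a))).+1.
Definition shift_const : R :=
  1 + 4 * depth_const * (depth_const + 1) ^+ 2 * expR lM / c1.
(** The second summand serves [B^2 <= b^2 V], the third [2 U g Z^j <= V], with [V], [U] and [Z] as
    in [regret_bound]. *)
Definition inflation_const : R :=
  1 + Ec ^+ 2 + 2 * depth_const * gfactor_const * shift_const ^+ discount_exponent.
Definition rate_const : R :=
  1 + 144 * C * (depth_const + 1) ^+ 2 * inflation_const / nu ^+ 2.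
(** Threshold on [n / b^2] above which [gfactor] is bounded away from zero. *)
Definition trivial_const : R := 1 + 4 / nu ^+ 2.
(** One summand per source: the depth [h], cross-validation, failure of concentration, and the
    regime of bounded [n / b^2]. *)
Definition regret_const : R :=
  3 * nu * (rho^-1 * rate_const) + 12 * Ec / (1 - gamma ^+ 2) +
  (1 - gamma)^-1 + nu * trivial_const.
(** [10 = 2 + 2 + 6]: from [n] against [H], from [h.+1^2], and from [V], which also brings [3 j]. *)
Definition regret_degree : nat := (10 + 3 * discount_exponent)%N.

Let g0 : 0 < gamma. Proof. by case/andP: gamma01. Qed.
Let g1 : gamma < 1. Proof. by case/andP: gamma01. Qed.
Let r0 : 0 < rho. Proof. by case/andP: rho_bounds. Qed.
Let r1 : rho < 1. Proof. by apply: le_lt_trans g1; case/andP: rho_bounds. Qed.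
Let gk0 : 0 < gamma ^+ 2 * kappa. Proof. by rewrite mulr_gt0 // exprn_gt0. Qed.
Let c1_gt0 : 0 < c1. Proof. by rewrite lt_min ltr01 gk0. Qed.
Let a_gt0 : 0 < a. Proof. by rewrite ln_gt0 // invf_gt1. Qed.
Let rr_gt0 : 0 < rr. Proof. by rewrite ln_gt0 // invf_gt1. Qed.
Let a_le : a <= rr.
Proof. by rewrite ler_ln ?posrE ?invr_gt0 // lef_pV2; case/andP: rho_bounds. Qed.
Let lmu_ge0 : 0 <= ln mu. Proof. by rewrite ln_ge0 // le_max lexx. Qed.
Let lM_gt0 : 0 < lM. Proof. by rewrite ltr_wpDl // mulr_gt0. Qed.
Let l1_ge0 : 0 <= l1.
Proof. by rewrite ln_ge0 // invf_ge1 ?subr_gt0 // gerBl ltW. Qed.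
Let lc1_le0 : ln c1 <= 0. Proof. by rewrite ln_le0 // ge_min lexx. Qed.
Let num_ge0 : 0 <= 4 + 2 * l1 - ln c1.
Proof. by move: l1_ge0 lc1_le0; move: l1 (ln c1) => ? ?; lra. Qed.
Lemma depth_const_ge1 : 1 <= depth_const.
Proof. by rewrite lerDl divr_ge0 // ltW. Qed.
Let dc0 : 0 < depth_const. Proof. exact: lt_le_trans ltr01 depth_const_ge1. Qed.
Lemma gfactor_const_ge0 : 0 <= gfactor_const.
Proof. by rewrite mulr_ge0 // addr_ge0. Qed.
Lemma shift_const_ge1 : 1 <= shift_const.
Proof.
rewrite lerDl divr_ge0 ?(ltW c1_gt0) // mulr_ge0 ?expR_ge0 // mulr_ge0 //.
  by rewrite mulr_ge0 // ltW.
by rewrite exprn_ge0 // addr_ge0 // ltW.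
Qed.
Let shift0 : 0 <= shift_const. Proof. exact: le_trans ler01 shift_const_ge1. Qed.

Lemma discount_exponentP : 2 * rr - 2 * a <= 2 * a * discount_exponent%:R.
Proof.
have a2 : 0 < 2 * a by rewrite mulr_gt0.
have q0 : 0 <= (2 * rr - 2 * a) / (2 * a).
  by rewrite divr_ge0 ?(ltW a2) // subr_ge0 ler_pM2l.
have /andP[_ /ltW] := truncn_itv q0.
by rewrite ler_pdivrMr // [X in _ <= X]mulrC.
Qed.

Hypothesis K_gt0 : (0 < K)%N.

Lemma error_const_ge0 : 0 <= Ec.
Proof.
have lK : 0 <= ln (2 * K%:R) :> R.
  by rewrite ln_ge0 // -natrM ler1n muln_gt0.
rewrite /error_const mulr_ge0 ?invr_ge0 ?exprn_ge0 ?subr_ge0 ?(ltW g1) //.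
apply: mulr_ge0; first by apply: mulr_ge0 => //; exact: addr_ge0.
apply: exprn_ge0; apply: addr_ge0 => //; rewrite invr_ge0; apply: mulr_ge0 => //.
exact: ltW.
Qed.

Lemma inflation_const_ge1 : 1 <= inflation_const.
Proof.
rewrite /inflation_const -addrA lerDl addr_ge0 ?sqr_ge0 //.
rewrite mulr_ge0 ?exprn_ge0 // mulr_ge0 ?gfactor_const_ge0 // mulr_ge0 //.
exact: ltW.
Qed.

Lemma rate_const_ge1 : 1 <= rate_const.
Proof.
have C0 : 0 <= C by exact: le_trans ler01 (ltW C_gt1).
rewrite lerDl divr_ge0 ?sqr_ge0 // mulr_ge0 ?(le_trans ler01 inflation_const_ge1) //.
by rewrite mulr_ge0 ?sqr_ge0 // mulr_ge0.
Qed.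

Lemma trivial_const_ge1 : 1 <= trivial_const.
Proof. by rewrite lerDl divr_ge0 ?sqr_ge0. Qed.

Lemma regret_const_gt0 : 0 < regret_const.
Proof.
have g2 : 0 < 1 - gamma ^+ 2 by rewrite subr_gt0 exprn_ilt1 // ltW.
have h1 : 0 <= 3 * nu * (rho^-1 * rate_const).
  rewrite mulr_ge0 // ?mulr_ge0 ?invr_ge0 ?(ltW nu_gt0) ?(ltW r0) //.
  exact: le_trans ler01 rate_const_ge1.
have h2 : 0 <= 12 * Ec / (1 - gamma ^+ 2).
  by rewrite divr_ge0 ?(ltW g2) // mulr_ge0 // error_const_ge0.
have h3 : 0 < (1 - gamma)^-1 by rewrite invr_gt0 subr_gt0.
have h4 : 0 <= nu * trivial_const.
  by rewrite mulr_ge0 ?(ltW nu_gt0) // (le_trans ler01 trivial_const_ge1).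
by rewrite /regret_const ltr_wpDr // ltr_wpDl // addr_ge0.
Qed.

Section instance.
Variables (n : nat) (b Rmax : R).
Hypotheses (pmax1 : (1 <= pmax R n)%N) (b_gt0 : 0 < b)
  (nu_le : nu <= Rmax / (1 - gamma)).
Local Notation H := ((hmax R n)%:R : R).
Local Notation L := (1 + ln n%:R + `|ln (Rmax / b)|).
Local Notation G := (b ^+ 2 / nu ^+ 2).
Local Notation g := (gfactor n gamma b Rmax).
Local Notation D := (n%:R / b ^+ 2).

Let og : 0 < 1 - gamma. Proof. by rewrite subr_gt0. Qed.
Let Rmax_gt0 : 0 < Rmax.
Proof. by have := lt_le_trans nu_gt0 nu_le; rewrite pmulr_lgt0 // invr_gt0. Qed.
Let n_gt0 : 0 < n%:R :> R. Proof. by rewrite ltr0n (budget_gt0 pmax1). Qed.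
Let lnn : 0 <= ln n%:R :> R.
Proof. by rewrite ln_ge0 // ler1n (budget_gt0 pmax1). Qed.
Lemma level_ge1 : 1 <= L. Proof. by rewrite -addrA lerDl addr_ge0. Qed.
Let H_gt0 : 0 < H. Proof. by rewrite ltr0n (hmax_gt0 pmax1). Qed.
Let G_gt0 : 0 < G. Proof. by rewrite divr_gt0 // exprn_gt0. Qed.

Lemma hmax_le_expR : H <= expR L.
Proof.
apply: (@le_trans _ _ n%:R); first by rewrite ler_nat (hmax_le pmax1).
by rewrite -[leLHS]lnK ?posrE // ler_expR addrAC lerDr addr_ge0.
Qed.

(** The noise enters through [ln nu - ln b], which [nu <= Rmax / (1 - gamma)] bounds by
    [ln (Rmax / b) + l1]. Hence the ratio [Rmax / b] in the logarithmic factor. *)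
Lemma depth_const_spec y : expR (y * lM) <= 2 * H / (G * c1) -> y <= depth_const * L.
Proof.
move=> h; have L1 := level_ge1.
have Gc : 0 < G * c1 by rewrite mulr_gt0.
have y1 : y * lM <= ln (2 * H / (G * c1)).
  by rewrite -[leLHS]expRK ler_ln ?posrE ?expR_gt0 // divr_gt0 // mulr_gt0.
have lH : ln H <= ln n%:R.
  by rewrite ler_ln ?posrE // ler_nat (hmax_le pmax1).
have lnu : ln nu <= ln Rmax + l1.
  by rewrite -lnM ?posrE ?invr_gt0 // ler_ln ?posrE // divr_gt0.
have e1 : ln (2 * H / (G * c1)) = ln 2 + ln H - (2 * (ln b - ln nu) + ln c1).
  have H2 : 0 < 2 * H by rewrite mulr_gt0.
  have -> : ln (2 * H / (G * c1)) = ln (2 * H) - ln (G * c1) by rewrite ln_div ?posrE.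
  have -> : ln (2 * H) = ln 2 + ln H by rewrite lnM ?posrE.
  have -> : ln (G * c1) = ln G + ln c1 by rewrite lnM ?posrE.
  have -> : ln G = ln (b ^+ 2) - ln (nu ^+ 2) by rewrite ln_div ?posrE ?exprn_gt0.
  by rewrite (lnXn 2 b_gt0) (lnXn 2 nu_gt0) -[ln b *+ 2]mulr_natr -[ln nu *+ 2]mulr_natr; ring.
have e2 : ln (Rmax / b) = ln Rmax - ln b by rewrite ln_div ?posrE.
have e3 := ler_norm (ln (Rmax / b)).
have l2 : ln 2 <= 1 :> R.
  by have := @ln_le_sub1 R 2 (ltr0Sn _ _); move: (ln 2) => z; lra.
have y2 : y * lM <= (4 + 2 * l1 - ln c1) * L.
  apply: (le_trans y1); rewrite e1.
  have : l1 <= l1 * L by rewrite ler_peMr.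
  have : - ln c1 <= - ln c1 * L by rewrite ler_peMr // oppr_ge0.
  move: L1 lH lnu e3 lnn; rewrite e2.
  move: (ln c1) l1 (ln Rmax) (ln b) (ln nu) (ln H) (ln n%:R) (ln 2) l2 `|_|.
  move=> v1 v2 v3 v4 v5 v6 v7 v8 hv v9 hL i1 i2 i3 i4 i5 i6.
  have -> : (4 + 2 * v2 - v1) * (1 + v7 + v9) =
     4 * (1 + v7 + v9) + 2 * (v2 * (1 + v7 + v9)) + (- v1 * (1 + v7 + v9)) by ring.
  by move: (v2 * _) (- v1 * _) i5 i6 => w1 w2 *; lra.
have y3 : y <= (4 + 2 * l1 - ln c1) / lM * L.
  by rewrite mulrAC ler_pdivlMr.
apply: (le_trans y3); rewrite ler_wpM2r ?(le_trans ler01 L1) //.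
by rewrite /depth_const lerDr.
Qed.

Lemma gfactor_le : g <= gfactor_const * L ^+ 2.
Proof.
have L1 := level_ge1.
have w : ln (Rmax * n%:R `^ (3 / 2) / (b * (1 - gamma))) <= (2 + l1) * L.
  have n32 : 0 < n%:R `^ (3 / 2) :> R by rewrite powR_gt0.
  have Rn : 0 < Rmax * n%:R `^ (3 / 2) by rewrite mulr_gt0.
  have bg : 0 < b * (1 - gamma) by rewrite mulr_gt0.
  have -> : ln (Rmax * n%:R `^ (3 / 2) / (b * (1 - gamma))) =
      ln (Rmax * n%:R `^ (3 / 2)) - ln (b * (1 - gamma)) by rewrite ln_div ?posrE.
  have -> : ln (Rmax * n%:R `^ (3 / 2)) = ln Rmax + 3 / 2 * ln n%:R.
    by rewrite lnM ?posrE // ln_powR.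
  have -> : ln (b * (1 - gamma)) = ln b + ln (1 - gamma) by rewrite lnM ?posrE.
  have e2 : ln (Rmax / b) = ln Rmax - ln b by rewrite ln_div ?posrE.
  have e3 := ler_norm (ln (Rmax / b)).
  have e4 : l1 <= l1 * L by rewrite ler_peMr.
  have e5 : ln (1 - gamma) = - l1 by rewrite lnV ?posrE // opprK.
  have -> : (2 + l1) * L = 2 * L + l1 * L by rewrite mulrDl.
  have e6 := normr_ge0 (ln Rmax - ln b).
  rewrite e5; move: e3 e4 lnn; rewrite e2; move: (l1 * L) => w; move: e6.
  by move: `|ln Rmax - ln b| (ln Rmax) (ln b) (ln n%:R) l1 => v1 v2 v3 v4 v5; lra.
have pm := pmax_le pmax1.
have Ln : ln n%:R <= L by rewrite addrAC lerDr addr_ge0.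
apply: (@le_trans _ _ ((2 * L) * ((2 + l1) * L))).
  have L0 : 0 <= L by exact: le_trans ler01 L1.
  have l2 : 0 <= (2 + l1) * L by rewrite mulr_ge0 // addr_ge0.
  apply: (@le_trans _ _ ((pmax R n)%:R * ((2 + l1) * L))); first by rewrite ler_wpM2l.
  by rewrite ler_wpM2r // (le_trans pm) // ler_pM2l.
by rewrite /gfactor_const le_eqVlt; apply/orP; left; apply/eqP; ring.
Qed.

(** Above the threshold [2 b <= nu * sqrt n], so the logarithm in [gfactor] has an argument of at
    least [2]. *)
Lemma gfactor_ge : trivial_const < D -> 1 / 2 <= g.
Proof.
move=> DD; have b2 : 0 < b ^+ 2 by rewrite exprn_gt0.
have n2 : 0 < nu ^+ 2 by rewrite exprn_gt0.
have h1 : 4 * b ^+ 2 <= nu ^+ 2 * n%:R.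
  have : 4 / nu ^+ 2 < D by apply: le_lt_trans DD; rewrite lerDr.
  rewrite ltr_pdivlMr // mulrAC ltr_pdivrMr // => /ltW.
  by rewrite [n%:R * _]mulrC.
have h2 : 2 * b <= nu * Num.sqrt n%:R.
  have -> : 2 * b = Num.sqrt (4 * b ^+ 2).
    have -> : 4 * b ^+ 2 = (2 * b) ^+ 2 by ring.
    by rewrite sqrtr_sqr ger0_norm // mulr_ge0 // ltW.
  have -> : nu * Num.sqrt n%:R = Num.sqrt (nu ^+ 2 * n%:R).
    by rewrite sqrtrM ?sqr_ge0 // sqrtr_sqr ger0_norm // ltW.
  exact: ler_wsqrtr.
have h3 : 2 <= Rmax * n%:R `^ (3 / 2) / (b * (1 - gamma)).
  have -> : Rmax * n%:R `^ (3 / 2) / (b * (1 - gamma)) =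
    Rmax / (1 - gamma) * n%:R `^ (3 / 2) / b by field; rewrite !gt_eqF.
  rewrite ler_pdivlMr //; apply: (le_trans h2); apply: ler_pM; [exact: ltW | exact: sqrtr_ge0 | exact: nu_le |].
  rewrite -powR12_sqrt // ler_powR ?ler1n ?(budget_gt0 pmax1) //; lra.
apply: (le_trans (ln2_ge_half R)).
apply: (@le_trans _ _ (ln (Rmax * n%:R `^ (3 / 2) / (b * (1 - gamma))))).
  by rewrite ler_ln ?posrE //; exact: lt_le_trans h3.
rewrite /gfactor ler_peMl ?ler1n // ln_ge0 //.
by apply: le_trans h3; rewrite ler1n.
Qed.

(** The confidence is [L] itself: [expR (- L) <= b / (Rmax * n)], so the left-hand side is at most
    [b / n] up to [(1 - gamma)^-1], and [b / sqrt n] is already [D^(-1/2)]. *)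
Lemma failure_le beta : 1 <= D -> 0 <= beta <= 1 / 2 ->
  nu * expR (- L) <= (1 - gamma)^-1 * D `^ (- beta).
Proof.
move=> D1 /andP[b0 b1].
have D0 : 0 < D by exact: lt_le_trans ltr01 D1.
have lD : ln D = ln n%:R - 2 * ln b.
  by rewrite ln_div ?posrE ?exprn_gt0 // lnXn // mulr_natl.
have lD0 : 0 <= ln D by rewrite ln_ge0.
have e2 : ln (Rmax / b) = ln Rmax - ln b by rewrite ln_div ?posrE.
have e3 := ler_norm (ln (Rmax / b)).
have lnu : ln nu <= ln Rmax + l1.
  by rewrite -lnM ?posrE ?invr_gt0 // ler_ln ?posrE // divr_gt0.
rewrite -[nu in leLHS]lnK ?posrE // -[(1 - gamma)^-1]lnK ?posrE ?invr_gt0 //.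
rewrite powR_expR // -!expRD ler_expR.
have : beta * ln D <= 1 / 2 * ln D by rewrite ler_wpM2r.
rewrite mulNr lD; move: e3 lnu lnn; rewrite e2.
move: l1 (ln Rmax) (ln b) (ln n%:R) `|_| (ln nu) => v1 v2 v3 v4 v5 v6.
by move: (beta * _) => w; lra.
Qed.

(** [b / sqrt n = D^(-1/2) <= D^(-beta)], and [6 L] is the root of the factor lost between [n] and
    [H]. *)
Lemma validation_le beta : 1 <= D -> 0 <= beta <= 1 / 2 ->
  b / Num.sqrt H <= 6 * L * D `^ (- beta).
Proof.
move=> D1 /andP[b0 b1]; have L1 := level_ge1.
have L0 : 0 <= L by exact: le_trans ler01 L1.
have D0 : 0 < D by exact: lt_le_trans ltr01 D1.
have lD0 : 0 <= ln D by rewrite ln_ge0.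
have nL : 1 + ln n%:R <= L by rewrite lerDl.
have bl := budget_le pmax1 nL.
have sH : 0 < Num.sqrt H by rewrite sqrtr_gt0.
have sn : 0 < Num.sqrt n%:R :> R by rewrite sqrtr_gt0.
have h1 : Num.sqrt n%:R <= 6 * L * Num.sqrt H :> R.
  have -> : 6 * L * Num.sqrt H = Num.sqrt (36 * L ^+ 2 * H).
    have -> : 36 * L ^+ 2 = (6 * L) ^+ 2 by ring.
    have L6 : 0 <= 6 * L by rewrite mulr_ge0.
    by rewrite sqrtrM ?sqr_ge0 // sqrtr_sqr (ger0_norm L6).
  exact: ler_wsqrtr.
have h2 : b / Num.sqrt n%:R <= D `^ (- beta).
  apply: (@le_trans _ _ (D `^ (- (1 / 2)))).
    rewrite powRN [1 / 2]div1r powR12_sqrt ?(ltW D0) // sqrtrM ?ler0n //.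
    by rewrite sqrtrV ?sqr_ge0 // sqrtr_sqr ger0_norm ?(ltW b_gt0) // invfM invrK mulrC.
  by rewrite ler_powR // lerN2.
rewrite ler_pdivrMr //; apply: (@le_trans _ _ (b / Num.sqrt n%:R * (6 * L * Num.sqrt H))).
  by rewrite mulrAC ler_pdivlMr // ler_pM2l.
apply: (@le_trans _ _ (D `^ (- beta) * (6 * L * Num.sqrt H))).
  by rewrite ler_wpM2r // mulr_ge0 ?sqrtr_ge0 // mulr_ge0.
by rewrite le_eqVlt; apply/orP; left; apply/eqP; ring.
Qed.
End instance.
End regret.

(** Witnessed by a prefix of an optimal sequence. At depth [1] it forces [1 <= C * kappa], from
    which [kappa > 0] is read off. *)
Lemma near_optimal_gt0 (R : realType) (X : Type) (A : finType)
    (f : X -> A -> X) (r : X -> A -> R) (x : X) (gamma nu rho Rmax : R) k :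
  0 < gamma < 1 -> (forall y a, 0 <= r y a <= Rmax) ->
  optimum_attained f r gamma x -> smooth f r gamma x Rmax nu rho ->
  (0 < near_optimal f r gamma x k (3 * nu * rho ^+ k))%N.
Proof.
move=> g01 rb [s sopt] sm; have [/andP[nu0 _] /andP[r0 _] _] := sm.
apply/card_gt0P; exists (Tuple (introT eqP (size_mkseq s k))); rewrite inE /=.
apply: le_trans (u_optimal_prefix g01 rb k sm sopt).
rewrite lerD2l lerN2 ler_wpM2r ?exprn_ge0 ?(ltW r0) //.
by rewrite ler_peMl ?(ltW nu0) // ler1n.
Qed.

Lemma regret_bound (R : realType) (K : nat) (gamma nu rho kappa C : R)
    (X : Type) (A : finType) (f : X -> A -> X) (r : X -> A -> R) (x : X)
    (Rmax b : R) (d : measure_display) (W : measurableType d)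
    (P : probability W R) (Y : seq A -> A -> nat -> {RV P >-> R})
    (tie : rel (seq A)) (c0 : A) (n : nat) (t beta : R) :
  #|A| = K -> 0 < gamma < 1 -> (forall y a, 0 <= r y a <= Rmax) -> 0 < b ->
  0 < kappa -> 1 < C ->
  optimum_attained f r gamma x -> smooth f r gamma x Rmax nu rho ->
  (forall k, (near_optimal f r gamma x k (3 * nu * rho ^+ k))%:R <= C * kappa ^+ k) ->
  generative_model f r x b Y -> total tie -> transitive tie ->
  (1 <= pmax R n)%N -> 0 < t ->
  htilde_condition n gamma nu rho kappa C b Rmax t ->
  nu ^+ 2 * rho `^ (2 * t) /
    (gamma `^ (2 * t) * t * b ^+ 2 * gfactor n gamma b Rmax) <= 1 ->
  0 <= beta <= 1 / 2 ->
  beta * (ln (Num.max 1 (gamma ^+ 2 * kappa)) + 2 * ln rho^-1) = ln rho^-1 ->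
  ('E_P[fun w : W => simple_regret f r gamma x
      (recommended n gamma tie (fun s a k => Y s a k w) c0)] <=
    (regret_const K gamma nu rho kappa C *
      polylog n b Rmax (regret_degree gamma rho) *
      (n%:R / b ^+ 2) `^ (- beta))%:E)%E.
Proof.
move=> AK g01 rb b0 k0 C1 opt sm Nle gen tt ttr pm1 t0 tcond i1 be bM.
have [/andP[nu0 nuR] rg _] := sm.
have K0 : (0 < K)%N by rewrite -AK; apply/card_gt0P; exists c0.
have A0 : (0 < #|A|)%N by rewrite AK.
have [g0 g1] := andP g01; have [r0 rg1] := andP rg; have [be0 be1] := andP be.
have be01 : 0 <= beta <= 1 by rewrite be0 (le_trans be1) //; lra.
set L : R := 1 + ln n%:R + `|ln (Rmax / b)|.
have L1 : 1 <= L by exact: level_ge1.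
have L0 : 0 <= L by exact: le_trans ler01 L1.
set D : R := n%:R / b ^+ 2.
have n0 : 0 < n%:R :> R by rewrite ltr0n (budget_gt0 pm1).
have D0 : 0 < D by rewrite divr_gt0 // exprn_gt0.
set F := fun w : W => simple_regret _ _ _ _ _.
have F0 w : 0 <= F w by exact: simple_regret_ge0.
have Fnu w : F w <= nu by exact: (simple_regret_le_nu g01 rb _ sm).
have Db0 : 0 < D `^ (- beta) by exact: powR_gt0.
have Lm (i : nat) : (i <= regret_degree gamma rho)%N ->
    L ^+ i <= polylog n b Rmax (regret_degree gamma rho).
  by move=> im; rewrite /polylog ler_weXn2l.
set m := regret_degree gamma rho in Lm *.
have Lm0 : 1 <= polylog n b Rmax m by have := Lm 0%N (leq0n _); rewrite expr0.
have tc1 := trivial_const_ge1 nu.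
have ec0 := error_const_ge0 g01 K0.
have rc1 := rate_const_ge1 K nu g01 rg k0 C1.
have g2 : 0 < 1 - gamma ^+ 2 by rewrite subr_gt0 exprn_ilt1 // ltW.
have og : 0 < 1 - gamma by rewrite subr_gt0.
have rc0 := le_trans ler01 rc1.
have p1 : 0 <= 3 * nu * (rho^-1 * rate_const K gamma nu rho kappa C).
  by apply: mulr_ge0; [rewrite mulr_ge0 // ltW | rewrite mulr_ge0 // invr_ge0 ltW].
have p2 : 0 <= 12 * error_const K gamma / (1 - gamma ^+ 2).
  by rewrite divr_ge0 ?(ltW g2) // mulr_ge0.
have p3 : 0 <= (1 - gamma)^-1 by rewrite invr_ge0 ltW.
have p4 : 0 <= nu * trivial_const nu.
  by rewrite mulr_ge0 ?(ltW nu0) // (le_trans ler01 tc1).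
have [Dle|Dgt] := leP D (trivial_const nu).
  apply: (le_trans (expectation_le_split P (B := set0) (e := nu) (N := nu)
    measurable0 (ltW nu0) (ltW nu0) F0 Fnu (fun w _ => Fnu w))).
  rewrite measure0 mulr0 addr0 lee_fin.
  have h := powR_le_rate D0 Dle tc1 be01.
  apply: (@le_trans _ _ (nu * trivial_const nu * D `^ (- beta))).
    by rewrite -mulrA ler_peMr // ltW.
  rewrite ler_wpM2r ?(ltW Db0) // /regret_const.
  apply: (@le_trans _ _ (regret_const K gamma nu rho kappa C)).
    by rewrite /regret_const lerDr addr_ge0 // addr_ge0.
  rewrite ler_peMr // /regret_const addr_ge0 // addr_ge0 // addr_ge0 //.
have D1 : 1 <= D by exact: le_trans tc1 (ltW Dgt).
have gg := gfactor_ge g01 nu0 pm1 b0 nuR Dgt.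
have gl := gfactor_le g01 nu0 pm1 b0 nuR; rewrite -/L in gl.
pose g := gfactor n gamma b Rmax; rewrite -/g in gg gl.
pose j := discount_exponent gamma rho.
pose dc := depth_const gamma rho kappa.
(* The power [6] is that of [B^2]; it also covers the [1 + 2] of [U] and [g], while [Z^j] accounts
   for [3 j]. *)
pose V := inflation_const K gamma rho kappa * L ^+ (6 + 3 * j).
pose Z := shift_const gamma rho kappa * L ^+ 3.
pose U := dc * L.
pose B := b * (error_const #|A| gamma * L ^+ 3).
have dc1 : 1 <= dc by exact: depth_const_ge1.
have dc0 : 0 <= dc by exact: le_trans ler01 dc1.
have sc1 : 1 <= shift_const gamma rho kappa by exact: shift_const_ge1.
have ic1 : 1 <= inflation_const K gamma rho kappa by exact: inflation_const_ge1.
have gc0 := gfactor_const_ge0 g01.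
have U1 : 1 <= U by rewrite -[leLHS]mulr1 ler_pM.
have LX (i : nat) : 1 <= L ^+ i by rewrite exprn_ege1.
have Z1 : 1 <= Z by rewrite -[leLHS]mulr1 ler_pM.
have V1 : 1 <= V by rewrite -[leLHS]mulr1 ler_pM.
have LX0 (i : nat) : 0 <= L ^+ i by exact: le_trans ler01 (LX i).
have scj0 : 0 <= shift_const gamma rho kappa ^+ j.
  by rewrite exprn_ge0 // (le_trans ler01).
have ec2 : 0 <= error_const K gamma ^+ 2 by exact: sqr_ge0.
have tail0 : 0 <= 2 * dc * gfactor_const gamma * shift_const gamma rho kappa ^+ j.
  by apply: mulr_ge0 => //; apply: mulr_ge0 => //; exact: mulr_ge0.
have ic_ec : error_const K gamma ^+ 2 <= inflation_const K gamma rho kappa.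
  by rewrite /inflation_const addrAC lerDr addr_ge0.
have ic_tail : 2 * dc * gfactor_const gamma * shift_const gamma rho kappa ^+ j <=
    inflation_const K gamma rho kappa.
  by rewrite /inflation_const lerDr addr_ge0.
have sc_tail : 4 * dc * (dc + 1) ^+ 2 *
      expR (ln (Num.max 1 (gamma ^+ 2 * kappa)) + 2 * ln rho^-1) /
      Num.min 1 (gamma ^+ 2 * kappa) <= shift_const gamma rho kappa.
  by rewrite /shift_const lerDr.
have rc_tail : 144 * C * (dc + 1) ^+ 2 * inflation_const K gamma rho kappa /
    nu ^+ 2 <= rate_const K gamma nu rho kappa C by rewrite /rate_const lerDr.
have mE : m = (10 + 3 * j)%N by [].
have jspec : 2 * ln rho^-1 - 2 * ln gamma^-1 <= 2 * ln gamma^-1 * j%:R.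
  exact: discount_exponentP.
have Uspec y := @depth_const_spec R gamma nu rho kappa g01 nu0 rg k0 n b Rmax
  pm1 b0 nuR y.
rewrite -/L -/dc -/U in Uspec.
clearbody j dc m.
have B0 : 0 <= B by rewrite mulr_ge0 ?(ltW b0) // mulr_ge0 // AK.
have BV : B ^+ 2 <= b ^+ 2 * V.
  have -> : B ^+ 2 = b ^+ 2 * (error_const K gamma ^+ 2 * L ^+ 6) by rewrite /B AK; ring.
  rewrite ler_wpM2l ?sqr_ge0 //; apply: ler_pM; rewrite ?sqr_ge0 //.
  by rewrite ler_weXn2l // leq_addr.
have ZV : 2 * U * g * Z ^+ j <= V.
  apply: (@le_trans _ _ (2 * U * (gfactor_const gamma * L ^+ 2) * Z ^+ j)).
    rewrite ler_wpM2r ?exprn_ge0 ?(le_trans ler01 Z1) // ler_wpM2l //.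
    by rewrite mulr_ge0 // (le_trans ler01 U1).
  have -> : 2 * U * (gfactor_const gamma * L ^+ 2) * Z ^+ j =
    (2 * dc * gfactor_const gamma * shift_const gamma rho kappa ^+ j) *
      (L ^+ 3 * (L ^+ 3) ^+ j) by rewrite /U /Z exprMn; ring.
  apply: ler_pM => //; first by rewrite mulr_ge0 // exprn_ge0.
  by rewrite -exprM -exprD ler_weXn2l // leq_add2r.
have UZ : 4 * U * (U + 1) ^+ 2 * expR (ln (Num.max 1 (gamma ^+ 2 * kappa)) +
    2 * ln rho^-1) / Num.min 1 (gamma ^+ 2 * kappa) <= Z.
  have c10 : 0 < Num.min 1 (gamma ^+ 2 * kappa).
    by rewrite lt_min ltr01 mulr_gt0 // exprn_gt0.
  have U2 : (U + 1) ^+ 2 <= ((dc + 1) * L) ^+ 2.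
    have U3 : U + 1 <= (dc + 1) * L by rewrite mulrDl mul1r lerD2l.
    have U4 : 0 <= U + 1 by rewrite addr_ge0 // (le_trans ler01 U1).
    by rewrite lerXn2r ?nnegrE // (le_trans U4).
  apply: (@le_trans _ _ (4 * dc * (dc + 1) ^+ 2 *
      expR (ln (Num.max 1 (gamma ^+ 2 * kappa)) + 2 * ln rho^-1) /
      Num.min 1 (gamma ^+ 2 * kappa) * L ^+ 3)); last first.
    by rewrite ler_wpM2r.
  move: (expR _) (expR_ge0 (ln (Num.max 1 (gamma ^+ 2 * kappa)) + 2 * ln rho^-1)) => E E0.
  have -> : 4 * dc * (dc + 1) ^+ 2 * E / Num.min 1 (gamma ^+ 2 * kappa) * L ^+ 3 =
    4 * U * ((dc + 1) * L) ^+ 2 * E / Num.min 1 (gamma ^+ 2 * kappa).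
    by rewrite /U; ring.
  rewrite ler_wpM2r ?invr_ge0 ?(ltW c10) // ler_wpM2r // ler_wpM2l //.
  by rewrite mulr_ge0 // (le_trans ler01 U1).
have [h [hU big hp]] := depth_and_stratum g01 nu0 r0 rg1 k0 C1 b0 gg V1 B0 BV U1 Z1 t0
  (hmax_gt0 pm1) Uspec jspec
  ZV UZ (critical_depth_stratum g0 nu0 r0 b0 t0 tcond i1)
  (critical_depth_le g0 nu0 r0 k0 (lt_trans ltr01 C1) b0 t0 tcond) Nle.
have HL := hmax_le_expR b Rmax pm1; rewrite -/L in HL.
have [Bad [mBad PBad conc]] := concentration (hmax R n) b0 L0 A0 gen.
pose rate := D `^ (- beta).
have sH : 0 < Num.sqrt (hmax R n)%:R :> R by rewrite sqrtr_gt0 ltr0n hmax_gt0.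
pose e := 3 * nu * rho ^+ h + 2 * B / (Num.sqrt (hmax R n)%:R * (1 - gamma ^+ 2)).
have e2_0 : 0 <= 2 * B / (Num.sqrt (hmax R n)%:R * (1 - gamma ^+ 2)).
  by apply: divr_ge0; [exact: mulr_ge0 | exact: mulr_ge0 (ltW sH) (ltW g2)].
have nrh0 : 0 <= 3 * nu * rho ^+ h.
  by rewrite mulr_ge0 ?exprn_ge0 ?(ltW r0) // mulr_ge0 // ltW.
have e0 : 0 <= e by rewrite addr_ge0.
have Fe w : ~ Bad w -> F w <= e.
  (* At [h = 0] the term [3 * nu] already exceeds the regret, so no stratum is required. *)
  move=> /conc cw; have [h0|h0] := posnP h.
    apply: (le_trans (Fnu w)); rewrite /e h0 expr0 mulr1.
    apply: (@le_trans _ _ (3 * nu)); first by rewrite ler_peMl ?ler1n // ltW.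
    by rewrite lerDl.
  have [p hpp] := hp h0.
  exact: (regret_on_concentration c0 g01 rb b0 L1 opt sm tt ttr HL cw hpp).
apply: (le_trans (expectation_le_split P mBad e0 (ltW nu0) F0 Fnu Fe)).
rewrite lee_fin.
have f1 : nu * fine (P Bad) <= (1 - gamma)^-1 * rate.
  apply: le_trans (failure_le g01 nu0 pm1 b0 nuR D1 be).
  by rewrite ler_pM2l.
have f2 : 2 * B / (Num.sqrt (hmax R n)%:R * (1 - gamma ^+ 2)) <=
    12 * error_const K gamma / (1 - gamma ^+ 2) * L ^+ 4 * rate.
  have := validation_le Rmax pm1 b0 D1 be; rewrite -/L -/rate => vl.
  have -> : 2 * B / (Num.sqrt (hmax R n)%:R * (1 - gamma ^+ 2)) =
    2 * error_const K gamma / (1 - gamma ^+ 2) * L ^+ 3 * (b / Num.sqrt (hmax R n)%:R).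
    by rewrite /B AK; field; rewrite !gt_eqF.
  have -> : 12 * error_const K gamma / (1 - gamma ^+ 2) * L ^+ 4 * rate =
    2 * error_const K gamma / (1 - gamma ^+ 2) * L ^+ 3 * (6 * L * rate) by ring.
  rewrite ler_wpM2l // mulr_ge0 // divr_ge0 ?(ltW g2) // mulr_ge0 //.
have f3 : rho ^+ h <= rho^-1 * (rate_const K gamma nu rho kappa C * L ^+ m) * rate.
  apply: rate_from_depth be01 bM _ => //.
    by rewrite -[leLHS]mulr1 ler_pM.
  have nL : 1 + ln n%:R <= L by rewrite lerDl.
  have bl := budget_le pm1 nL.
  have b2 : 0 < b ^+ 2 by rewrite exprn_gt0.
  have n2 : 0 < nu ^+ 2 by rewrite exprn_gt0.
  rewrite /D ltr_pdivrMr //; apply: (le_lt_trans bl).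
  have L2 : 0 < 36 * L ^+ 2 by rewrite mulr_gt0 // (lt_le_trans ltr01).
  rewrite -(ltr_pM2l L2) in big; apply: (lt_le_trans big).
  move: (expR _) (expR_ge0 (h.+1%:R * (ln (Num.max 1 (gamma ^+ 2 * kappa)) +
    2 * ln rho^-1))) => E E0.
  have -> : 36 * L ^+ 2 * (4 * C * h.+1%:R ^+ 2 * (b ^+ 2 / nu ^+ 2) * V * E) =
    (144 * C / nu ^+ 2 * L ^+ 2 * V * E * b ^+ 2) * h.+1%:R ^+ 2 by ring.
  have C0 : 0 <= C by exact: le_trans ler01 (ltW C1).
  have pos : 0 <= 144 * C / nu ^+ 2 * L ^+ 2 * V * E * b ^+ 2.
    rewrite mulr_ge0 ?(ltW b2) // mulr_ge0 // mulr_ge0 ?(le_trans ler01 V1) //.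
    by rewrite mulr_ge0 // divr_ge0 ?(ltW n2) // mulr_ge0.
  apply: (@le_trans _ _ (144 * C / nu ^+ 2 * L ^+ 2 * V * E * b ^+ 2 *
      ((dc + 1) * L) ^+ 2)).
    have h1 : h.+1%:R <= (dc + 1) * L by rewrite -natr1 mulrDl mul1r lerD.
    rewrite ler_wpM2l //; apply: lerXn2r => //; rewrite nnegrE //.
    exact: le_trans h1.
  have -> : 144 * C / nu ^+ 2 * L ^+ 2 * V * E * b ^+ 2 * ((dc + 1) * L) ^+ 2 =
    (144 * C * (dc + 1) ^+ 2 * inflation_const K gamma rho kappa / nu ^+ 2) *
      (L ^+ 2 * L ^+ 2 * L ^+ (6 + 3 * j)) * E * b ^+ 2 by rewrite /V; ring.
  rewrite ler_wpM2r ?(ltW b2) // ler_wpM2r //; apply: ler_pM.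
  - rewrite divr_ge0 ?(ltW n2) // mulr_ge0 ?(le_trans ler01 ic1) //.
    by rewrite mulr_ge0 ?sqr_ge0 // mulr_ge0.
  - by rewrite mulr_ge0 // mulr_ge0.
  - exact: rc_tail.
  by rewrite -!exprD mE ler_weXn2l.
have rate0 : 0 <= rate by exact: ltW.
have q1 : 3 * nu * rho ^+ h <=
    3 * nu * (rho^-1 * rate_const K gamma nu rho kappa C) * L ^+ m * rate.
  have -> : 3 * nu * (rho^-1 * rate_const K gamma nu rho kappa C) * L ^+ m * rate =
    3 * nu * (rho^-1 * (rate_const K gamma nu rho kappa C * L ^+ m) * rate) by ring.
  by rewrite ler_wpM2l // mulr_ge0 // ltW.
have q2 : 12 * error_const K gamma / (1 - gamma ^+ 2) * L ^+ 4 * rate <=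
    12 * error_const K gamma / (1 - gamma ^+ 2) * L ^+ m * rate.
  by rewrite ler_wpM2r // ler_wpM2l // mE ler_weXn2l.
have q3 : (1 - gamma)^-1 * rate <= (1 - gamma)^-1 * L ^+ m * rate.
  by rewrite ler_wpM2r // ler_peMr.
have q4 : 0 <= nu * trivial_const nu * L ^+ m * rate.
  by rewrite mulr_ge0 // mulr_ge0.
have dist (y1 y2 y3 y4 y5 y6 : R) : (y1 + y2 + y3 + y4) * y5 * y6 =
  y1 * y5 * y6 + y2 * y5 * y6 + y3 * y5 * y6 + y4 * y5 * y6 by ring.
rewrite /regret_const dist -[leLHS]addr0; apply: lerD q4.
by apply: lerD (le_trans f1 q3); exact: lerD q1 (le_trans f2 q2).
Qed.

Theorem theorem3 (R : realType) (K : nat) (gamma nu rho kappa C : R) :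
  exists (c : R) (m : nat), 0 < c /\
  forall (X : Type) (A : finType) (f : X -> A -> X) (r : X -> A -> R) (x : X)
    (Rmax b : R) (d : measure_display) (W : measurableType d)
    (P : probability W R) (Y : seq A -> A -> nat -> {RV P >-> R})
    (tie : rel (seq A)) (c0 : A) (n : nat) (htilde htilde1 htilde2 : R),
    #|A| = K ->
    0 < gamma < 1 ->
    (forall y a, 0 <= r y a <= Rmax) ->
    0 < b ->
    optimum_attained f r gamma x ->
    smooth f r gamma x Rmax nu rho ->
    kappa = branching_factor f r gamma x nu rho ->
    branching_constant f r gamma x nu rho C ->
    generative_model f r x b Y ->
    total tie -> transitive tie ->
    (1 <= pmax R n)%N ->
    is_htilde1 n gamma nu rho kappa C b Rmax htilde1 ->
    is_htilde2 n gamma nu rho C b Rmax htilde2 ->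
    is_htilde n gamma nu rho kappa C b Rmax htilde ->
    high_noise n gamma nu rho kappa b Rmax htilde htilde1 htilde2 ->
    let expected_regret := ('E_P[fun w : W =>
      simple_regret f r gamma x
        (recommended n gamma tie (fun s a k => Y s a k w) c0)])%E in
    (gamma ^+ 2 * kappa <= 1 ->
      (expected_regret <=
        (c * polylog n b Rmax m * (n%:R / b ^+ 2) `^ (- (1 / 2)))%:E)%E) /\
    (1 < gamma ^+ 2 * kappa ->
      (expected_regret <=
        (c * polylog n b Rmax m *
          (n%:R / b ^+ 2) `^
            (- (ln (1 / rho) / ln (gamma ^+ 2 * kappa / rho ^+ 2))))%:E)%E).
Proof.
(* The constants are chosen before the problem. If the parameters are not admissible, no problem
   realises them and any constants do. *)
have [adm|nadm] := pselect ([/\ 0 < gamma < 1, 0 < nu, 0 < rho <= gamma &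
    [/\ 0 < kappa, 1 < C & (0 < K)%N]]); last first.
  exists 1, 0%N; split => // X A f r x Rmax b d W P Y tie c0 n t t1 t2.
  move=> AK g01 rb b0 opt sm kE [C1 Nle] _ _ _ _ _ _ _ _ er; case: nadm.
  have [/andP[nu0 _] rg _] := sm; split => //; split => //; last first.
    by rewrite -AK; apply/card_gt0P; exists c0.
  have /(leq_trans (ltn0Sn 0)) := near_optimal_gt0 1 g01 rb opt sm.
  have := Nle 1%N; rewrite -kE expr1 => N1 _.
  have : 1 <= C * kappa.
    by apply: le_trans N1; rewrite ler1n (near_optimal_gt0 1 g01 rb opt sm).
  by move=> /(lt_le_trans ltr01); rewrite pmulr_rgt0 // (lt_trans ltr01).
have [g01 nu0 rg [k0 C1 K0]] := adm.
exists (regret_const K gamma nu rho kappa C), (regret_degree gamma rho).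
split; first exact: regret_const_gt0.
move=> X A f r x Rmax b d W P Y tie c0 n t t1 t2 AK _ rb b0 opt sm kE [_ Nle] gen.
move=> tt ttr pm _ _ [t0 tcond _] [i1 _ _] er.
have [r0 rg1] := andP rg; have [g0 g1] := andP g01.
have r1 : rho < 1 by exact: le_lt_trans g1.
have rr0 : 0 < ln rho^-1 by rewrite ln_gt0 // invf_gt1.
have Nle' k : (near_optimal f r gamma x k (3 * nu * rho ^+ k))%:R <= C * kappa ^+ k.
  by rewrite kE.
have bound beta := regret_bound (beta := beta) c0 AK g01 rb b0 k0 C1 opt sm Nle' gen
  tt ttr pm t0 tcond i1.
have lnE : 1 < gamma ^+ 2 * kappa -> ln (gamma ^+ 2 * kappa / rho ^+ 2) =
    ln (gamma ^+ 2 * kappa) + 2 * ln rho^-1.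
  move=> /(lt_trans ltr01) gk; have r2 : 0 < rho ^+ 2 by rewrite exprn_gt0.
  rewrite ln_div ?posrE // (lnXn 2 r0) lnV ?posrE //.
  by rewrite -[ln rho *+ 2]mulr_natl mulrN.
have den : 1 < gamma ^+ 2 * kappa ->
    0 < ln (gamma ^+ 2 * kappa) + 2 * ln rho^-1.
  by move=> gt1; rewrite addr_gt0 ?ln_gt0 // mulr_gt0.
(* In both regimes [beta] is [ln (1 / rho)] over [ln mu + 2 ln (1 / rho)], which is [1/2] for
   [mu = 1] and at most [1/2] in general since [ln mu >= 0]. *)
split => [le1|gt1]; apply: bound.
- by rewrite divr_ge0 //= lexx.
- by rewrite (max_idPl le1) ln1 add0r mulrA divfK ?mul1r.
- have gk : 0 < ln (gamma ^+ 2 * kappa) by rewrite ln_gt0.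
  rewrite lnE // [1 / rho]div1r divr_ge0 ?(ltW rr0) ?(ltW (den gt1)) //=.
  rewrite ler_pdivrMr ?den //.
  by move: gk; move: (ln _) (ln _) => v w ?; lra.
by rewrite (max_idPr (ltW gt1)) lnE // [1 / rho]div1r divfK // gt_eqF // den.
Qed.
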